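(* Let $(k_{a,c}, p_{a,c}, \varphi_{a,c})$, $(a,c)\in(-a_0,a_0)\times(-c_0,c_0)$, be the family of small periodic solutions, and let $u_{a,c}$ be the generalized solitary waves, with parameters $a_1, M_1, \ell, \theta, c_2(\ell), a_2(\ell)$, described in the context. Let $$\mathcal B_{a,c} = \partial_z^2\left(k_{a,c}^4\partial_z^4+k_{a,c}^2\partial_z^2-c+p_{a,c}\right),\qquad \mathcal C_{a,c}=\partial_x^2\left(\partial_x^4+\partial_x^2-c+u_{a,c}\right).$$ Let $c_3\in(0,c_0]$, $a_3\in(0,a_0]$ and, for all $c\in(-c_3,c_3)\setminus\{0\}$ and $a\in(-a_3,a_3)\setminus\{0\}$, $\Lambda_{a,c}>0$ be constants such that for all such $a,c$ and all $\Lambda\in(0,\Lambda_{a,c})$ the operator $\Lambda\partial_z-\mathcal B_{a,c}$ acting in $L^2(0,2\pi)$ with domain $H^6_{\mathrm{per}}(0,2\pi)$ has a simple negative eigenvalue (such constants exist). Let $0<\ell<\pi$ and $0<\theta<1$. Then for any $c\in(0,c_2(\ell)]$ with $c<c_3$, any $a$ with $|a|\in[a_2(\ell)\,c\,e^{-\ell/\sqrt c},a_1]$ and $|a|<a_3$, and any $\Lambda\in(0,\Lambda_{a,c})$, the linear operator $k_{a,c}\Lambda\partial_x-\mathcal C_{a,c}$ acting in $L^2(\mathbb R)$ with domain $H^6(\mathbb R)$ has negative essential spectrum, i.e. its essential spectrum contains a negative real number. Consequently, for these $a$ and $c$, the generalized solitary wave $u_{a,c}$ is transversely essentially unstable.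
   Context: Equation. The fifth-order KP equation is $\partial_t\partial_x u = \partial_x^2(\partial_x^4 u+\partial_x^2u+\frac12u^2)+\partial_y^2u$. Its line traveling waves of speed $c$ considered here are, in a comoving frame, solutions $u=u(x)$ of $$\partial_x^4 u + \partial_x^2 u - cu + \tfrac12 u^2 = 0. \qquad ( * )$$ Function spaces. $H^j_{\mathrm{per}}(0,2\pi)=\{f\in H^j_{\mathrm{loc}}(\mathbb R): f(z+2\pi)=f(z)\ \forall z\in\mathbb R\}$. Periodic waves (previously known existence result). There exist positive constants $c_0,a_0$ such that for any $c\in(-c_0,c_0)$ equation $( * )$ has a one-parameter family of even periodic solutions $(\varphi_{a,c})_{a\in(-a_0,a_0)}$ of the form $\varphi_{a,c}(x)=p_{a,c}(k_{a,c}x)$, $x\in\mathbb R$, such that: (i) the real-valued map $(a,c)\mapsto k_{a,c}$ is analytic on $(-a_0,a_0)\times(-c_0,c_0)$ and $k_{a,c}=k_0(c)+c\,\widetilde k(a,c)$, with $k_0(c)=\left(\frac{1+\sqrt{1+4c}}{2}\right)^{1/2}$ and $\widetilde k(a,c)=\sum_{n\ge1}\widetilde k_{2n}(c)a^{2n}$, where $|\widetilde k_{2n}(c)|\le K_0/\rho_0^{2n}$ for all $n\ge1$ and some positive constants $K_0,\rho_0$; (ii) the map $(a,c)\mapsto p_{a,c}$ is analytic on $(-a_0,a_0)\times(-c_0,c_0)$ with values in $H^6_{\mathrm{per}}(0,2\pi)$ and $$p_{a,c}(z)=ac\cos(z)+c\sum_{n,m\ge0,\ n+m\ge2,\ n-m\ne\pm1}\widetilde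 p_{n,m}(c)\,e^{i(n-m)z}a^{n+m},$$ where the $\widetilde p_{n,m}(c)$ are real, $\widetilde p_{n,m}(c)=\widetilde p_{m,n}(c)$, and $|\widetilde p_{n,m}(c)|\le C_0/\rho_0^{n+m}$ for all $c\in(-c_0,c_0)$ and some positive constant $C_0$; (iii) the Fourier coefficients $\widehat p_q(a,c)$ of $p_{a,c}(z)=\sum_{q\in\mathbb Z}\widehat p_q(a,c)e^{iqz}$ are real, $\widehat p_0(a,c)=O(ca^2)$ and $\widehat p_q(a,c)=O(c|a|^{|q|})$ for $q\ne0$, as $a\to0$; $a\mapsto\widehat p_q(a,c)$ is even (resp. odd) for even (resp. odd) $q$, so that $p_{-a,c}(z)=p_{a,c}(z+\pi)$. The family is fixed once and for all. Generalized solitary waves (known existence result). There exist positive constants $a_1$ and $M_1$ such that for any $0<\ell<\pi$ and $0<\theta<1$ there exist $c_2(\ell)>0$ and $a_2(\ell)>0$ such that for all $c\in(0,c_2(\ell)]$ and $|a|\in[a_2(\ell)\,c\,e^{-\ell/\sqrt c},a_1]$, equation $( * )$ possesses an even solution $$u_{a,c}(x)=h_{a,c}(x)+\varphi_{a,c}\big(x+\tau_{a,c}\tanh(\sqrt c\,x/2)\big),$$ where $|\partial_x^jh_{a,c}(x)|\le M_1\,c\,e^{-\theta\sqrt c|x|}$ for $j=0,1,2,3$ and all $x\in\mathbb R$, $\varphi_{a,c}$ is the periodic solution above, and the asymptotic phase shift $\tau_{a,c}\in\mathbb R$ satisfies $\tau_{a,c}=O(1)$ as $(a,c)\to(0,0)$.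 These $u_{a,c}$ are called generalized solitary waves. Operators. In expressions such as $\mathcal B_{a,c}$ and $\mathcal C_{a,c}$, functions act by multiplication, e.g. $\mathcal C_{a,c}f=\partial_x^2(\partial_x^4f+\partial_x^2f-cf+u_{a,c}f)$. Essential spectrum. For a closed operator $T$, $\sigma_{\mathrm{ess}}(T)=\{\nu\in\mathbb C: T-\nu \text{ is not Fredholm with index } 0\}$. Instability notion. $u_{a,c}$ is called transversely essentially unstable (with respect to localized longitudinal perturbations) if there exist $\lambda\in\mathbb C$ with $\Re\lambda>0$ and $\omega\in\mathbb R$ such that $-\omega^2$ is negative and belongs to the essential spectrum of $\lambda\partial_x-\mathcal C_{a,c}$ acting in $L^2(\mathbb R)$ with domain $H^6(\mathbb R)$. *)

(* Defs.v *)
From HB Require Import structures.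
From mathcomp Require Import all_boot all_order all_algebra finmap.
From mathcomp Require Import complex.
From mathcomp Require Import all_classical all_reals all_analysis.
Set Implicit Arguments.
Unset Strict Implicit.
Unset Printing Implicit Defensive.
Import Order.TTheory GRing.Theory Num.Theory.
Import numFieldTopology.Exports numFieldNormedType.Exports.
Local Open Scope classical_set_scope.
Local Open Scope ring_scope.
Local Open Scope complex_scope.

Section Sobolev.
Variable R : realType.
Local Notation mu := (@lebesgue_measure R).

Definition test_function (w : R -> R) : Prop :=
  (forall n x, derivable (derive1n n w) x 1) /\
  (exists M : R, forall x, M < `|x| -> w x = 0).

Definition weak_deriv (n : nat) (f g : R -> R) : Prop :=
  [/\ locally_integrable setT f, locally_integrable setT g &
      forall w, test_function w ->
        (\int[mu]_x (f x * derive1n n w x) = (-1) ^+ n * \int[mu]_x (g x * w x))%R].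

Definition L2 (f : R -> R) : Prop := f \in Lfun mu 2%:E.

Definition L2loc (f : R -> R) : Prop :=
  forall K : set R, compact K -> L2 (fun x => \1_K x * f x).

Definition Hs (s : nat) (f : R -> R) : Prop :=
  L2 f /\ forall j, (j <= s)%N -> exists2 g, weak_deriv j f g & L2 g.

Definition Hs_loc (s : nat) (f : R -> R) : Prop :=
  L2loc f /\ forall j, (j <= s)%N -> exists2 g, weak_deriv j f g & L2loc g.

Definition Hs_per (s : nat) (f : R -> R) : Prop :=
  Hs_loc s f /\ forall z, f (z + 2 * pi) = f z.

(* Graph of the norm of H^s_per(0,2pi); weak derivatives are only determined
   almost everywhere, so the norm is given as a relation. *)
Definition Hs_per_norm (s : nat) (f : R -> R) (r : R) : Prop :=
  Hs_per s f /\
  exists2 g : nat -> R -> R,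
    forall j, (j <= s)%N -> weak_deriv j f (g j) /\ L2loc (g j) &
    r = Num.sqrt (\sum_(j < s.+1)
          (\int[mu]_(z in `[0%R, (2 * pi)%R]) (g j z ^+ 2))%R).

(* Elements of complex L^2 spaces are represented by functions R -> R[i],
   identified when equal almost everywhere.  A space P of real functions is
   complexified componentwise. *)
Definition cplx (P : (R -> R) -> Prop) (f : R -> R[i]) : Prop :=
  P (fun x => complex.Re (f x)) /\ P (fun x => complex.Im (f x)).

Definition cweak_deriv (n : nat) (f g : R -> R[i]) : Prop :=
  weak_deriv n (fun x => complex.Re (f x)) (fun x => complex.Re (g x)) /\
  weak_deriv n (fun x => complex.Im (f x)) (fun x => complex.Im (g x)).

Definition null (f : R -> R[i]) : Prop := {ae mu, forall x, f x = 0}.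

Definition sqdist (f g : R -> R[i]) : R :=
  (\int[mu]_x (complex.Re (f x - g x) ^+ 2 + complex.Im (f x - g x) ^+ 2))%R.

End Sobolev.

Section Spectra.
Variable R : realType.
Local Notation mu := (@lebesgue_measure R).

(* An unbounded operator is given by its graph: [T f g] means that f is in the
   domain of T and that g represents T f. *)
Definition operator := (R -> R[i]) -> (R -> R[i]) -> Prop.

(* The quotient of U by its subspace W has dimension n. *)
Definition quot_dim (U W : (R -> R[i]) -> Prop) (n : nat) : Prop :=
  exists2 e : 'I_n -> R -> R[i], forall i, U (e i) &
    forall f, U f -> exists! a : 'rV[R[i]]_n,
      W (fun x => f x - \sum_i a 0 i * e i x).

Definition shift_op (T : operator) (nu : R[i]) : operator :=
  fun f g => T f (fun x => g x + nu * f x).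

Definition ker (T : operator) (f : R -> R[i]) : Prop := T f (fun=> 0).

Definition range_op (T : operator) (g : R -> R[i]) : Prop := exists f, T f g.

Definition closed_in_L2 (W : (R -> R[i]) -> Prop) : Prop :=
  forall (g_ : nat -> R -> R[i]) (g : R -> R[i]),
    (forall n, W (g_ n)) -> cplx (@L2 R) g ->
    sqdist (g_ n) g @[n --> \oo] --> (0 : R) -> W g.

Definition fredholm_index0 (T : operator) : Prop :=
  closed_in_L2 (range_op T) /\
  exists n, quot_dim (ker T) (@null R) n /\
            quot_dim (cplx (@L2 R)) (range_op T) n.

(* Intended for closed operators T in L^2(R; C). *)
Definition ess_spectrum (T : operator) (nu : R[i]) : Prop :=
  ~ fredholm_index0 (shift_op T nu).

Definition eigenvalue (T : operator) (nu : R[i]) : Prop :=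
  exists2 f, ~ null f & ker (shift_op T nu) f.

Fixpoint ker_pow (T : operator) (n : nat) (f : R -> R[i]) : Prop :=
  if n is m.+1 then exists2 g, T f g & ker_pow T m g else null f.

(* Algebraic multiplicity one. *)
Definition simple_eigenvalue (T : operator) (nu : R[i]) : Prop :=
  eigenvalue T nu /\
  quot_dim (fun f => exists n, ker_pow (shift_op T nu) n f) (@null R) 1.

(* g = lam f' - (al f'''' + be f'' - c f + v f)'', almost everywhere and with
   weak derivatives. *)
Definition kp_expr (lam : R[i]) (al be c : R) (v : R -> R) : operator :=
  fun f g => exists f1 f2 f4 w : R -> R[i],
  [/\ cweak_deriv 1 f f1, cweak_deriv 2 f f2, cweak_deriv 4 f f4,
      cweak_deriv 2 (fun x => al%:C * f4 x + be%:C * f2 x - c%:C * f x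
                              + (v x)%:C * f x) w &
      {ae mu, forall x, g x = lam * f1 x - w x}].

(* lam d_x - C in L^2(R) with domain H^6(R). *)
Definition line_op (lam : R[i]) (c : R) (u : R -> R) : operator :=
  fun f g => [/\ cplx (Hs 6) f, cplx (@L2 R) g & kp_expr lam 1 1 c u f g].

(* Lam d_z - B in L^2(0,2pi) with domain H^6_per(0,2pi); elements of
   L^2(0,2pi) are represented by their 2pi-periodic extensions. *)
Definition per_op (Lam k c : R) (p : R -> R) : operator :=
  fun f g => [/\ cplx (Hs_per 6) f, cplx (Hs_per 0) g &
                 kp_expr Lam%:C (k ^+ 4) (k ^+ 2) c p f g].

Definition transversely_essentially_unstable (c : R) (u : R -> R) : Prop :=
  exists lam : R[i], 0 < complex.Re lam /\
  exists omega : R, - omega ^+ 2 < 0 /\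
    ess_spectrum (line_op lam c u) (- omega ^+ 2)%:C.

End Spectra.

Section Waves.
Variable R : realType.
Local Notation mu := (@lebesgue_measure R).

Definition line_wave (c : R) (u : R -> R) : Prop :=
  (forall j x, (j < 4)%N -> derivable (derive1n j u) x 1) /\
  (forall x, derive1n 4 u x + derive1n 2 u x - c * u x + 2^-1 * u x ^+ 2 = 0).

(* Real analyticity in two variables of a map into a real normed space whose
   norm is given by its graph: near each point of the domain the map is the sum
   of a normally convergent power series. *)
Definition analytic2 (V : lmodType R) (nrm : V -> R -> Prop)
    (D : R -> R -> Prop) (F : R -> R -> V) : Prop :=
  forall a1 c1, D a1 c1 ->
  exists (P : nat -> nat -> V) (r K : R), 0 < r /\
  (forall m n, exists2 N, nrm (P m n) N & N * r ^+ (m + n) <= K) /\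
  (forall a c, `|a - a1| < r -> `|c - c1| < r ->
   forall e, 0 < e -> exists N0, forall N, (N0 <= N)%N ->
   exists2 d, nrm (F a c - \sum_(m < N) \sum_(n < N)
                     ((a - a1) ^+ m * (c - c1) ^+ n) *: P m n) d & d < e).

(* Unconditional (unordered) sum over the indices satisfying P. *)
Definition has_sum (I : choiceType) (V : numFieldType) (P : pred I)
    (x : I -> V) (s : V) : Prop :=
  forall e, 0 < e -> exists A : {fset I}, forall B : {fset I},
    (A `<=` B)%fset -> `|s - \sum_(i <- B | P i) x i| < e.

Definition cis (t : R) : R[i] := cos t +i* sin t.

Definition cintegral (D : set R) (f : R -> R[i]) : R[i] :=
  (\int[mu]_(x in D) complex.Re (f x))%R
  +i* (\int[mu]_(x in D) complex.Im (f x))%R.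

Definition fourier_coef (f : R -> R) (q : int) : R[i] :=
  (2 * pi)^-1%:C *
  cintegral `[0, 2 * pi] (fun z => (f z)%:C * cis (- (q%:~R * z))).

Definition k0 (c : R) : R := Num.sqrt ((1 + Num.sqrt (1 + 4 * c)) / 2).

Definition phi_of (k : R -> R -> R) (p : R -> R -> R -> R) (a c x : R) : R :=
  p a c (k a c * x).

(* Indices (n, m) with n + m >= 2 and n - m <> +1, -1. *)
Definition p_index (i : nat * nat) : bool :=
  [&& (2 <= i.1 + i.2)%N, i.1 != i.2.+1 & i.2 != i.1.+1].

(* [kt n] is the coefficient of index 2n of the expansion of k. *)
Definition periodic_family (a0 c0 : R) (k : R -> R -> R)
    (p : R -> R -> R -> R) : Prop :=
  let D (a c : R) := `|a| < a0 /\ `|c| < c0 in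
  [/\ 0 < a0 /\ 0 < c0,
      (forall a c, D a c -> line_wave c (phi_of k p a c) /\
         forall x, phi_of k p a c (- x) = phi_of k p a c x),
      analytic2 (V := R^o) (fun x r => r = `|x|) D k,
      (analytic2 (V := R -> R^o) (Hs_per_norm 6) D p /\
       forall a c, D a c -> Hs_per 6 (p a c)) &
      [/\ (exists (K0 C0 rho0 : R) (kt : nat -> R -> R)
                  (pt : nat -> nat -> R -> R),
        [/\ 0 < K0, 0 < C0, 0 < rho0,
         (forall c, `|c| < c0 -> forall n, (1 <= n)%N ->
            `|kt n c| <= K0 / rho0 ^+ (2 * n)) /\
         (forall a c, D a c -> exists2 ktilde : R,
            series (fun n => kt n.+1 c * a ^+ (2 * n.+1)) n @[n --> \oo]
              --> ktilde &
            k a c = k0 c + c * ktilde) &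
         (forall c, `|c| < c0 -> forall n m, p_index (n, m) ->
            pt n m c = pt m n c /\ `|pt n m c| <= C0 / rho0 ^+ (n + m)) /\
         (forall a c, D a c -> forall z, exists2 s : R[i],
            has_sum p_index (fun i : nat * nat =>
              (pt i.1 i.2 c)%:C * cis ((i.1%:R - i.2%:R) * z)
              * (a ^+ (i.1 + i.2))%:C) s &
            (p a c z)%:C = (a * c * cos z)%:C + c%:C * s)]),
       (forall a c, D a c -> forall q,
          complex.Im (fourier_coef (p a c) q) = 0),
       (exists K d : R, 0 < d /\ forall a c, D a c -> `|a| < d ->
          `|fourier_coef (p a c) 0| <= (K * `|c| * a ^+ 2)%:C),
       (forall q : int, q != 0 -> exists K d : R, 0 < d /\
          forall a c, D a c -> `|a| < d ->
          `|fourier_coef (p a c) q| <= (K * `|c| * `|a| ^+ absz q)%:C) &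
       (forall a c, D a c ->
          (forall q, fourier_coef (p (- a) c) q =
                     (-1) ^+ absz q * fourier_coef (p a c) q) /\
          (forall z, p (- a) c z = p a c (z + pi)))]].

Definition tanh (x : R) : R :=
  (expR x - expR (- x)) / (expR x + expR (- x)).

(* phi is indexed by |a| < a0, |c| < c0. *)
Definition gen_solitary_waves (a0 c0 : R) (phi : R -> R -> R -> R) (a1 M1 : R)
    (c2 a2 : R -> R) (tau : R -> R -> R -> R -> R)
    (h u : R -> R -> R -> R -> R -> R) : Prop :=
  [/\ 0 < a1, 0 < M1 &
  forall l th, 0 < l < pi -> 0 < th < 1 ->
  let D (a c : R) := [/\ 0 < c <= c2 l,
     a2 l * c * expR (- (l / Num.sqrt c)) <= `|a| <= a1,
     `|a| < a0 & c < c0] in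
  [/\ 0 < c2 l, 0 < a2 l,
   (forall a c, D a c ->
     [/\ line_wave c (u l th a c),
         (forall x, u l th a c (- x) = u l th a c x),
         (forall x, u l th a c x = h l th a c x +
            phi a c (x + tau l th a c * tanh (Num.sqrt c * x / 2))),
         (forall j x, (j < 3)%N -> derivable (derive1n j (h l th a c)) x 1) &
         (forall j x, (j <= 3)%N -> `|derive1n j (h l th a c) x| <=
            M1 * c * expR (- (th * Num.sqrt c * `|x|)))]) &
   (exists K d : R, 0 < d /\ forall a c, D a c ->
      `|a| < d -> `|c| < d -> `|tau l th a c| <= K)]].

End Waves.

(* Main.v *)
Require Import Defs.
From mathcomp Require Import all_boot all_order all_algebra finmap.
From mathcomp Require Import complex.
From mathcomp Require Import all_classical all_reals all_analysis.
From mathcomp Require Import measurable_realfun ring lra.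
Set Implicit Arguments.
Unset Strict Implicit.
Unset Printing Implicit Defensive.
Import Order.TTheory GRing.Theory Num.Theory.
Import numFieldTopology.Exports numFieldNormedType.Exports.
Local Open Scope classical_set_scope.
Local Open Scope ring_scope.

(** The wave [u] approaches the shifted periodic wave [phi (x + tau)] exponentially
fast as [x] tends to [+oo], so a periodic eigenfunction is almost an
eigenfunction on the line once it is cut off far to the right; such functions
prevent the range of [k L d_x - C - k^2 nu] from being closed.  All coefficients
are real, so real and imaginary parts are treated separately and the analysis
takes place over [R].

The change of variable [z = k (x + tau)] turns [L d_z - B] into
[k^-2 (k L d_x - C_oo)], where [C_oo] has the limiting potential.  A periodic
eigenfunction with eigenvalue [nu < 0] becomes a periodic [psi] on the line with
eigenvalue [k^2 nu < 0] ([line_eigenfunction]).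

For [0 <= r <= 6] let [m_r = x^(r/24)], cut off on the left.  The derivatives of
[m_r] are [O(x^(-3/4))], and [m_r] times the difference of the two potentials is of
the same order, so [g_r = (k L d_x - C - k^2 nu) (m_r psi)] is [O(x^(-3/4))]
([residual_bound]); it is square integrable although [m_r psi] is not.
Cutting [m_r] off on the right gives elements of the range that converge to [g_r].
If the range were closed, [g_r] would be the image of some [f_r] in [H^6].  The
seven functions [m_r psi - f_r] solve one homogeneous linear equation of order
six, so a nontrivial combination of them vanishes for [x >= 0]
([solutions_dependent]).  Then [P(x^(1/24)) psi], for a nonzero polynomial [P], is
square integrable at [+oo], which a nonzero periodic [psi] does not allow
([periodic_not_L2]).  So the range is not closed ([weyl_not_closed]), and the
operator is not Fredholm.

The functions in the operator domains are only known through weak derivatives.  A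
function with a weak derivative is a primitive of it up to a null set: testing
against smooth approximations of the indicator of an interval gives the increment [f b - f a] at Lebesgue points
([weak_deriv1_lebesgue_pt]).  Reading the equation once more makes domain
elements with continuous image six times differentiable ([kp_regularity]).

The rescaling, and the sign of [lam = k L], require [k > 0]
([wavenumber_positive]).  At amplitude [0] one has [k = k0(c) > 0].  If [k] first
vanishes at an amplitude [t a], then letting [k -> 0] in
[k^4 p'''' + k^2 p'' = c p - p^2/2] shows that the profile there takes its values
in [{0, 2c}], so it is constant; but with [k = 0] and a constant profile the
periodic operator [L d_z - B] has no negative eigenvalue, contrary to the
hypothesis on the periodic family at that amplitude. *)

(** * Functions with their derivatives *)

Section Towers.
Variable R : realType.
Implicit Types (F G : nat -> R -> R) (f g : R -> R).

(** A function together with its successive derivatives; carrying the derivatives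
along avoids iterating [derive1] and makes Leibniz' rule computable. *)
Definition tower (n : nat) F : Prop :=
  forall j (x : R), (j < n)%N -> is_derive x 1 (F j) (F j.+1 x).

Definition smooth F : Prop := forall j (x : R), is_derive x 1 (F j) (F j.+1 x).

Lemma smooth_tower n F : smooth F -> tower n F.
Proof. by move=> sF j x _; exact: sF. Qed.

Lemma tower_le m n F : (m <= n)%N -> tower n F -> tower m F.
Proof. by move=> mn tF j x jm; apply: tF; exact: leq_trans jm mn. Qed.

Lemma is_derive_continuous f (x d : R) : is_derive x 1 f d -> {for x, continuous f}.
Proof.
by move=> [df _]; apply: differentiable_continuous; exact/derivable1_diffP.
Qed.

Lemma tower_continuous n F j : tower n F -> (j < n)%N -> continuous (F j).
Proof. by move=> tF jn x; apply: is_derive_continuous; exact: tF. Qed.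

Lemma tower_continuous_le n F j : tower n F -> continuous (F n) -> (j <= n)%N ->
  continuous (F j).
Proof.
by move=> tF cF; rewrite leq_eqVlt => /predU1P[->//|]; exact: tower_continuous.
Qed.

Lemma is_derive_unique f (x d d' : R) :
  is_derive x 1 f d -> is_derive x 1 f d' -> d = d'.
Proof. by move=> [_ <-] [_ <-]. Qed.

Lemma is_derive_ext f g (x d d' : R) :
  is_derive x 1 f d -> f =1 g -> d = d' -> is_derive x 1 g d'.
Proof. by move=> fd fg <-; rewrite -(_ : f = g)//; exact/funext. Qed.

Lemma tower_derive1n n F j : tower n F -> (j <= n)%N -> derive1n j (F 0%N) = F j.
Proof.
move=> tF; elim: j => [//|j IH] jn; rewrite derive1nS IH ?(ltnW jn)//.
by apply/funext => x; rewrite derive1E; case: (tF j x jn) => _ ->.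
Qed.

Lemma derivable_tower n f :
  (forall j x, (j < n)%N -> derivable (derive1n j f) x 1) ->
  tower n (fun j => derive1n j f).
Proof.
move=> df j x jn; split; first exact: df.
by rewrite derive1nS derive1E.
Qed.

(** Used at the points where a flat function vanishes. *)
Lemma quadratic_is_derive0 f (x C : R) :
  (forall y, `|f y - f x| <= C * (y - x) ^+ 2) -> is_derive x 1 f 0.
Proof.
move=> H.
have C0 : 0 <= C.
  by have := le_trans (normr_ge0 _) (H (x + 1)); rewrite addrAC subrr add0r expr1n mulr1.
have cv : h^-1 *: ((f \o shift x) h%:A - f x) @[h --> (0:R)^'] --> (0:R).
  apply/cvgrPdist_le => e e0; near=> h.
  have h0 : h != 0 by near: h; exact: nbhs_dnbhs_neq.
  rewrite sub0r normrN normrM normfV /= -[_ *: 1]/(h * 1) mulr1.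
  have := H (h + x); rewrite addrK => Hh.
  rewrite ler_pdivrMl ?normr_gt0//; apply: (le_trans Hh).
  rewrite (_ : h ^+ 2 = `|h| * `|h|); last by rewrite -expr2 real_normK ?num_real.
  rewrite mulrA [leRHS]mulrC.
  rewrite ler_wpM2r//.
  have : `|h| < e / (C + 1).
    near: h; apply: dnbhs0_lt; rewrite divr_gt0//; lra.
  rewrite ltr_pdivlMr; last lra.
  by move=> hh; rewrite mulrC; apply: le_trans (ltW hh); rewrite ler_wpM2l//; lra.
split; first by apply/cvg_ex; exists 0.
exact/cvg_lim.
Unshelve. all: by end_near. Qed.

End Towers.

(** * The functions P(1/x) exp(-1/x) *)

Section FlatFunctions.
Variable R : realType.
Implicit Types (P : {poly R}) (x y : R).

(** [P(1/x) exp(-1/x)] extended by zero.  The class is closed under derivation, which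
is why the polynomial factor is part of the definition. *)
Definition flat P x : R := if 0 < x then P.[x^-1] * expR (- x^-1) else 0.

(** A single term of the exponential series is at most its sum. *)
Lemma exprn_expRN_le n y : 0 <= y -> y ^+ n * expR (- y) <= n`!%:R.
Proof.
move=> y0; rewrite expRN ler_pdivrMr ?expR_gt0//.
case: n => [|n]; first by rewrite expr0 fact0 mul1r -expR0 ler_expR.
have := expR_ge1Dxn n y0 => H.
have f0 : (0:R) < n.+1`!%:R by rewrite ltr0n fact_gt0.
rewrite -ler_pdivrMl// mulrC; apply: le_trans H; lra.
Qed.

(** The bound is quadratic because that is what makes the derivative vanish at every
point of the half-line where the function is zero, including the origin. *)
Lemma flat_bound P : exists C, forall x, `|flat P x| <= C * x ^+ 2.
Proof.
exists (\sum_(i < size P) `|P`_i| * (i.+2)`!%:R) => x; rewrite /flat.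
case: ifPn => [x0|_]; last first.
  rewrite normr0 mulr_ge0 ?sqr_ge0//; apply: sumr_ge0 => i _.
  by rewrite mulr_ge0.
have y0 : 0 < x^-1 by rewrite invr_gt0.
rewrite -ler_pdivrMr ?exprn_gt0// -exprVn.
move: (x^-1) y0 => y y0.
rewrite horner_coef normrM (ger0_norm (expR_ge0 _)) -mulrA.
rewrite (le_trans (ler_wpM2r _ (ler_norm_sum _ _ _)))//.
  by rewrite mulr_ge0 ?expR_ge0// exprn_ge0// ltW.
rewrite big_distrl /=; apply: ler_sum => i _.
rewrite normrM -mulrA ler_wpM2l// (ger0_norm (exprn_ge0 _ (ltW y0))).
have H := exprn_expRN_le i.+2 (ltW y0).
by rewrite [expR _ * _]mulrC mulrA -exprD addn2.
Qed.

Lemma flat_le0 P x : x <= 0 -> flat P x = 0.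
Proof. by rewrite /flat leNgt; case: (0 < x). Qed.

Lemma is_derive_flat P x :
  is_derive x 1 (flat P) (flat ('X^2 * (P - P^`())) x).
Proof.
have [x0|x0] := leP x 0.
  rewrite (flat_le0 _ x0); have [C HC] := flat_bound P.
  have C0 : 0 <= C.
    have := le_trans (normr_ge0 _) (HC 1).
    by rewrite expr1n mulr1.
  apply: (@quadratic_is_derive0 _ _ _ C) => y; rewrite (flat_le0 _ x0) subr0.
  have [y0|y0] := leP y 0.
    by rewrite flat_le0// normr0 mulr_ge0// sqr_ge0.
  apply: le_trans (HC y) _; rewrite ler_wpM2l// lerXn2r ?nnegrE//; lra.
have D : is_derive x 1 (fun y => P.[y^-1] * expR (- y^-1))
    (flat ('X^2 * (P - P^`())) x).
  have xn0 : x != 0 by rewrite gt_eqF.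
  have dV : is_derive x 1 (fun y : R => y^-1) (- (x ^- 2)).
    have D := @is_deriveV R id x 1 1 xn0 (is_derive_id x 1).
    by apply: is_derive_ext D _ _ => //=; exact: mulr1.
  have d1 := @is_derive1_comp _ (horner P) _ _ _ _ (is_derive_poly P (x^-1)) dV.
  have dN : is_derive x 1 (fun y : R => - y^-1) (x ^- 2).
    by apply: is_derive_eq; rewrite opprK.
  have d2 := @is_derive1_comp _ expR (fun y => - y^-1) _ _ _ (is_derive_expR (- x^-1)) dN.
  apply: is_derive_ext (is_deriveM d1 d2) _ _ => //=.
  rewrite /flat x0 !hornerE /= -exprVn.
  rewrite -![_ *: _]/(_ * _); ring.
apply: near_eq_is_derive D; near=> y; rewrite /flat ifT//.
by near: y; exact: lt_nbhsr.
Unshelve. all: by end_near. Qed.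

(** Numerators of the successive derivatives of [exp(-1/x)]. *)
Definition flat_poly (j : nat) : {poly R} := iter j (fun P => 'X^2 * (P - P^`())) 1.

Lemma smooth_flat : smooth (fun j => flat (flat_poly j)).
Proof. by move=> j x; exact: is_derive_flat. Qed.

Lemma flat0_gt0 x : 0 < x -> 0 < flat (flat_poly 0) x.
Proof. by move=> x0; rewrite /flat x0 hornerE mul1r expR_gt0. Qed.

Lemma flat0_ge0 x : 0 <= flat (flat_poly 0) x.
Proof. by rewrite /flat; case: ifP => // _; rewrite hornerE mul1r expR_ge0. Qed.

End FlatFunctions.

(** * Primitives of locally integrable functions *)

Section Primitives.
Variable R : realType.
Local Notation mu := (@lebesgue_measure R).
Local Notation loc_int := (@locally_integrable R setT).
Implicit Types (f g : R -> R) (a b x : R).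

Lemma loc_int_compact f (K : set R) : compact K -> loc_int f ->
  mu.-integrable K (EFin \o f).
Proof.
move=> cK [mf _ /(_ K (@subsetT _ _)) H].
apply/integrableP; split; last exact: H.
by apply/measurable_EFinP; apply: measurable_funTS.
Qed.

Lemma loc_int_itv f a b : loc_int f -> mu.-integrable `[a, b] (EFin \o f).
Proof. by apply: loc_int_compact; exact: segment_compact. Qed.

Lemma continuous_loc_int f : continuous f -> loc_int f.
Proof.
move=> cf; split; [exact: continuous_measurable_fun|exact: openT|].
move=> K _ cK.
have : mu.-integrable K (EFin \o f).
  by apply: continuous_compact_integrable => //; exact: continuous_subspaceT.
by case/integrableP.
Qed.

Lemma Rint_split f a b c : loc_int f -> a <= b -> b <= c ->
  (\int[mu]_(x in `[a, c]) f x =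
   \int[mu]_(x in `[a, b]) f x + \int[mu]_(x in `[b, c]) f x)%R.
Proof.
move=> lf ab bc.
have H := @Rintegral_itvB R f (BLeft a) (BRight c) b (loc_int_itv _ _ lf).
rewrite -(@Rintegral_itv_obnd_cbnd _ b (BRight c)); last first.
  apply: integrableS (loc_int_itv b c lf) => //.
  by apply: subset_itvr; rewrite bnd_simp.
by rewrite -H ?bnd_simp// addrC subrK.
Qed.

Lemma continuous_sqr f : continuous f -> continuous (fun x => f x ^+ 2).
Proof.
move=> cf; rewrite (_ : (fun x => f x ^+ 2) = (fun x => f x * f x)).
  by move=> x; apply: cvgM; exact: cf.
by apply/funext => x; rewrite expr2.
Qed.

(** One of the two integrals is always over an empty set or a point, so no case
distinction on the sign of [x] is needed. *)
Definition primitive f x : R :=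
  (\int[mu]_(t in `[0%R, x]) f t - \int[mu]_(t in `[x, 0%R]) f t)%R.

Lemma Rint_itv_gt f a b : b < a -> (\int[mu]_(t in `[a, b]) f t = 0)%R.
Proof. by move=> ba; rewrite set_itv_ge ?bnd_simp -?ltNge// Rintegral_set0. Qed.

Lemma Rint_itv1 f a : (\int[mu]_(t in `[a, a]) f t = 0)%R.
Proof. by rewrite set_itv1 Rintegral_set1. Qed.

Lemma primitive_ge0 f x : 0 <= x -> primitive f x = (\int[mu]_(t in `[0%R, x]) f t)%R.
Proof.
rewrite /primitive le_eqVlt => /predU1P[<-|x0]; first by rewrite !Rint_itv1 subr0.
by rewrite (Rint_itv_gt _ x0) subr0.
Qed.

Lemma primitive_le0 f x : x <= 0 -> primitive f x = - (\int[mu]_(t in `[x, 0%R]) f t)%R.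
Proof.
rewrite /primitive le_eqVlt => /predU1P[->|x0]; first by rewrite !Rint_itv1 subr0 oppr0.
by rewrite (Rint_itv_gt _ x0) sub0r.
Qed.

Lemma primitiveB f a b : loc_int f -> a <= b ->
  primitive f b - primitive f a = (\int[mu]_(t in `[a, b]) f t)%R.
Proof.
move=> lf ab; have [a0|a0] := leP 0 a.
  rewrite !primitive_ge0 ?(le_trans a0 ab)// (Rint_split lf a0 ab); ring.
have [b0|b0] := leP 0 b.
  by rewrite (primitive_ge0 _ b0) (primitive_le0 _ (ltW a0)) (Rint_split lf (ltW a0) b0); ring.
rewrite !primitive_le0 ?(ltW a0) ?(ltW b0)// (Rint_split lf ab (ltW b0)); ring.
Qed.

(** The basepoint of the fundamental theorem of calculus must lie strictly to the left
of [x]; additivity of the integral allows one to replace [0] by [x - 1]. *)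
Lemma primitive_derive f x : loc_int f -> {for x, continuous f} ->
  is_derive x 1 (primitive f) (f x).
Proof.
move=> lf cf.
have E y : x - 1 <= y ->
    primitive f y = primitive f (x - 1) + (\int[mu]_(t in `[(x - 1)%R, y]) f t)%R.
  by move=> yx; rewrite -primitiveB//; ring.
have [d1 d2] : derivable (fun y => \int[mu]_(t in `[(x - 1)%R, y]) f t)%R x 1 /\
   derive1 (fun y => \int[mu]_(t in `[(x - 1)%R, y]) f t)%R x = f x.
  apply: (@continuous_FTC1_closed _ f (x - 1) x (x + 1)) => //.
  - by rewrite ltrDl.
  - exact: loc_int_itv.
  - by rewrite ltrBlDr ltrDl.
have D : is_derive x 1 (fun y => \int[mu]_(t in `[(x - 1)%R, y]) f t)%R (f x).
  by split; [exact: d1|rewrite -derive1E; exact: d2].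
have D2 : is_derive x 1 (fun y => primitive f (x - 1) +
    (\int[mu]_(t in `[(x - 1)%R, y]) f t)%R) (f x).
  have := is_deriveD (is_derive_cst (primitive f (x - 1)) x 1) D.
  by move/is_derive_ext; apply => //; rewrite add0r.
apply: near_eq_is_derive D2; near=> y; rewrite -E//.
by apply/ltW; near: y; apply: lt_nbhsr; rewrite ltrBlDr ltrDl.
Unshelve. all: by end_near. Qed.

Lemma primitive_continuous f : loc_int f -> continuous (primitive f).
Proof.
move=> lf x.
have E y : x - 1 <= y ->
    primitive f y = primitive f (x - 1) + (\int[mu]_(t in `[(x - 1)%R, y]) f t)%R.
  by move=> yx; rewrite -primitiveB//; ring.
have xx : x - 1 < x + 1 by lra.
have := @parameterized_integral_continuous R (x - 1) (x + 1) f (ltW xx)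
  (loc_int_itv _ _ lf).
move/(continuous_within_itvP _ xx) => [H _ _].
have {}H : {for x, continuous (fun y => \int[mu]_(t in `[(x - 1)%R, y]) f t)%R}.
  by apply: H; rewrite in_itv/=; lra.
have H2 : {for x, continuous (fun y => primitive f (x - 1) +
   (\int[mu]_(t in `[(x - 1)%R, y]) f t)%R)}.
  by apply: cvgD => //; exact: cvg_cst.
rewrite /continuous_at E; last lra.
apply: cvg_trans H2; apply: near_eq_cvg; near=> y; rewrite -E//.
by apply/ltW; near: y; apply: lt_nbhsr; lra.
Unshelve. all: by end_near. Qed.

Lemma zero_derivative_constant f : (forall x : R, is_derive x 1 f 0) -> forall x y, f x = f y.
Proof. by move=> H x y; exact: is_derive_0_is_cst. Qed.

Lemma integral_derivative (F f : R -> R) a b : (forall x : R, is_derive x 1 F (f x)) -> continuous f ->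
  a <= b -> (\int[mu]_(t in `[a, b]) f t)%R = F b - F a.
Proof.
move=> dF cf ab; have lf := continuous_loc_int cf.
rewrite -primitiveB//.
have : (primitive f - F) b = (primitive f - F) a.
  apply: zero_derivative_constant => x.
  have := is_deriveB (primitive_derive lf (cf x)) (dF x).
  by rewrite subrr.
rewrite /= !fctE; lra.
Qed.

End Primitives.

(** * Leibniz rule and affine changes of variable *)

Section Leibniz.
Variable R : realType.
Implicit Types (F G : nat -> R -> R).

(** The [j]-th derivative of a product, written as a recursion without binomial
coefficients: derive the left factor or derive the right one. *)
Fixpoint leibniz (j : nat) F G : R -> R :=
  if j is i.+1 then fun x => leibniz i (fun k => F k.+1) G x + leibniz i F (fun k => G k.+1) x
  else fun x => F 0%N x * G 0%N x.

Lemma is_derive_leibniz j F G (x : R) :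
  (forall i, (i <= j)%N -> is_derive x 1 (F i) (F i.+1 x)) ->
  (forall i, (i <= j)%N -> is_derive x 1 (G i) (G i.+1 x)) ->
  is_derive x 1 (leibniz j F G) (leibniz j.+1 F G x).
Proof.
elim: j F G => [|j IH] F G dF dG.
  apply: is_derive_ext (is_deriveM (dF 0%N (leqnn _)) (dG 0%N (leqnn _))) _ _ => //=.
  by rewrite -![_ *: _]/(_ * _) addrC [G _ _ * _]mulrC.
apply: is_derive_ext (is_deriveD (IH _ _ _ _) (IH _ _ _ _)) _ _ => //=.
- by move=> i ij; apply: dF.
- by move=> i ij; apply: dG; exact: leq_trans ij _.
- by move=> i ij; apply: dF; exact: leq_trans ij _.
- by move=> i ij; apply: dG.
Qed.

Lemma leibniz_continuous j F G : (forall i, (i <= j)%N -> continuous (F i)) ->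
  (forall i, (i <= j)%N -> continuous (G i)) -> continuous (leibniz j F G).
Proof.
elim: j F G => [|j IH] F G cF cG x.
  by apply: cvgM; [exact: cF|exact: cG].
apply: cvgD; apply: IH => i ij.
- exact: cF.
- by apply: cG; exact: leqW.
- by apply: cF; exact: leqW.
- exact: cG.
Qed.

Lemma tower_leibniz n F G : tower n F -> tower n G ->
  tower n (fun j => leibniz j F G).
Proof.
move=> tF tG j x jn; apply: is_derive_leibniz => i ij.
  by apply: tF; exact: leq_ltn_trans ij jn.
by apply: tG; exact: leq_ltn_trans ij jn.
Qed.

(** There are [2^j] terms in the recursion. *)
Lemma leibniz_le_terms j F G x (N : R) :
  (forall i, (i <= j)%N -> `|F i x| * `|G (j - i)%N x| <= N) ->
  `|leibniz j F G x| <= 2 ^+ j * N.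
Proof.
elim: j F G => [|j IH] F G H /=.
  by rewrite expr0 mul1r normrM (H 0%N).
apply: (le_trans (ler_normD _ _)); rewrite exprS -mulrA mulr_natl mulr2n lerD//.
  by apply: IH => i ij; exact: (H i.+1).
by apply: IH => i ij; have := H i (leqW ij); rewrite subSn.
Qed.

Lemma leibniz_eq0l j F G x : (forall i, (i <= j)%N -> F i x = 0) -> leibniz j F G x = 0.
Proof.
move=> H; apply/eqP; rewrite -normr_le0 -[leRHS](mulr0 (2 ^+ j)).
by apply: leibniz_le_terms => i ij; rewrite H// normr0 mul0r.
Qed.

Lemma eq_leibniz j F F' G G' x : (forall i, (i <= j)%N -> F i x = F' i x) ->
  (forall i, (i <= j)%N -> G i x = G' i x) -> leibniz j F G x = leibniz j F' G' x.
Proof.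
elim: j F F' G G' => [|j IH] F F' G G' HF HG /=; first by rewrite HF ?HG.
by congr (_ + _); apply: IH => i ij; by [exact: HF|exact: HG|
  apply: HF; exact: leqW|apply: HG; exact: leqW].
Qed.

(** The derivatives of [F 0 (r x + s)]. *)
Definition affine_tower F (r s : R) (j : nat) (x : R) := r ^+ j * F j (r * x + s).

Lemma is_derive_affine f (r s x d : R) :
  is_derive (r * x + s) 1 f d -> is_derive x 1 (fun y => f (r * y + s)) (r * d).
Proof.
move=> df.
have d1 : is_derive x 1 (fun y : R => r * y + s) r.
  have := is_deriveD (is_deriveZ r (is_derive_id x 1)) (is_derive_cst s x 1).
  by move/is_derive_ext; apply => //=; rewrite addr0; exact: mulr1.
have := @is_derive1_comp _ f (fun y : R => r * y + s) x _ _ df d1.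
by rewrite mulrC.
Qed.

Lemma tower_affine n F r s : tower n F -> tower n (affine_tower F r s).
Proof.
move=> tF j x jn.
have := is_deriveZ (r ^+ j) (is_derive_affine (tF j (r * x + s) jn)).
move/is_derive_ext; apply => //=.
by rewrite /affine_tower exprSr -mulrA.
Qed.

End Leibniz.

(** * A smooth step *)

Section SmoothStep.
Variable R : realType.
Local Notation mu := (@lebesgue_measure R).

Let fl (j : nat) : R -> R := flat (flat_poly R j).

(** The product [exp(-1/x) exp(-1/(1-x))], supported in [[0, 1]]. *)
Definition raw_bump (j : nat) : R -> R := leibniz j fl (affine_tower fl (-1) 1).

Let bump_mass : R := primitive (raw_bump 0) 1.

Lemma smooth_raw_bump : smooth raw_bump.
Proof.
have tF n : tower n fl by apply: smooth_tower; exact: smooth_flat.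
move=> j x; apply: (@tower_leibniz R j.+1 fl (affine_tower fl (-1) 1)) => //.
exact: tower_affine.
Qed.

Lemma raw_bump_out j (x : R) : x <= 0 \/ 1 <= x -> raw_bump j x = 0.
Proof.
rewrite /raw_bump /affine_tower => H.
have : (forall i, fl i x = 0) \/ (forall i, affine_tower fl (-1) 1 i x = 0).
  case: H => H; [left|right] => i; first exact: flat_le0.
  by rewrite /affine_tower /fl flat_le0 ?mulr0//; lra.
rewrite -/(affine_tower fl (-1) 1).
move: {H} fl (affine_tower _ _ _) => F G.
elim: j F G => [|j IH] F G [H|H] /=; rewrite ?H ?mul0r ?mulr0//;
  rewrite !IH ?addr0//; by [left|right].
Qed.

Lemma raw_bump_ge0 (x : R) : 0 <= raw_bump 0 x.
Proof. by rewrite /raw_bump /= /affine_tower expr0 mul1r mulr_ge0 ?flat0_ge0. Qed.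

Lemma raw_bump_gt0 (x : R) : 0 < x < 1 -> 0 < raw_bump 0 x.
Proof.
move=> /andP[x0 x1]; rewrite /raw_bump /= /affine_tower expr0 mul1r mulr_gt0 ?flat0_gt0//.
lra.
Qed.

Lemma smooth_continuous (F : nat -> R -> R) j : smooth F -> continuous (F j).
Proof. by move=> sF x; apply: is_derive_continuous (sF j x). Qed.

Lemma mean_value (F f : R -> R) (a b : R) : a < b ->
  (forall x : R, is_derive x 1 F (f x)) ->
  exists2 z, z \in `]a, b[%R & F b - F a = f z * (b - a).
Proof.
move=> ab dF; apply: MVT => //.
by apply: continuous_subspaceT => x; exact: is_derive_continuous (dF x).
Qed.

Lemma derive_pos_increasing (F f : R -> R) (a b : R) : a < b ->
  (forall x : R, is_derive x 1 F (f x)) -> (forall x, a < x < b -> 0 < f x) ->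
  F a < F b.
Proof.
move=> ab dF f0.
have [z zab E] := mean_value ab dF.
rewrite -subr_gt0 E mulr_gt0 ?subr_gt0// f0//.
Qed.

Lemma derive_ge0_nondecreasing (F f : R -> R) (a b : R) : a <= b ->
  (forall x : R, is_derive x 1 F (f x)) -> (forall x, a < x < b -> 0 <= f x) ->
  F a <= F b.
Proof.
rewrite le_eqVlt => /predU1P[->//|ab] dF f0.
have [z zab E] := mean_value ab dF.
rewrite -subr_ge0 E mulr_ge0 ?subr_ge0 ?(ltW ab)//; exact: f0.
Qed.

Let derive_raw_primitive (x : R) : is_derive x 1 (primitive (raw_bump 0)) (raw_bump 0 x).
Proof.
have cb : continuous (raw_bump 0) by apply: smooth_continuous; exact: smooth_raw_bump.
by apply: primitive_derive (cb x); exact: continuous_loc_int.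
Qed.

Lemma bump_mass_gt0 : 0 < bump_mass.
Proof.
rewrite (_ : 0 = primitive (raw_bump 0) 0); last first.
  by rewrite primitive_ge0// Rint_itv1.
by apply: derive_pos_increasing => //; exact: raw_bump_gt0.
Qed.

Definition unit_bump (j : nat) (x : R) : R := bump_mass^-1 * raw_bump j x.

(** The smooth transition from [0] to [1] across [[0, 1]]. *)
Definition unit_step (j : nat) (x : R) : R :=
  if j is i.+1 then unit_bump i x else bump_mass^-1 * primitive (raw_bump 0) x.

Lemma smooth_unit_bump : smooth unit_bump.
Proof.
move=> j x; have := is_deriveZ bump_mass^-1 (smooth_raw_bump j x).
by move/is_derive_ext; apply.
Qed.

Lemma smooth_unit_step : smooth unit_step.
Proof.
case=> [|j] x; last exact: smooth_unit_bump.
have := is_deriveZ bump_mass^-1 (derive_raw_primitive x).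
by move/is_derive_ext; apply.
Qed.

Lemma bump_out j (x : R) : x <= 0 \/ 1 <= x -> unit_bump j x = 0.
Proof. by move=> H; rewrite /unit_bump raw_bump_out// mulr0. Qed.

Lemma bump_ge0 (x : R) : 0 <= unit_bump 0 x.
Proof. by rewrite mulr_ge0 ?raw_bump_ge0// invr_ge0 ltW// bump_mass_gt0. Qed.

Lemma step_le0 (x : R) : x <= 0 -> unit_step 0 x = 0.
Proof.
move=> x0; rewrite /unit_step primitive_le0// (@eq_Rintegral _ _ _ _ _ (cst 0)).
  by rewrite Rintegral_cst// mul0r oppr0 mulr0.
by move=> t; rewrite inE/= in_itv/= => /andP[_ t0]; rewrite raw_bump_out//; left.
Qed.

Lemma step_ge1 (x : R) : 1 <= x -> unit_step 0 x = 1.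
Proof.
move=> x1.
have E : unit_step 0 1 = 1 by rewrite /unit_step mulVf// gt_eqF// bump_mass_gt0.
apply/eqP; rewrite eq_le; apply/andP; split.
  rewrite -E -lerN2.
  apply: (@derive_ge0_nondecreasing (fun x => - unit_step 0 x) (fun x => - unit_bump 0 x)) => //.
    by move=> y; exact: is_deriveN (smooth_unit_step 0 y).
  by move=> y /andP[y1 _]; rewrite bump_out ?oppr0//; right; exact: ltW.
rewrite -{1}E.
apply: (@derive_ge0_nondecreasing _ (unit_bump 0)) => //.
  by move=> y; exact: (smooth_unit_step 0 y).
by move=> y _; exact: bump_ge0.
Qed.

Lemma step_ge0_le1 (x : R) : 0 <= unit_step 0 x <= 1.
Proof.
have mono (a b : R) : a <= b -> unit_step 0 a <= unit_step 0 b.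
  move=> ab; apply: (@derive_ge0_nondecreasing _ (unit_bump 0)) => //.
    by move=> y; exact: (smooth_unit_step 0 y).
  by move=> y _; exact: bump_ge0.
have [x0|x0] := leP x 0; first by rewrite step_le0// lexx ler01.
have [x1|x1] := leP 1 x; first by rewrite step_ge1// lexx ler01.
rewrite -(@step_ge1 1)// -{1}(@step_le0 0)//; apply/andP; split; apply: mono; exact: ltW.
Qed.

End SmoothStep.

(** * Almost everywhere identities and local bounds *)

Section AlmostEverywhere.
Variable R : realType.
Local Notation mu := (@lebesgue_measure R).
Local Notation loc_int := (@locally_integrable R setT).
Implicit Types (f g : R -> R) (a b x : R).

Lemma ae_imp2 (P Q S : R -> Prop) : (forall x, P x -> Q x -> S x) ->
  {ae mu, forall x, P x} -> {ae mu, forall x, Q x} -> {ae mu, forall x, S x}.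
Proof. move=> PQS; exact: (@filterS2 _ _ (ae_filter_ringOfSetsType mu) P Q S PQS). Qed.

Lemma ae_imp (P Q : R -> Prop) : (forall x, P x -> Q x) ->
  {ae mu, forall x, P x} -> {ae mu, forall x, Q x}.
Proof. move=> PQ; exact: (@filterS _ _ (ae_filter_ringOfSetsType mu) P Q PQ). Qed.

Lemma ae_and (P Q : R -> Prop) :
  {ae mu, forall x, P x} -> {ae mu, forall x, Q x} -> {ae mu, forall x, P x /\ Q x}.
Proof. by apply: ae_imp2. Qed.

Lemma ae_everywhere (P : R -> Prop) : (forall x, P x) -> {ae mu, forall x, P x}.
Proof. by move=> H; apply: aeW. Qed.

Lemma ae_Rintegral f g (D : set R) : measurable D -> measurable_fun D f -> measurable_fun D g ->
  {ae mu, forall x, f x = g x} ->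
  (\int[mu]_(x in D) f x = \int[mu]_(x in D) g x)%R.
Proof.
move=> mD mf mg fg; rewrite /Rintegral; congr fine.
apply: ae_eq_integral => //; try exact/measurable_EFinP.
by apply: ae_imp fg => x /= ->.
Qed.

Lemma ae_primitive f g : loc_int f -> loc_int g -> {ae mu, forall x, f x = g x} ->
  primitive f = primitive g.
Proof.
move=> [mf _ _] [mg _ _] fg; apply/funext => x; rewrite /primitive.
congr (_ - _); apply: ae_Rintegral => //; exact: measurable_funTS.
Qed.

Lemma interval_not_null a b (P : R -> Prop) : a < b -> {ae mu, forall x, P x} ->
  exists2 x, a < x < b & P x.
Proof.
move=> ab [N [mN N0 sN]]; apply: contrapT => H.
have : mu `]a, b[ = 0%E.
  apply: (@subset_measure0 _ _ _ mu _ N) => // x /=; rewrite in_itv/= => xab.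
  by apply: sN => Px; apply: H; exists x.
rewrite lebesgue_measure_itv/= lte_fin ab -EFinB => -[]; lra.
Qed.

(** Turns almost-everywhere identities between classical expressions into identities. *)
Lemma ae_eq_continuous f g : continuous f -> continuous g ->
  {ae mu, forall x, f x = g x} -> f = g.
Proof.
move=> cf cg fg; apply/funext => x; apply: contrapT => /eqP nfg.
have cd : {for x, continuous (fun y => `|f y - g y|)}.
  by apply: cvg_norm; apply: cvgB; [exact: cf|exact: cg].
have d0 : 0 < `|f x - g x| by rewrite normr_gt0 subr_eq0.
have /nbhs_ballP[e /= e0 He] : \forall y \near x, 0 < `|f y - g y|.
  by move/cvgr_gt : cd; apply.
have [y /andP[y1 y2] Ey] := @interval_not_null (x - e) (x + e) _ ltac:(lra) fg.
have : 0 < `|f y - g y| by apply: He; rewrite /ball/= ltr_norml; lra.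
by rewrite Ey subrr normr0 ltxx.
Qed.

Lemma continuous_itv_bounded f a b : continuous f ->
  exists2 M, 0 <= M & forall x, a <= x <= b -> `|f x| <= M.
Proof.
move=> cf; have [ab|ba] := leP a b; last by exists 0 => // x; lra.
have cn : {within `[a, b], continuous (fun y => `|f y|)}.
  by apply: continuous_subspaceT => x; apply: cvg_norm; exact: cf.
have [c _ Hc] := EVT_max ab cn.
by exists `|f c| => // x xab; apply: Hc; rewrite in_itv.
Qed.

Lemma bounded_family n (f : nat -> R -> R) (D : R -> Prop) :
  (forall j, (j <= n)%N -> exists2 M, 0 <= M & forall x, D x -> `|f j x| <= M) ->
  exists2 M, 0 <= M & forall j x, (j <= n)%N -> D x -> `|f j x| <= M.
Proof.
elim: n => [|n IH] H.
  have [M M0 HM] := H 0%N isT; exists M => // j x; rewrite leqn0 => /eqP ->; exact: HM.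
have [M M0 HM] := IH (fun j jn => H j (leqW jn)).
have [N N0 HN] := H n.+1 (leqnn _); exists (M + N); first exact: addr_ge0.
move=> j x; rewrite leq_eqVlt => /predU1P[-> Dx|jn Dx].
  by apply: le_trans (HN x Dx) _; rewrite lerDr.
by apply: le_trans (HM j x jn Dx) _; rewrite lerDl.
Qed.

Lemma Rint_support f a b : (forall x, x < a \/ b < x -> f x = 0) ->
  (\int[mu]_x f x = \int[mu]_(x in `[a, b]) f x)%R.
Proof.
move=> f0; rewrite [RHS]Rintegral_mkcond; apply: eq_Rintegral => x _.
rewrite patchE; case: ifPn => //; rewrite notin_setE/= in_itv/= => /negP.
rewrite negb_and -!ltNge => /orP xab; rewrite f0//; exact: xab.
Qed.

End AlmostEverywhere.

(** * Weak derivatives of classical functions *)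

Section WeakDerivatives.
Variable R : realType.
Local Notation mu := (@lebesgue_measure R).
Local Notation loc_int := (@locally_integrable R setT).
Implicit Types (f g : R -> R) (a b x : R).

Lemma smooth_test (W : nat -> R -> R) (M : R) : smooth W ->
  (forall x, M < `|x| -> W 0%N x = 0) -> test_function (W 0%N).
Proof.
move=> sW W0; split; last by exists M.
move=> n x; rewrite (tower_derive1n (@smooth_tower _ n _ sW))//.
by case: (sW n x).
Qed.

Lemma smooth_derive1n (W : nat -> R -> R) n : smooth W -> derive1n n (W 0%N) = W n.
Proof. by move=> sW; rewrite (tower_derive1n (@smooth_tower _ n _ sW)). Qed.

Lemma test_smooth (w : R -> R) : test_function w -> smooth (fun j => derive1n j w).
Proof.
move=> [dw _] j x; have := @derivable_tower R j.+1 w (fun i x _ => dw i x).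
by move=> /(_ j x (leqnn _)).
Qed.

(** The complement of a closed interval is open, so vanishing there passes to the
derivative. *)
Lemma zero_off_derive (F f : R -> R) (M : R) : (forall x : R, is_derive x 1 F (f x)) ->
  (forall x, M < `|x| -> F x = 0) -> forall x, M < `|x| -> f x = 0.
Proof.
move=> dF F0 x Mx; apply: is_derive_unique (dF x) _.
apply: near_eq_is_derive (is_derive_cst (0:R) x 1); near=> y.
rewrite F0//; near: y.
by have /cvgr_gt := @norm_continuous _ _ x; apply.
Unshelve. all: by end_near. Qed.

Lemma test_support (w : R -> R) : test_function w -> exists2 M, 0 < M &
  forall j x, M < `|x| -> derive1n j w x = 0.
Proof.
move=> tw; have sw := test_smooth tw; case: tw => _ [M HM].
exists (`|M| + 1) => [|j x Mx]; first by rewrite ltr_pwDr.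
have {Mx} : M < `|x| by have := ler_norm M; lra.
elim: j x => [|j IH] x Mx; first exact: HM.
by apply: zero_off_derive (sw j) _ _ Mx => y; exact: IH.
Qed.

Lemma test_derive1 (w : R -> R) : test_function w -> test_function (derive1 w).
Proof.
move=> tw; have [M M0 HM] := test_support tw.
apply: (@smooth_test (fun j => derive1n j.+1 w) M) => [j x|x Mx].
  exact: (test_smooth tw j.+1 x).
exact: (HM 1%N).
Qed.

Lemma derive1n_derive1 (w : R -> R) n : derive1n n (derive1 w) = derive1n n.+1 w.
Proof. by rewrite /derive1n iterSr. Qed.

(** There are no boundary terms, because [G] has compact support. *)
Lemma parts_compact (F f G g : R -> R) (M : R) : 
  (forall x : R, is_derive x 1 F (f x)) -> continuous f ->
  (forall x : R, is_derive x 1 G (g x)) -> continuous g ->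
  (forall x, M < `|x| -> G x = 0) ->
  (\int[mu]_x (F x * g x) = - \int[mu]_x (f x * G x))%R.
Proof.
move=> dF cf dG cg G0.
have cF : continuous F by move=> x; apply: is_derive_continuous (dF x).
have cG : continuous G by move=> x; apply: is_derive_continuous (dG x).
have g0 := zero_off_derive dG G0.
pose N := `|M| + 1.
have out x : x < - N \/ N < x -> M < `|x|.
  rewrite /N => H; have := ler_norm M; have := ler_norm x; have := ler_norm (- x).
  rewrite normrN; case: H; lra.
rewrite (@Rint_support _ (fun x => F x * g x) (- N) N); last first.
  by move=> x /out H; rewrite g0// mulr0.
rewrite (@Rint_support _ (fun x => f x * G x) (- N) N); last first.
  by move=> x /out H; rewrite G0// mulr0.
apply/eqP; rewrite -addr_eq0 -RintegralD//=; last 2 first.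
- apply: loc_int_itv; apply: continuous_loc_int => x.
  by apply: cvgM; [exact: cF|exact: cg].
- apply: loc_int_itv; apply: continuous_loc_int => x.
  by apply: cvgM; [exact: cf|exact: cG].
have dFG x : is_derive x 1 (fun y => F y * G y) (F x * g x + f x * G x).
  apply: is_derive_ext (is_deriveM (dF x) (dG x)) _ _ => //.
  by rewrite -![_ *: _]/(_ * _) [G x * _]mulrC.
have NN : - N <= N by rewrite /N; have := normr_ge0 M; lra.
have cd : continuous (fun x => F x * g x + f x * G x).
  by move=> x; apply: cvgD; apply: cvgM; [exact: cF|exact: cg|exact: cf|exact: cG].
rewrite (integral_derivative dFG cd NN).
have MN : M < N by rewrite /N; have := ler_norm M; lra.
by rewrite !G0 ?mulr0 ?subr0// ?normrN; apply: lt_le_trans MN (ler_norm _).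
Qed.

Lemma weak_deriv_tower n (F : nat -> R -> R) : tower n F -> continuous (F n) ->
  weak_deriv n (F 0%N) (F n).
Proof.
move=> tF cFn.
have cF j : (j <= n)%N -> continuous (F j).
  exact: tower_continuous_le.
split; [exact: continuous_loc_int (cF _ _)|exact: continuous_loc_int (cF _ _)|].
have H j : (j <= n)%N -> forall w, test_function w ->
    (\int[mu]_x (F 0%N x * derive1n j w x) = (-1) ^+ j * \int[mu]_x (F j x * w x))%R.
  elim: j => [|j IH] jn w tw; first by rewrite expr0 mul1r.
  rewrite -derive1n_derive1 IH ?(ltnW jn)//; last exact: test_derive1.
  have [M _ HM] := test_support tw; have sw := test_smooth tw.
  have dF x : is_derive x 1 (F j) (F j.+1 x) by exact: tF.
  have dw x : is_derive x 1 w (derive1 w x) by exact: (sw 0%N x).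
  have cw : continuous (derive1 w).
    exact: (@smooth_continuous _ (fun j => derive1n j w) 1%N).
  rewrite (parts_compact dF (cF _ jn) dw cw (HM 0%N)).
  by rewrite exprS mulrN mulN1r mulNr.
exact: H.
Qed.

(** Test the first relation against [w'] and the second one against [w]. *)
Lemma weak_deriv_succ i f g h : weak_deriv i f g -> weak_deriv i.+1 f h ->
  weak_deriv 1 g h.
Proof.
move=> [_ lg Hg] [_ lh Hh]; split=> // w tw.
have := Hg _ (test_derive1 tw); rewrite derive1n_derive1 Hh//.
rewrite exprS mulN1r mulNr -mulrN expr1 mulN1r => /mulfI E.
by rewrite derive1n1 -E// expf_neq0// oppr_eq0 oner_eq0.
Qed.

End WeakDerivatives.

(** * Mollification at Lebesgue points *)

Section Mollification.
Variable R : realType.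
Local Notation mu := (@lebesgue_measure R).
Local Notation loc_int := (@locally_integrable R setT).
Implicit Types (f g : R -> R) (a b x r : R).

Lemma loc_int_mul f g : loc_int f -> continuous g -> loc_int (fun x => f x * g x).
Proof.
move=> lf cg; have [mf _ _] := lf.
have mg := continuous_measurable_fun cg.
split; [exact: measurable_funM|exact: openT|move=> K _ cK].
have [N [_ HN]] := compact_bounded cK.
have [M M0 HM] := continuous_itv_bounded (- (N + 1)) (N + 1) cg.
have iK : mu.-integrable K (fun x => M%:E * (f x)%:E)%E.
  by apply: integrableZl; [exact: compact_measurable|exact: loc_int_compact].
have mK : measurable K by exact: compact_measurable.
suff : mu.-integrable K (EFin \o (fun x => f x * g x)) by case/integrableP.
apply: le_integrable iK => //.
  by apply/measurable_EFinP; apply: measurable_funTS; exact: measurable_funM.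
move=> x Kx /=; rewrite lee_fin mulrC !normrM ler_wpM2r// (ger0_norm M0).
have Nx : `|x| <= N + 1 by apply: HN => //; rewrite ltrDl.
by apply: HM; rewrite -ler_norml.
Qed.

Lemma loc_int_abs f : loc_int f -> loc_int (fun x => `|f x|).
Proof.
move=> [mf oT H]; split => //; first exact: measurableT_comp.
by move=> K KT cK; under eq_integral do rewrite normr_id; exact: H.
Qed.

Lemma bump_bounded : exists2 B, 0 <= B & forall x : R, `|unit_bump 0 x| <= B.
Proof.
have cb : continuous (@unit_bump R 0) by apply: smooth_continuous; exact: smooth_unit_bump.
have [B B0 HB] := continuous_itv_bounded 0 1 cb; exists B => // x.
have [x0|x0] := leP x 0; first by rewrite bump_out ?normr0//; left.
have [x1|x1] := leP 1 x; first by rewrite bump_out ?normr0//; right.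
by apply: HB; rewrite !ltW.
Qed.

Definition kernel_tower (F : nat -> R -> R) x r : nat -> R -> R :=
  affine_tower F r^-1 (- (r^-1 * x)).

Lemma smooth_affine (F : nat -> R -> R) (s t : R) : smooth F -> smooth (affine_tower F s t).
Proof.
by move=> sF j x; apply: (@tower_affine _ j.+1) => // i y _; exact: sF.
Qed.

Lemma kernel_tower0 F x r y : kernel_tower F x r 0 y = F 0%N (r^-1 * (y - x)).
Proof. by rewrite /kernel_tower /affine_tower expr0 mul1r mulrBr. Qed.

Lemma kernel_tower1 F x r y : kernel_tower F x r 1 y = r^-1 * F 1%N (r^-1 * (y - x)).
Proof. by rewrite /kernel_tower /affine_tower expr1 mulrBr. Qed.

(** The mollified value minus [f x] is the integral of [f - f x] against a kernel of
height [B / r] on an interval of length [r], hence at most a multiple of the mean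
oscillation of [f] on the ball of radius [2 r]. *)
Lemma mollify_le (B : R) : 0 <= B -> (forall x : R, `|unit_bump 0 x| <= B) ->
  forall f x r, loc_int f -> 0 < r ->
  (`|\int[mu]_y (f y * (r^-1 * unit_bump 0 (r^-1 * (y - x)))) - f x|%:E <=
     (4 * B)%:E * davg f x (2 * r))%E.
Proof.
move=> B0 HB f x r lf r0.
have ri0 : 0 < r^-1 by rewrite invr_gt0.
pose K y : R := r^-1 * unit_bump 0 (r^-1 * (y - x)).
have KE y : K y = kernel_tower (@unit_step R) x r 1 y by rewrite kernel_tower1.
have sK := smooth_affine r^-1 (- (r^-1 * x)) (@smooth_unit_step R).
have cK : continuous K.
  by move=> y; rewrite (funext KE); apply: smooth_continuous.
have K0 y : y < x \/ x + r < y -> K y = 0.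
  move=> H; rewrite /K bump_out ?mulr0//; case: H => H; [left|right].
    by rewrite mulr_ge0_le0 ?ltW// subr_lt0.
  by rewrite ler_pdivlMl// mulr1; lra.
have xr : x <= x + r by lra.
have IK : (\int[mu]_(y in `[x, (x + r)%R]) K y = 1)%R.
  have dK (y : R) : is_derive y 1 (kernel_tower (@unit_step R) x r 0) (K y).
    by rewrite KE; exact: sK.
  rewrite (integral_derivative dK cK xr) !kernel_tower0 subrr mulr0 addrAC subrr add0r.
  by rewrite mulVf ?gt_eqF// step_ge1// step_le0// subr0.
rewrite -/(K _) (@Rint_support _ (fun y => f y * K y) x (x + r)); last first.
  by move=> y /K0 ->; rewrite mulr0.
have E : ((\int[mu]_(y in `[x, (x + r)%R]) (f y * K y)) - f x =
          \int[mu]_(y in `[x, (x + r)%R]) ((f y - f x) * K y))%R.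
  rewrite -[X in _ - X]mulr1 -IK -RintegralZl//; last first.
    by apply: loc_int_itv; exact: continuous_loc_int.
  rewrite -RintegralB//; last 2 first.
    by apply: loc_int_itv; exact: loc_int_mul.
    apply: loc_int_itv; apply: continuous_loc_int => y.
    by apply: cvgM; [exact: cvg_cst|exact: cK].
  by apply: eq_Rintegral => y _; rewrite mulrBl.
rewrite E {E}.
have lfx : loc_int (fun y => f y - f x).
  apply: locally_integrableB => //.
  by apply: continuous_loc_int; exact: cst_continuous.
rewrite EFin_normr_Rintegral//; last by apply: loc_int_itv; exact: loc_int_mul.
have mfx : measurable_fun setT (fun y => f y - f x) by case: lfx.
apply: le_trans; first apply: le_abse_integral => //.
  apply/measurable_EFinP; apply: measurable_funTS; apply: measurable_funM => //.
  exact: continuous_measurable_fun.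
have bx : (ball x (2 * r) : set R) = `](x - 2 * r)%R, (x + 2 * r)%R[%classic.
  by rewrite ball_itv.
apply: (@le_trans _ _ (\int[mu]_(y in `[x, (x + r)%R]) ((B / r)%:E * `|f y - f x|%:E))%E).
  apply: ge0_le_integral => //=.
  - by apply/measurable_EFinP; apply: measurable_funTS; apply: measurableT_comp => //;
      apply: measurable_funM => //; exact: continuous_measurable_fun.
  - apply/measurable_EFinP; apply: measurable_funTS; apply: measurable_funM => //.
    exact: measurableT_comp.
  - move=> y _; rewrite -EFinM lee_fin normrM mulrC ler_wpM2r//.
    by rewrite /K normrM (ger0_norm (ltW ri0)) mulrC ler_wpM2r// ltW.
rewrite /davg /iavg bx lebesgue_measure_itv/= lte_fin ifT; last lra.
rewrite -EFinD inver ifF; last by apply/negbTE; lra.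
rewrite ge0_integralZl//=; last 2 first.
- by apply/measurable_EFinP; apply: measurable_funTS; exact: measurableT_comp.
- by rewrite lee_fin divr_ge0// ltW.
rewrite muleA -EFinM (_ : 4 * B * _ = B / r); last first.
  by field; rewrite gt_eqF//=; lra.
apply: lee_wpmul2l; first by rewrite lee_fin divr_ge0// ltW.
apply: ge0_subset_integral => //=.
- by apply/measurable_EFinP; apply: measurable_funTS; exact: measurableT_comp.
- by move=> y /=; rewrite !in_itv/=; lra.
Qed.

Lemma mollify_cvg f x (e : R) : loc_int f -> lebesgue_pt f x -> 0 < e ->
  exists2 d, 0 < d & forall r, 0 < r < d ->
  `|(\int[mu]_y (f y * (r^-1 * unit_bump 0 (r^-1 * (y - x)))))%R - f x| < e.
Proof.
move=> lf fx e0; have [B B0 HB] := bump_bounded.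
have e1 : 0 < e / (4 * B + 1) by rewrite divr_gt0//; lra.
have : \forall r \near 0^'+, (davg f x r < (e / (4 * B + 1))%:E)%E.
  apply: (fx [set z | (z < (e / (4 * B + 1))%:E)%E]).
  by apply: open_nbhs_nbhs; split; [exact: open_ereal_lt_ereal|rewrite /= lte_fin].
move=> /nbhs_ballP[d /= d0 Hd]; exists (d / 2); first by rewrite divr_gt0.
move=> r /andP[r0 rd].
have : (davg f x (2 * r) < (e / (4 * B + 1))%:E)%E.
  apply: Hd => /=; last lra.
  by rewrite /ball/= sub0r normrN gtr0_norm; lra.
have := mollify_le B0 HB x lf r0; have := davg_ge0 f x (2 * r).
case: (davg _ _ _) => [v| |]//; rewrite -EFinM !lee_fin lte_fin => v0 H Hv.
apply: le_lt_trans H _; move: Hv; rewrite ltr_pdivlMr; last lra.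
by move=> Hv; apply: le_lt_trans Hv; rewrite mulrC ler_wpM2l//; lra.
Qed.

End Mollification.

(** * Functions with weak derivatives are primitives *)

Section DuBoisReymond.
Variable R : realType.
Local Notation mu := (@lebesgue_measure R).
Local Notation loc_int := (@locally_integrable R setT).
Implicit Types (f g : R -> R) (a b x r : R).

Let kbump x r y : R := r^-1 * unit_bump 0 (r^-1 * (y - x)).
Let kstep x r y : R := unit_step 0 (r^-1 * (y - x)).

Let kbump_out x r y : 0 < r -> y <= x \/ x + r <= y -> kbump x r y = 0.
Proof.
move=> r0 H; have ri0 : 0 < r^-1 by rewrite invr_gt0.
rewrite /kbump bump_out ?mulr0//; case: H => H; [left|right].
  by rewrite mulr_ge0_le0 ?(ltW ri0)// subr_le0.
by rewrite ler_pdivlMl// mulr1; lra.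
Qed.

Let kstep_le x r y : 0 < r -> y <= x -> kstep x r y = 0.
Proof.
by move=> r0 yx; rewrite /kstep step_le0// mulr_ge0_le0 ?invr_ge0 ?(ltW r0)// subr_le0.
Qed.

Let kstep_ge x r y : 0 < r -> x + r <= y -> kstep x r y = 1.
Proof.
move=> r0 yx; rewrite /kstep step_ge1//.
by rewrite ler_pdivlMl// mulr1; lra.
Qed.

Let smooth_k x r : smooth (kernel_tower (@unit_step R) x r).
Proof. by apply: smooth_affine; exact: smooth_unit_step. Qed.

Let kbumpE x r : kernel_tower (@unit_step R) x r 1 = kbump x r.
Proof. by apply/funext => y; rewrite kernel_tower1. Qed.

Let kstepE x r : kernel_tower (@unit_step R) x r 0 = kstep x r.
Proof. by apply/funext => y; rewrite kernel_tower0. Qed.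

(** The test functions behind the fundamental lemma. *)
Lemma kbump_test x r : 0 < r -> test_function (kbump x r).
Proof.
move=> r0; rewrite -kbumpE.
apply: (@smooth_test _ (fun j => kernel_tower (@unit_step R) x r j.+1) (`|x| + r)).
  by move=> j y; exact: smooth_k.
move=> y xy; rewrite kbumpE kbump_out//.
have := ler_norm x; have := ler_norm (- x); rewrite normrN.
have [y0|y0] := leP 0 y; move: xy.
  by rewrite (ger0_norm y0) => *; right; lra.
by rewrite (ltr0_norm y0) => *; left; lra.
Qed.

(** At a Lebesgue point [f x] is the limit of integrals of [f] against test
functions. *)
Lemma fundamental_lemma f : loc_int f ->
  (forall w, test_function w -> (\int[mu]_x (f x * w x))%R = 0) ->
  {ae mu, forall x, f x = 0}.
Proof.
move=> lf H; have := lebesgue_differentiation lf; apply: ae_imp => x fx.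
apply/eqP; rewrite -normr_le0 leNgt; apply/negP => f0.
(* a scale at which the mollified value would be closer to [f x] than to zero *)
have [d d0 Hd] := mollify_cvg lf fx f0.
have : 0 < d / 2 < d by lra.
move=> /[dup] /andP[d20 _] /Hd.
by rewrite (H (kbump x (d / 2)))// ?sub0r ?normrN ?ltxx//; exact: kbump_test.
Qed.

Lemma exists_lt_pos (m : R) : 0 < m -> exists r, 0 < r < m.
Proof. by move=> m0; exists (m / 2); lra. Qed.

Lemma outside_both_supports a b r y : 0 < r -> `|a| + `|b| + r < `|y| ->
  (a + r <= y) && (b + r <= y) \/ (y <= a) && (y <= b).
Proof.
have := ler_norm a; have := ler_norm (- a); rewrite normrN.
have := ler_norm b; have := ler_norm (- b); rewrite normrN.
have := normr_ge0 a; have := normr_ge0 b.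
have [y0|y0] := leP 0 y; [rewrite (ger0_norm y0)|rewrite (ltr0_norm y0)] => *.
  by left; apply/andP; lra.
by right; apply/andP; lra.
Qed.

(** The error budget of [weak_deriv1_lebesgue_pt]: two mollification errors and two
boundary layers. *)
Lemma four_errors (X1 X2 u v I1 I3 J1 J2 q : R) :
  `|X1 - u| < q -> `|X2 - v| < q -> `|I1 - J1| < q -> `|I3| < q ->
  X1 - X2 = - (I1 + J2 + I3) -> `|v - u - (J1 + J2)| < 4 * q.
Proof. rewrite !ltr_norml; lra. Qed.

(** The test function rises from [0] to [1] just after [a] and falls back just after
[b].  Its derivative is a difference of two mollifiers, so the weak identity
compares [f a - f b] with the integral of [g] over [[a, b]], up to the boundary
layers of width [r]. *)
Lemma weak_deriv1_lebesgue_pt f g a b : weak_deriv 1 f g -> a < b ->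
  lebesgue_pt f a -> lebesgue_pt f b ->
  f b - f a = primitive g b - primitive g a.
Proof.
move=> [lf lg H] ab fa fb.
have lag := loc_int_abs lg.
apply/eqP; rewrite -subr_eq0 -normr_le0 leNgt; apply/negP => e0.
set e := `| _ | in e0.
have e4 : 0 < e / 4 by rewrite divr_gt0.
have [d1 d10 Hd1] := mollify_cvg lf fa e4.
have [d2 d20 Hd2] := mollify_cvg lf fb e4.
have near_prim x : exists2 d, 0 < d & forall r, 0 < r < d ->
    (\int[mu]_(y in `[x, (x + r)%R]) `|g y|)%R < e / 4.
  have /cvgrPdist_lt /(_ _ e4) /nbhs_ballP[d /= d0 Hd] := primitive_continuous lag (x := x).
  exists d => // r /andP[r0 rd]; rewrite -primitiveB//; last lra.
  apply: le_lt_trans (ler_norm _) _; rewrite distrC; apply: Hd.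
  by rewrite /ball/= opprD addrA subrr sub0r normrN gtr0_norm.
have [d3 d30 Hd3] := near_prim a; have [d4 d40 Hd4] := near_prim b.
have [r [r0 [rd1 rd2 rd3 rd4]] rab] : exists2 r, 0 < r /\ [/\ r < d1, r < d2, r < d3 & r < d4]
    & a + r <= b.
  have m0 : 0 < Num.min (Num.min d1 d2) (Num.min (Num.min d3 d4) (b - a)).
    by rewrite !lt_min d10 d20 d30 d40 subr_gt0 ab.
  have [r rm] : exists r, 0 < r < Num.min (Num.min d1 d2) (Num.min (Num.min d3 d4) (b - a)).
    exact: exists_lt_pos.
  move: rm; rewrite !lt_min => /andP[r0 /andP[/andP[? ?] /andP[/andP[? ?] rab]]].
  by exists r; rewrite // addrC -lerBrDr ltW.
have abr : a <= a + r by rewrite lerDl ltW.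
have bbr : b <= b + r by rewrite lerDl ltW.
have abb : a <= b by rewrite ltW.
pose W j y : R := kernel_tower (@unit_step R) a r j y - kernel_tower (@unit_step R) b r j y.
have sW : smooth W.
  by move=> j y; exact: (is_deriveB (smooth_k a r j y) (smooth_k b r j y)).
have W0E y : W 0%N y = kstep a r y - kstep b r y by rewrite /W !kstepE.
have W1E y : W 1%N y = kbump a r y - kbump b r y by rewrite /W !kbumpE.
have tW : test_function (W 0%N).
  apply: (@smooth_test _ W (`|a| + `|b| + r)) => // y Hy; rewrite W0E.
  have [y0|y0] := outside_both_supports r0 Hy.
    by case/andP: y0 => y1 y2; rewrite !kstep_ge ?subrr.
  by case/andP: y0 => y1 y2; rewrite !kstep_le ?subrr.
have := H _ tW; rewrite (smooth_derive1n 1 sW) expr1 mulN1r.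
have ck x : continuous (kbump x r).
  by rewrite -kbumpE; apply: smooth_continuous; exact: smooth_k.
have cs x : continuous (kstep x r).
  by rewrite -kstepE; apply: smooth_continuous; exact: smooth_k.
have E1 : (\int[mu]_x (f x * W 1%N x))%R =
  (\int[mu]_x (f x * kbump a r x))%R - (\int[mu]_x (f x * kbump b r x))%R.
  have S x : x = a \/ x = b ->
      (\int[mu]_y (f y * kbump x r y) = \int[mu]_(y in `[a, (b + r)%R]) (f y * kbump x r y))%R.
    move=> xab; apply: Rint_support => y Hy; rewrite kbump_out ?mulr0//.
    case: xab Hy => -> [/ltW y1|/ltW y1]; [by left|right|left|by right].
      by apply: le_trans y1; rewrite lerD2r.
    exact: le_trans y1 abb.
  rewrite (S a) ?(S b)//; [|by right|by left].
  rewrite -RintegralB//; [|by apply: loc_int_itv; exact: loc_int_mul..].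
  rewrite (@Rint_support _ _ a (b + r)); last first.
    move=> y Hy; rewrite W1E !kbump_out ?subrr ?mulr0//;
    case: Hy => /ltW y1; [left|right|left|right] => //.
      exact: le_trans y1 abb.
    by apply: le_trans y1; rewrite lerD2r.
  by apply: eq_Rintegral => y _; rewrite W1E mulrBr.
have cW : continuous (W 0%N) by apply: smooth_continuous.
have lgW : loc_int (fun x => g x * W 0%N x) by exact: loc_int_mul.
(* [W] equals [1] between the two boundary layers *)
have E2 : (\int[mu]_x (g x * W 0%N x))%R =
  (\int[mu]_(x in `[a, (a + r)%R]) (g x * W 0%N x))%R +
  (\int[mu]_(x in `[(a + r)%R, b]) g x)%R +
  (\int[mu]_(x in `[b, (b + r)%R]) (g x * W 0%N x))%R.
  rewrite (@Rint_support _ _ a (b + r)); last first.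
    move=> y Hy; rewrite W0E; case: Hy => /ltW y1.
      by rewrite !kstep_le ?subrr ?mulr0// (le_trans y1 abb).
    by rewrite !kstep_ge ?subrr ?mulr0// (le_trans _ y1)// lerD2r.
  rewrite (Rint_split lgW abb bbr) (Rint_split lgW abr rab).
  congr (_ + _ + _); apply: eq_Rintegral => y; rewrite inE/= in_itv/= => /andP[y1 y2].
  by rewrite W0E kstep_ge ?kstep_le ?subr0 ?mulr1.
have bnd x : (\int[mu]_(y in `[x, (x + r)%R]) `|g y|)%R < e / 4 ->
   forall k : R -> R, continuous k -> (forall y, x <= y <= x + r -> `|k y| <= 1) ->
   `|(\int[mu]_(y in `[x, (x + r)%R]) (g y * k y))%R| < e / 4.
  move=> Hx k ck' k1; apply: le_lt_trans Hx.
  apply: le_trans; first apply: le_normr_Rintegral => //.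
    by apply: loc_int_itv; exact: loc_int_mul.
  apply: le_Rintegral => //.
  - by apply: loc_int_itv; apply: loc_int_abs; exact: loc_int_mul.
  - exact: loc_int_itv.
  - move=> y /=; rewrite in_itv/= => /k1 ky; rewrite normrM -[leRHS]mulr1.
    by rewrite ler_wpM2l.
have s01 x y : 0 <= kstep x r y <= 1 by exact: step_ge0_le1.
have B1 : `|(\int[mu]_(y in `[a, (a + r)%R]) (g y * (W 0%N y - 1)))%R| < e / 4.
  apply: bnd.
  - by apply: Hd3; rewrite r0.
  - by move=> y; apply: cvgB; [exact: cW|exact: cvg_cst].
  - move=> y /andP[_ y2]; rewrite W0E (kstep_le r0 (le_trans y2 rab)) subr0.
    have /andP[s0 s1] := s01 a y; rewrite ler_norml lerBlDr.
    by rewrite lerBrDr addNr s0 (le_trans s1)// lerDl.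
have B2 : `|(\int[mu]_(y in `[b, (b + r)%R]) (g y * W 0%N y))%R| < e / 4.
  apply: bnd => //.
  - by apply: Hd4; rewrite r0.
  - move=> y /andP[y1 _]; rewrite W0E (kstep_ge r0 (le_trans rab y1)).
    have /andP[s0 s1] := s01 b y; rewrite ler_norml lerBlDr lerDl s0 andbT.
    by rewrite lerBrDl (le_trans _ ler01)// subr_le0.
have E3 : (\int[mu]_(y in `[a, (a + r)%R]) (g y * (W 0%N y - 1)))%R =
   (\int[mu]_(y in `[a, (a + r)%R]) (g y * W 0%N y))%R -
   (\int[mu]_(y in `[a, (a + r)%R]) (g y))%R.
  rewrite -RintegralB//; [|exact: loc_int_itv|exact: loc_int_itv].
  by apply: eq_Rintegral => y _; rewrite mulrBr mulr1.
have E4 : primitive g b - primitive g a =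
   (\int[mu]_(y in `[a, (a + r)%R]) g y)%R + (\int[mu]_(x in `[(a + r)%R, b]) g x)%R.
  by rewrite primitiveB// -Rint_split.
have A1 : `|(\int[mu]_y (f y * kbump a r y))%R - f a| < e / 4 by apply: Hd1; rewrite r0.
have A2 : `|(\int[mu]_y (f y * kbump b r y))%R - f b| < e / 4 by apply: Hd2; rewrite r0.
rewrite E1 E2 => E5; rewrite E3 in B1.
have := four_errors A1 A2 B1 B2 E5; rewrite -E4 -/e (_ : 4 * (e / 4) = e) ?ltxx//.
by rewrite mulrC divfK.
Qed.

(** Almost every point is a Lebesgue point. *)
Theorem weak_deriv1_primitive f g : weak_deriv 1 f g ->
  exists C, {ae mu, forall x, f x = C + primitive g x}.
Proof.
move=> fg; have [lf _ _] := fg; have D := lebesgue_differentiation lf.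
have [x0 _ fx0] := interval_not_null ltr01 D.
exists (f x0 - primitive g x0); apply: ae_imp D => x fx.
have [xx0|xx0|->] := ltgtP x x0; last by ring.
  by have := weak_deriv1_lebesgue_pt fg xx0 fx fx0; lra.
by have := weak_deriv1_lebesgue_pt fg xx0 fx0 fx; lra.
Qed.

Lemma weak_deriv1_continuous f g : weak_deriv 1 f g ->
  exists2 F, continuous F & {ae mu, forall x, f x = F x}.
Proof.
move=> fg; have [C HC] := weak_deriv1_primitive fg; have [_ lg _] := fg.
exists (fun x => C + primitive g x) => // x.
by apply: cvgD; [exact: cvg_cst|exact: primitive_continuous].
Qed.

Lemma weak_deriv1_C1 f g (G : R -> R) : weak_deriv 1 f g -> continuous G ->
  {ae mu, forall x, g x = G x} ->
  exists2 F : R -> R, (forall x : R, is_derive x 1 F (G x)) &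
    {ae mu, forall x, f x = F x}.
Proof.
move=> fg cG gG; have [C HC] := weak_deriv1_primitive fg; have [_ lg _] := fg.
have lG := continuous_loc_int cG.
exists (fun x => C + primitive G x); last by rewrite -(ae_primitive lg lG gG).
move=> x; have := is_deriveD (is_derive_cst C x 1) (primitive_derive lG (cG x)).
by move/is_derive_ext; apply => //; rewrite add0r.
Qed.

Lemma weak_deriv_unique n f g1 g2 : weak_deriv n f g1 -> weak_deriv n f g2 ->
  {ae mu, forall x, g1 x = g2 x}.
Proof.
move=> [_ l1 H1] [_ l2 H2].
have l12 : loc_int (fun x => g1 x - g2 x) by exact: locally_integrableB.
have := fundamental_lemma l12; move=> H.
have {}H : {ae mu, forall x, g1 x - g2 x = 0}.
  apply: H => w tw; have [M M0 HM] := test_support tw.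
  have cw : continuous w.
    exact: (@smooth_continuous _ (fun j => derive1n j w) 0%N (test_smooth tw)).
  have S (h : R -> R) : (\int[mu]_x (h x * w x) = \int[mu]_(x in `[- M, M]) (h x * w x))%R.
    apply: Rint_support => x xM; rewrite (_ : w x = 0) ?mulr0//; apply: (HM 0%N).
    have := ler_norm x; have := ler_norm (- x); rewrite normrN.
    by case: xM; lra.
  rewrite S; under eq_Rintegral do rewrite mulrBl.
  rewrite RintegralB//; [|by apply: loc_int_itv; exact: loc_int_mul..].
  rewrite -!S; apply/eqP; rewrite subr_eq0; apply/eqP.
  have := H1 w tw; rewrite (H2 w tw) => /mulfI -> //.
  by rewrite expf_neq0// oppr_eq0 oner_eq0.
by apply: ae_imp H => x /eqP; rewrite subr_eq0 => /eqP.
Qed.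

Lemma weak_deriv_ae n f f' g : weak_deriv n f g -> loc_int f' ->
  {ae mu, forall x, f x = f' x} -> weak_deriv n f' g.
Proof.
move=> [lf lg H] lf' ff'; split => // w tw; rewrite -H//.
have cw : continuous (derive1n n w).
  exact: (@smooth_continuous _ (fun j => derive1n j w) n (test_smooth tw)).
apply: ae_Rintegral => //.
- by case: (loc_int_mul lf' cw).
- by case: (loc_int_mul lf cw).
- by apply: ae_imp ff' => x ->.
Qed.

(** A chain of weak derivatives whose last term is continuous is a classical
derivative chain: integrate from the top. *)
Lemma weak_ladder n (g : nat -> R -> R) (H : R -> R) :
  (forall j, (j < n)%N -> weak_deriv 1 (g j) (g j.+1)) ->
  continuous H -> {ae mu, forall x, g n x = H x} ->
  exists F : nat -> R -> R, [/\ tower n F, F n = H &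
    forall j, (j <= n)%N -> {ae mu, forall x, g j x = F j x}].
Proof.
elim: n g => [|n IH] g wg cH gH.
  by exists (fun=> H); split => // j; rewrite leqn0 => /eqP ->.
have [F [tF Fn gF]] := IH (fun j => g j.+1) (fun j jn => wg j.+1 jn) cH gH.
have cF0 : continuous (F 0%N).
  case: n {IH wg gH} tF Fn gF => [_ -> //|n tF _ _]; exact: tower_continuous tF _.
have [F0 dF0 gF0] := weak_deriv1_C1 (wg 0%N (ltn0Sn _)) cF0 (gF 0%N (leq0n _)).
exists (fun j => if j is i.+1 then F i else F0); split => //.
  by case=> [|j] x jn; [exact: dF0|exact: tF].
by case=> [|j] jn; [exact: gF0|exact: gF].
Qed.

End DuBoisReymond.

(** * Regularity of the elements of the operator domains *)

Section Regularity.
Variable R : realType.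
Local Notation mu := (@lebesgue_measure R).
Local Notation loc_int := (@locally_integrable R setT).
Implicit Types (f g v : R -> R) (F V : nat -> R -> R).

Definition weakly_differentiable (n : nat) f : Prop :=
  forall j, (j <= n)%N -> exists g, weak_deriv j f g.

(** Real form of [kp_expr], to which both components of a complex solution reduce when
[lam] is real. *)
Definition real_kp_expr (lam al be c : R) v f g : Prop :=
  exists f1 f2 f4 w : R -> R,
  [/\ weak_deriv 1 f f1, weak_deriv 2 f f2, weak_deriv 4 f f4,
      weak_deriv 2 (fun x => al * f4 x + be * f2 x - c * f x + v x * f x) w &
      {ae mu, forall x, g x = lam * f1 x - w x}].

Lemma weakly_differentiable_tower n f : weakly_differentiable n.+1 f ->
  exists F, [/\ tower n F, continuous (F n) & {ae mu, forall x, f x = F 0%N x}].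
Proof.
move=> H.
have [g Hg] : {g : nat -> R -> R & forall j, (j <= n.+1)%N -> weak_deriv j f (g j)}.
  apply: (@choice _ _ (fun j g => (j <= n.+1)%N -> weak_deriv j f g)) => j.
  by case: (leqP j n.+1) => [/H[g Hg]|_]; [exists g|exists f].
have g1 j : (j < n.+1)%N -> weak_deriv 1 (g j) (g j.+1).
  by move=> jn; apply: weak_deriv_succ (Hg j.+1 jn); apply: Hg; exact: ltnW.
have [G cG gG] := weak_deriv1_continuous (g1 n (leqnn _)).
have [F [tF Fn gF]] := weak_ladder (fun j jn => g1 j (leqW jn)) cG gG.
exists F; split; rewrite ?Fn//.
have w0 : weak_deriv 0 f f.
  have [lf _ _] := Hg 0%N (leq0n _).
  by split => // w _; rewrite expr0 mul1r.
apply: ae_imp2 (weak_deriv_unique w0 (Hg 0%N (leq0n _))) (gF 0%N (leq0n _)).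
by move=> x ->.
Qed.

(** The expression under the outer second derivative is already of class C^1, and its
second weak derivative is continuous by the equation; so its first derivative is
differentiable in the classical sense.  Since [al] and [be] may vanish here, the
lemma also covers the degenerate case of wavenumber zero. *)
Lemma kp_bootstrap lam al be c f g G F V :
  tower 5 F -> continuous (F 5%N) -> {ae mu, forall x, f x = F 0%N x} ->
  tower 1 V -> continuous (V 1%N) -> continuous G ->
  {ae mu, forall x, g x = G x} ->
  real_kp_expr lam al be c (V 0%N) f g ->
  forall x : R, is_derive x 1
    (fun x => al * F 5%N x + be * F 3%N x - c * F 1%N x + leibniz 1 V F x)
    (lam * F 1%N x - G x).
Proof.
move=> tF cF5 fF tV cV1 cG gG [f1 [f2 [f4 [w [w1 w2 w4 wY gE]]]]].
have cF j : (j <= 5)%N -> continuous (F j).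
  exact: tower_continuous_le.
have lF0 : loc_int (F 0%N) by apply: continuous_loc_int; exact: cF.
have cV j : (j <= 1)%N -> continuous (V j).
  exact: tower_continuous_le.
have FE j fj : (j <= 5)%N -> weak_deriv j f fj -> {ae mu, forall x, fj x = F j x}.
  move=> j5 wj; apply: weak_deriv_unique (weak_deriv_ae wj lF0 fF) _.
  by apply: weak_deriv_tower; [exact: tower_le tF|exact: cF].
pose Y (j : nat) x := al * F (4 + j)%N x + be * F (2 + j)%N x - c * F j x + leibniz j V F x.
have cY j : (j <= 1)%N -> continuous (Y j).
  move=> j1 x; have c4 := cF (4 + j)%N; have c2 := cF (2 + j)%N.
  have cc (k : nat) (r : R) : (k <= 5)%N -> {for x, continuous (fun x => r * F k x)}.
    by move=> k5; apply: cvgM; [exact: cvg_cst|exact: cF].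
  apply: cvgD; [apply: cvgD; [apply: cvgD|apply: cvgN]|]; try apply: cc.
  - by rewrite (leq_add2l 4 j 1).
  - by rewrite (leq_trans (_ : _ <= 2 + 1)%N)// leq_add2l.
  - by rewrite (leq_trans j1).
  - case: j j1 {c4 c2} => [|[|//]] _ /=.
      by apply: cvgM; [exact: cV|exact: cF].
    by apply: cvgD; apply: cvgM; (try exact: cV); exact: cF.
have dY (x : R) : is_derive x 1 (Y 0%N) (Y 1%N x).
  have d (k : nat) (r : R) : (k < 5)%N -> is_derive x 1 (fun x => r * F k x) (r * F k.+1 x).
    move=> k5; have := is_deriveZ r (tF k x k5).
    by move/is_derive_ext; apply.
  have dl : is_derive x 1 (leibniz 0 V F) (leibniz 1 V F x).
    by apply: is_derive_leibniz => i; rewrite leqn0 => /eqP ->; [exact: tV|exact: tF].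
  apply: is_derive_ext (is_deriveD (is_deriveB (is_deriveD (d 4%N al _) (d 2%N be _))
    (d 0%N c _)) dl) _ _ => //.
have aeY : {ae mu, forall x, al * f4 x + be * f2 x - c * f x + V 0%N x * f x = Y 0%N x}.
  apply: ae_imp2 (ae_and (FE 4%N _ isT w4) (FE 2%N _ isT w2)) fF.
  by move=> x [-> ->] ->.
have wY0 : weak_deriv 2 (Y 0%N) w.
  by apply: weak_deriv_ae wY _ aeY; apply: continuous_loc_int; exact: cY.
have wY1 : weak_deriv 1 (Y 0%N) (Y 1%N).
  by apply: (@weak_deriv_tower _ 1 Y); [case=> [|//] x _; exact: dY|exact: cY].
have wY2 := weak_deriv_succ wY1 wY0.
have cW : continuous (fun x => lam * F 1%N x - G x).
  by move=> x; apply: cvgB; [apply: cvgM; [exact: cvg_cst|exact: cF]|exact: cG].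
have wW : {ae mu, forall x, w x = lam * F 1%N x - G x}.
  apply: ae_imp2 (ae_and (FE 1%N _ isT w1) gG) gE.
  by move=> x [-> ->] ->; ring.
have [Z dZ YZ] := weak_deriv1_C1 wY2 cW wW.
have -> : (fun x => al * F 5%N x + be * F 3%N x - c * F 1%N x + leibniz 1 V F x) = Z.
  apply: (ae_eq_continuous (cY 1%N isT) _ YZ).
  by move=> x; exact: is_derive_continuous (dZ x).
exact: dZ.
Qed.

(** The expression of [kp_expr] with its outer second derivative carried out. *)
Definition kp_classical (lam al be c : R) V F (x : R) : R :=
  lam * F 1%N x - (al * F 6%N x + be * F 4%N x - c * F 2%N x + leibniz 2 V F x).

(** Solve the bootstrapped relation for the fifth derivative of [F]: the remaining
terms are differentiable. *)
Lemma kp_regularity lam al be c f g G F V : al != 0 ->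
  tower 5 F -> continuous (F 5%N) -> {ae mu, forall x, f x = F 0%N x} ->
  tower 2 V -> continuous (V 2%N) -> continuous G ->
  {ae mu, forall x, g x = G x} ->
  real_kp_expr lam al be c (V 0%N) f g ->
  exists F', [/\ tower 6 F', F' 0%N = F 0%N, continuous (F' 6%N) &
    forall x, kp_classical lam al be c V F' x = G x].
Proof.
move=> al0 tF cF5 fF tV cV2 cG gG K.
have cF j : (j <= 5)%N -> continuous (F j).
  exact: tower_continuous_le.
have cV j : (j <= 2)%N -> continuous (V j).
  exact: tower_continuous_le.
have D := kp_bootstrap tF cF5 fF (tower_le (isT : (1 <= 2)%N) tV) (cV 1%N isT) cG gG K.
pose F6 x := al^-1 * (lam * F 1%N x - G x - be * F 4%N x + c * F 2%N x - leibniz 2 V F x).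
exists (fun j => if j == 6%N then F6 else F j); split => //.
- move=> j x; rewrite ltnS leq_eqVlt => /predU1P[->|j5]; last first.
    by rewrite !ltn_eqF//; [exact: tF|exact: leqW].
  rewrite /=.
  have d (k : nat) (r : R) : (k < 5)%N -> is_derive x 1 (fun x => r * F k x) (r * F k.+1 x).
    move=> k5; have := is_deriveZ r (tF k x k5).
    by move/is_derive_ext; apply.
  have dl : is_derive x 1 (leibniz 1 V F) (leibniz 2 V F x).
    by apply: is_derive_leibniz => i i1; [exact: tV|apply: tF; exact: leq_ltn_trans i1 _].
  have := is_deriveZ al^-1 (is_deriveB (is_deriveD (is_deriveB (D x) (d 3%N be isT))
     (d 1%N c isT)) dl).
  have E y : al^-1 * (al * F 5%N y + be * F 3%N y - c * F 1%N y + leibniz 1 V F y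
    - be * F 3%N y + c * F 1%N y - leibniz 1 V F y) = F 5%N y by field.
  by move/is_derive_ext; apply => // y; exact: E.
- move=> x; apply: cvgM; first exact: cvg_cst.
  have cc (k : nat) (r : R) : (k <= 5)%N -> {for x, continuous (fun x => r * F k x)}.
    by move=> k5; apply: cvgM; [exact: cvg_cst|exact: cF].
  apply: cvgB; first (apply: cvgD; [apply: cvgB; [apply: cvgB|]|]);
    try exact: cc; try exact: cG.
  by apply: cvgD; apply: cvgD; apply: cvgM; by [exact: cV|exact: cF].
- by move=> x; rewrite /kp_classical /F6 /=; field.
Qed.

End Regularity.

(** * Translation invariance of null sets *)

Section Translation.
Variable R : realType.
Local Notation mu := (@lebesgue_measure R).

Let shift_by (s x : measurableTypeR R) : measurableTypeR R := (x + s : R).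

Let mshift (s : R) : measurable_fun setT (shift_by s).
Proof.
apply: (@continuous_measurable_fun R) => x.
by apply: cvgD; [exact: cvg_id|exact: cvg_cst].
Qed.

(** The shifted measure gives half-open intervals their length, which determines it. *)
Lemma lebesgue_measure_shift (s : R) (A : set R) : measurable A ->
  pushforward mu (shift_by s) A = mu A.
Proof.
move=> mA; apply/esym/lebesgue_measure_unique => //= _ [[a b]] _ <-.
rewrite /pushforward (_ : _ @^-1` _ = `](a - s)%R, (b - s)%R]%classic).
  rewrite !lebesgue_measure_itv/= !lte_fin ltrD2r; case: ifP => // _.
  by rewrite -!EFinB; congr EFin; ring.
by apply/seteqP; split => x /=; rewrite !in_itv/= ltrBlDr lerBrDr.
Qed.

Lemma ae_shift (P : R -> Prop) (s : R) : {ae mu, forall x, P x} ->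
  {ae mu, forall x, P (x + s)}.
Proof.
move=> [N [mN N0 sN]]; exists (shift_by s @^-1` N); split.
- by rewrite -[X in measurable X]setTI; exact: mshift.
- by rewrite -[LHS](lebesgue_measure_shift s mN) in N0.
- by move=> x /= nP; exact: (sN (x + s)).
Qed.

End Translation.

(** * Square integrability *)

Section SquareIntegrable.
Variable R : realType.
Local Notation mu := (@lebesgue_measure R).
Implicit Types f g : R -> R.

(** [Lfun] is phrased with powers of absolute values; squares are more convenient. *)
Lemma L2P f : L2 f <-> measurable_fun setT f /\
  mu.-integrable setT (EFin \o (fun x => f x ^+ 2)).
Proof.
split => [Lf|[mf /integrableP[_ H]]].
  split; last exact: Lfun2_integrable_sqr.
  by move: Lf; rewrite /L2 inE => /andP[/set_mem].
rewrite /L2 inE; apply/andP; split; first exact/mem_set.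
apply/mem_set; rewrite /= /finite_norm unlock /Lnorm.
apply: poweR_lty; apply: le_lt_trans H; rewrite le_eqVlt; apply/orP; left.
apply/eqP; apply: eq_integral => x _ /=.
by rewrite ?poweR_EFin powR_mulrn// real_normK ?num_real// ger0_norm// sqr_ge0.
Qed.

End SquareIntegrable.

(** * Reduction to real functions *)

Section RealParts.
Variable R : realType.
Local Open Scope complex_scope.
Local Notation mu := (@lebesgue_measure R).

Lemma Re_mulC (r : R) (z : R[i]) : complex.Re (r%:C * z) = r * complex.Re z.
Proof. by case: z => a b /=; rewrite mul0r subr0. Qed.

Lemma Im_mulC (r : R) (z : R[i]) : complex.Im (r%:C * z) = r * complex.Im z.
Proof. by case: z => a b /=; rewrite mul0r addr0. Qed.

Lemma ReD (z w : R[i]) : complex.Re (z + w) = complex.Re z + complex.Re w.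
Proof. by case: z => a b; case: w. Qed.

Lemma ImD (z w : R[i]) : complex.Im (z + w) = complex.Im z + complex.Im w.
Proof. by case: z => a b; case: w. Qed.

Lemma ReN (z : R[i]) : complex.Re (- z) = - complex.Re z.
Proof. by case: z. Qed.

Lemma ImN (z : R[i]) : complex.Im (- z) = - complex.Im z.
Proof. by case: z. Qed.

Lemma weak_deriv_ext n (f f' g : R -> R) : f =1 f' ->
  weak_deriv n f g -> weak_deriv n f' g.
Proof. by move=> /funext ->. Qed.

Lemma real_kp_expr_ext (lam al be c : R) (v f g g' : R -> R) : g =1 g' ->
  real_kp_expr lam al be c v f g -> real_kp_expr lam al be c v f g'.
Proof. by move=> /funext ->. Qed.

Let ReE := (Re_mulC, ReD, ReN).
Let ImE := (Im_mulC, ImD, ImN).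

Lemma kp_expr_Re (lam al be c : R) (v : R -> R) (f g : R -> R[i]) :
  kp_expr lam%:C al be c v f g ->
  real_kp_expr lam al be c v (fun x => complex.Re (f x)) (fun x => complex.Re (g x)).
Proof.
move=> [f1 [f2 [f4 [w [[w1 _] [w2 _] [w4 _] [ww _] gE]]]]].
exists (fun x => complex.Re (f1 x)), (fun x => complex.Re (f2 x)),
  (fun x => complex.Re (f4 x)), (fun x => complex.Re (w x)); split => //.
  by apply: weak_deriv_ext ww => x; rewrite !ReE.
by apply: ae_imp gE => x ->; rewrite !ReE.
Qed.

Lemma kp_expr_Im (lam al be c : R) (v : R -> R) (f g : R -> R[i]) :
  kp_expr lam%:C al be c v f g ->
  real_kp_expr lam al be c v (fun x => complex.Im (f x)) (fun x => complex.Im (g x)).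
Proof.
move=> [f1 [f2 [f4 [w [[_ w1] [_ w2] [_ w4] [_ ww] gE]]]]].
exists (fun x => complex.Im (f1 x)), (fun x => complex.Im (f2 x)),
  (fun x => complex.Im (f4 x)), (fun x => complex.Im (w x)); split => //.
  by apply: weak_deriv_ext ww => x; rewrite !ImE.
by apply: ae_imp gE => x ->; rewrite !ImE.
Qed.

Lemma kp_expr_real (lam al be c : R) (v : R -> R) (f g : R -> R) :
  real_kp_expr lam al be c v f g ->
  kp_expr lam%:C al be c v (fun x => (f x)%:C) (fun x => (g x)%:C).
Proof.
move=> [f1 [f2 [f4 [w [w1 w2 w4 ww gE]]]]].
have w0 n : weak_deriv n (fun=> 0 : R) (fun=> 0 : R).
  apply: (@weak_deriv_tower _ n (fun _ _ => 0)) => [j x _|].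
    exact: is_derive_cst.
  exact: cst_continuous.
exists (fun x => (f1 x)%:C), (fun x => (f2 x)%:C),
  (fun x => (f4 x)%:C), (fun x => (w x)%:C); split => //.
  split; last first.
    rewrite (_ : (fun x => _) = (fun=> 0)) //; apply/funext => x.
    by rewrite !ImE /= !mulr0 subr0 !addr0.
  by apply: weak_deriv_ext ww => x; rewrite !ReE.
by apply: ae_imp gE => x ->; rewrite rmorphB rmorphM.
Qed.

(** At least one of the two components of a complex eigenfunction is not null. *)
Lemma per_eigenfunction (L k c nu : R) (p : R -> R) :
  Defs.eigenvalue (per_op L k c p) nu%:C ->
  exists f : R -> R, [/\ Hs_per 6 f, ~ {ae mu, forall x, f x = 0} &
    real_kp_expr L (k ^+ 4) (k ^+ 2) c p f (fun x => nu * f x)].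
Proof.
move=> [f nf [[fR fI] _ K]].
have [nR|aR] := pselect (~ {ae mu, forall x, complex.Re (f x) = 0}).
  exists (fun x => complex.Re (f x)); split => //.
  apply: real_kp_expr_ext (kp_expr_Re K) => x.
  by rewrite !ReE /= add0r.
exists (fun x => complex.Im (f x)); split => // [aI|].
  apply: nf; apply: ae_imp2 (contrapT aR) aI => x.
  by case: (f x) => a b /= -> ->.
apply: real_kp_expr_ext (kp_expr_Im K) => x.
by rewrite !ImE /= add0r.
Qed.

End RealParts.

(** * Periodic functions *)

Section PeriodicTowers.
Variable R : realType.
Local Notation mu := (@lebesgue_measure R).

(** Derivatives are unique. *)
Lemma tower_periodic n F (T : R) : tower n F -> (forall x, F 0%N (x + T) = F 0%N x) ->
  forall j x, (j <= n)%N -> F j (x + T) = F j x.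
Proof.
move=> tF pF; elim=> [|j IH] x jn; first exact: pF.
have D : is_derive x 1 (F j) (F j.+1 (x + T)).
  have d := tF j (x + T) jn.
  have := @is_derive_affine R (F j) 1 T x (F j.+1 (x + T)); rewrite mul1r.
  move=> /(_ d); move/is_derive_ext; apply; last by rewrite mul1r.
  by move=> y; rewrite mul1r IH// ltnW.
exact: is_derive_unique D (tF j x jn).
Qed.

Lemma periodic_nat (f : R -> R) (T : R) : (forall x, f (x + T) = f x) ->
  forall n x, f (x + n%:R * T) = f x.
Proof.
move=> pf; elim=> [|n IH] x; first by rewrite mul0r addr0.
by rewrite -addn1 natrD mulrDl mul1r addrA pf IH.
Qed.

Lemma periodic_reduce (f : R -> R) (T : R) : 0 < T -> (forall x, f (x + T) = f x) ->
  forall x, exists2 y, 0 <= y <= T & f x = f y.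
Proof.
move=> T0 pf x; pose m := Num.floor (x / T).
have /andP[m1 m2] : m%:~R * T <= x < (m + 1)%:~R * T.
  by rewrite -ler_pdivlMr// -ltr_pdivrMr// floor_le_tmp floorD1_gt.
exists (x - m%:~R * T).
  rewrite subr_ge0 m1 /= lerBlDr; move: m2; rewrite intrD mulrDl mul1r addrC.
  exact: ltW.
have H (n : nat) y : f (y - n%:R * T) = f y.
    by rewrite -(periodic_nat pf n (y - n%:R * T)) subrK.
case: m {m1 m2} => n; first by rewrite H.
by rewrite NegzE mulrNz mulNr opprK (periodic_nat pf).
Qed.

Lemma periodic_bounded (f : R -> R) (T : R) : 0 < T -> continuous f ->
  (forall x, f (x + T) = f x) -> exists2 M, 0 <= M & forall x, `|f x| <= M.
Proof.
move=> T0 cf pf; have [M M0 HM] := continuous_itv_bounded 0 T cf.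
by exists M => // x; have [y /HM] := periodic_reduce T0 pf x; move=> ? ->.
Qed.

(** Periodicity is assumed for the representative [f], and has to be transported to the
continuous representative by translation invariance. *)
Lemma Hs_per_tower n (f : R -> R) : Hs_per n.+1 f ->
  exists F, [/\ tower n F, continuous (F n), {ae mu, forall x, f x = F 0%N x} &
    forall x, F 0%N (x + 2 * pi) = F 0%N x].
Proof.
move=> [[_ H] pf].
have [F [tF cF fF]] : exists F, [/\ tower n F, continuous (F n) &
    {ae mu, forall x, f x = F 0%N x}].
  by apply: weakly_differentiable_tower => j /H[g wg _]; exists g.
exists F; split => //.
have cF0 : continuous (F 0%N).
  by case: n tF cF {H} => // n tF _; exact: tower_continuous tF _.
have E : (fun x => F 0%N (x + 2 * pi)) = F 0%N.
  apply: ae_eq_continuous => //.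
    move=> x; apply: continuous_comp; last exact: cF0.
    by apply: cvgD; [exact: cvg_id|exact: cvg_cst].
  by apply: ae_imp2 fF (ae_shift (2 * pi) fF) => x <- <-; exact: pf.
by move=> x; rewrite -[RHS](congr1 (fun g => g x) E).
Qed.

End PeriodicTowers.

(** * Uniqueness for linear differential equations *)

Section LinearODE.
Variable R : realType.
Implicit Types (W : nat -> R -> R).

(** [E exp(-K x)] is nonincreasing, nonnegative and starts at zero. *)
Lemma gronwall_zero (E dE : R -> R) (K : R) : (forall x : R, is_derive x 1 E (dE x)) ->
  (forall x, 0 <= x -> 0 <= E x) -> (forall x, 0 <= x -> dE x <= K * E x) ->
  E 0 = 0 -> forall x, 0 <= x -> E x = 0.
Proof.
move=> dEx E0 HE E00 x x0.
pose Q y := - (E y * expR (- K * y)).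
have dQ (y : R) : is_derive y 1 Q ((K * E y - dE y) * expR (- K * y)).
  have dk : is_derive y 1 (fun z : R => expR (- K * z)) (- K * expR (- K * y)).
    have := @is_derive_affine R expR (- K) 0 y _ (is_derive_expR _).
    by rewrite addr0; move/is_derive_ext; apply => // z; rewrite addr0.
  have := is_deriveN (is_deriveM (dEx y) dk).
  move/is_derive_ext; apply => //.
  by rewrite -![_ *: _]/(_ * _); ring.
have : Q 0 <= Q x.
  apply: (derive_ge0_nondecreasing x0 dQ) => y /andP[y0 _].
  by rewrite mulr_ge0 ?expR_ge0// subr_ge0 HE// ltW.
rewrite /Q E00 mul0r oppr0 oppr_ge0 pmulr_lle0 ?expR_gt0// => Ex.
by apply/eqP; rewrite eq_le Ex E0.
Qed.

Lemma prod_le_sqr (a b E : R) : a ^+ 2 <= E -> b ^+ 2 <= E -> `|a| * `|b| <= E.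
Proof.
move=> aE bE; have E0 : 0 <= E by apply: le_trans aE; exact: sqr_ge0.
rewrite -normrM.
have : 0 <= (a - b) ^+ 2 by exact: sqr_ge0.
have : 0 <= (a + b) ^+ 2 by exact: sqr_ge0.
by rewrite ler_norml => *; nra.
Qed.

(** Gronwall's lemma for the sum of the squares of [W 0], ..., [W (n - 1)]. *)
Lemma ode_uniqueness n W (B : R) : (0 < n)%N -> tower n W ->
  (forall x, 0 <= x -> `|W n x| <= B * \sum_(i < n) `|W i x|) ->
  (forall j, (j < n)%N -> W j 0 = 0) ->
  forall x j, 0 <= x -> (j < n)%N -> W j x = 0.
Proof.
move=> n0 tW HB W0.
pose E x := \sum_(i < n) W i x ^+ 2.
have WE x j : (j < n)%N -> W j x ^+ 2 <= E x.
  move=> jn; rewrite /E (bigD1 (Ordinal jn))//= lerDl sumr_ge0// => i _.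
  exact: sqr_ge0.
have E0 x : 0 <= E x by apply: sumr_ge0 => i _; exact: sqr_ge0.
pose dE x := \sum_(i < n) 2 * W i x * W i.+1 x.
have dEx (x : R) : is_derive x 1 E (dE x).
  have d (i : 'I_n) : is_derive x 1 (fun y => W i y ^+ 2) (2 * W i x * W i.+1 x).
    have := is_deriveX 2 (tW i x (ltn_ord i)).
    by move/is_derive_ext; apply => //=; rewrite expr1.
  have := @is_derive_sum _ _ _ n (fun i y => W i y ^+ 2) x 1 _ d.
  by move/is_derive_ext; apply => // y; rewrite fct_sumE.
have B0 x : 0 <= x -> `|W n x| <= `|B| * \sum_(i < n) `|W i x|.
  move=> x0; apply: le_trans (HB x x0) _.
  by rewrite ler_wpM2r ?ler_norm// sumr_ge0.
(* [2] bounds the products of consecutive derivatives; the rest comes from the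
   equation, which enters through the term with [W n] *)
pose K1 : R := 2 + 2 * `|B| * n%:R.
have HdE x : 0 <= x -> dE x <= (n%:R * K1) * E x.
  move=> x0; have -> : n%:R * K1 * E x = \sum_(i < n) K1 * E x.
    by rewrite sumr_const card_ord -[RHS]mulr_natl mulrA.
  apply: ler_sum => i _.
  apply: le_trans (ler_norm _) _; rewrite !normrM (ger0_norm (ler0n _ 2)).
  have [i1|i1] := ltnP i.+1 n.
    have := prod_le_sqr (WE x i (ltn_ord i)) (WE x i.+1 i1).
    have : 0 <= 2 * `|B| * n%:R * E x by rewrite !mulr_ge0.
    by rewrite /K1 mulrDl; lra.
  have -> : i.+1 = n by apply/eqP; rewrite eqn_leq i1 ltn_ord.
  have H : `|W i x| * `|W n x| <= `|B| * (n%:R * E x).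
    apply: le_trans (ler_wpM2l (normr_ge0 _) (B0 x x0)) _.
    rewrite mulrCA ler_wpM2l// mulr_sumr.
    have -> : n%:R * E x = \sum_(i < n) E x by rewrite sumr_const card_ord mulr_natl.
    by apply: ler_sum => j _; apply: prod_le_sqr; apply: WE; exact: ltn_ord.
  by rewrite /K1 mulrDl; have := E0 x; move: H; rewrite !mulrA; lra.
have E00 : E 0 = 0.
  by rewrite /E big1// => i _; rewrite W0// expr0n.
move=> x j x0 jn; apply/eqP; rewrite -sqrf_eq0 eq_le sqr_ge0 andbT.
by rewrite -(gronwall_zero dEx (fun y _ => E0 y) HdE E00 x0) WE.
Qed.

(** The initial data of [n.+1] solutions form a matrix with more rows than columns, so
some nontrivial combination has zero data. *)
Lemma solutions_dependent n (W : 'I_n.+1 -> nat -> R -> R) (B : R) (b : nat -> R -> R) :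
  (0 < n)%N -> (forall r, tower n (W r)) ->
  (forall r x, 0 <= x -> W r n x = \sum_(i < n) b i x * W r i x) ->
  (forall i x, (i < n)%N -> 0 <= x -> `|b i x| <= B) ->
  exists2 al : 'I_n.+1 -> R, (exists r, al r != 0) &
    forall x, 0 <= x -> \sum_(r < n.+1) al r * W r 0%N x = 0.
Proof.
move=> n0 tW eW bB.
pose M := \matrix_(r < n.+1, j < n) W r j 0.
have /rowV0Pn[v /sub_kermxP vM v0] : kermx M != 0.
  rewrite kermx_eq0 /row_free neq_ltn; apply/orP; left.
  by apply: leq_ltn_trans (rank_leq_col M) _.
exists (fun r => v 0 r).
  move: v0; apply: contra_neqP => /forallNP H.
  by apply/rowP => r; rewrite mxE; apply: contrapT => /eqP; exact: H.
pose V j x := \sum_(r < n.+1) v 0 r * W r j x.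
have V0 j : (j < n)%N -> V j 0 = 0.
  move=> jn; have := congr1 (fun A : 'rV_n => A 0 (Ordinal jn)) vM.
  rewrite !mxE => E; rewrite -[RHS]E; apply: eq_bigr => r _; by rewrite mxE.
have tV : tower n V.
  move=> j x jn.
  have d (r : 'I_n.+1) : is_derive x 1 (fun y => v 0 r * W r j y) (v 0 r * W r j.+1 x).
    by have := is_deriveZ (v 0 r) (tW r j x jn); move/is_derive_ext; apply.
  have := @is_derive_sum _ _ _ _ (fun r y => v 0 r * W r j y) x 1 _ d.
  by move/is_derive_ext; apply => // y; rewrite fct_sumE.
have VB x : 0 <= x -> `|V n x| <= B * \sum_(i < n) `|V i x|.
  move=> x0; have -> : V n x = \sum_(i < n) b i x * V i x.
    rewrite /V; under eq_bigr => r _ do rewrite eW// mulr_sumr.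
    rewrite exchange_big /=; apply: eq_bigr => i _; rewrite mulr_sumr.
    by apply: eq_bigr => r _; rewrite mulrCA.
  apply: le_trans (ler_norm_sum _ _ _) _; rewrite mulr_sumr; apply: ler_sum => i _.
  by rewrite normrM ler_wpM2r// bB.
move=> x x0; exact: (ode_uniqueness n0 tV VB V0 x0 n0).
Qed.

End LinearODE.

(** * Slowly varying amplitudes *)

Section SlowModulation.
Variable R : realType.
Implicit Types (F G : nat -> R -> R) (a t x : R).

(** The derivatives of [x^a], meaningful for [x > 0]. *)
Definition power_tower (a : R) (j : nat) (x : R) : R :=
  (\prod_(i < j) (a - i%:R)) * x `^ (a - j%:R).

Lemma is_derive_power a j x : 0 < x -> is_derive x 1 (power_tower a j) (power_tower a j.+1 x).
Proof.
move=> x0; have := is_deriveZ (\prod_(i < j) (a - i%:R)) (is_derive1_powR (a - j%:R) x0).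
move/is_derive_ext; apply => //.
by rewrite /power_tower big_ord_recr /= -[_ *: _]/(_ * _) mulrA -addrA -opprD natr1.
Qed.

Lemma power_le a j x : 0 <= a <= 1 / 4 -> 1 <= x -> (0 < j <= 6)%N ->
  `|power_tower a j x| <= 6 ^+ 6 * x `^ (- (3 / 4)).
Proof.
move=> /andP[a0 a1] x1 /andP[j0 j6].
rewrite /power_tower normrM (ger0_norm (powR_ge0 _ _)) ler_pM ?powR_ge0//.
  apply: (@le_trans _ _ (6 ^+ j)); last first.
    by rewrite ler_weXn2l// ler1n.
  rewrite normr_prod; apply: (@le_trans _ _ (\prod_(i < j) (6 : R))).
    apply: ler_prod => i _; rewrite normr_ge0 /=.
    have i5 : (i%:R : R) <= 5 by rewrite ler_nat -ltnS (leq_trans (ltn_ord i)).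
    have i0 : 0 <= (i%:R : R) by [].
    by rewrite ler_norml; lra.
  by rewrite prodr_const card_ord.
apply: ler_powR => //.
have : (1 : R) <= j%:R by rewrite ler1n.
lra.
Qed.

Lemma power0_le a x : 0 <= a <= 1 / 4 -> 1 <= x -> `|power_tower a 0 x| <= x `^ (1 / 4).
Proof.
move=> /andP[a0 a1] x1; rewrite /power_tower big_ord0 mul1r subr0 ger0_norm ?powR_ge0//.
exact: ler_powR.
Qed.

Definition unit_drop (j : nat) (x : R) : R := (j == 0%N)%:R - unit_step j x.

Lemma smooth_unit_drop : smooth unit_drop.
Proof.
move=> j x; have := is_deriveB (is_derive_cst ((j == 0%N)%:R : R) x 1) (smooth_unit_step j x).
by move/is_derive_ext; apply.
Qed.

Definition up_cut := affine_tower (@unit_step R) 1 (- 1).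
Definition down_cut t := affine_tower unit_drop t (- 1).
(** Rises across [[1, 2]] and, for [t > 0], falls across [[1/t, 2/t]].  With [t = 0] the
second factor is identically [1], so that the truncated and the full amplitudes
are members of one family and are estimated together. *)
Definition cutoff t (j : nat) : R -> R := leibniz j up_cut (down_cut t).
(** The slowly varying amplitude: a truncated power. *)
Definition modulation a t (j : nat) : R -> R := leibniz j (cutoff t) (power_tower a).

Lemma step_out j x : x <= 0 -> unit_step j x = 0.
Proof. by case: j => [|j] x0; [exact: step_le0|apply: bump_out; left]. Qed.

Lemma unit_drop_ge1 j x : 1 <= x -> unit_drop j x = 0.
Proof.
rewrite /unit_drop; case: j => [|j] x1; first by rewrite step_ge1// subrr.
by rewrite /= bump_out ?subr0//; right.
Qed.

Lemma unit_drop_le0 j x : x <= 0 -> unit_drop j x = (j == 0%N)%:R.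
Proof. by move=> x0; rewrite /unit_drop step_out// subr0. Qed.

Lemma cutoff_le1 t j x : x <= 1 -> cutoff t j x = 0.
Proof.
move=> x1; apply: leibniz_eq0l => i _; rewrite /up_cut /affine_tower step_out ?mulr0//.
by rewrite mul1r subr_le0.
Qed.

Lemma modulation_le1 a t j x : x <= 1 -> modulation a t j x = 0.
Proof. by move=> x1; apply: leibniz_eq0l => i _; exact: cutoff_le1. Qed.

Lemma smooth_cutoff t : smooth (cutoff t).
Proof.
by move=> j x; apply: is_derive_leibniz => i _; apply: smooth_affine;
  [exact: smooth_unit_step|exact: smooth_unit_drop].
Qed.

(** The power is only differentiable on [x > 0]; to the left of [1] the product is
identically zero. *)
Lemma smooth_modulation a t : smooth (modulation a t).
Proof.
move=> j x; have [x0|x0] := ltP x 1; last first.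
  apply: is_derive_leibniz => i _; first exact: smooth_cutoff.
  by apply: is_derive_power; exact: lt_le_trans x0.
rewrite modulation_le1 ?(ltW x0)//.
apply: near_eq_is_derive (is_derive_cst (0:R) x 1); near=> y.
rewrite modulation_le1//; apply/ltW; near: y.
exact: lt_nbhsl.
Unshelve. all: by end_near. Qed.

Lemma cutoff_far t j x : 2 <= t * x -> cutoff t j x = 0.
Proof.
move=> tx; apply/eqP; rewrite -normr_le0 -[leRHS](mulr0 (2 ^+ j)).
apply: leibniz_le_terms => i ij; rewrite /down_cut /affine_tower unit_drop_ge1 ?mulr0 ?normr0 ?mulr0//.
lra.
Qed.

Lemma modulation_far a t j x : 2 <= t * x -> modulation a t j x = 0.
Proof. by move=> tx; apply: leibniz_eq0l => i _; exact: cutoff_far. Qed.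

Lemma modulation_near a t j x : t * x <= 1 -> modulation a t j x = modulation a 0 j x.
Proof.
move=> tx; apply: eq_leibniz => // i _; apply: eq_leibniz => // k _.
rewrite /down_cut /affine_tower mul0r !unit_drop_le0; [|lra|lra].
by case: k => [|k]; rewrite ?expr0// !mulr0.
Qed.

Lemma modulation_main a x : 2 <= x -> modulation a 0 0 x = x `^ a.
Proof.
move=> x2; rewrite /modulation /= /cutoff /= /up_cut /down_cut /affine_tower /power_tower.
rewrite big_ord0 !expr0 !mul1r subr0 step_ge1; last lra.
by rewrite mul0r unit_drop_le0 ?mul1r//; lra.
Qed.

Lemma step_bounded : exists2 B, 0 <= B & forall j x, (j <= 6)%N -> `|unit_step j x : R| <= B.
Proof.
have [B B0 HB] : exists2 B, 0 <= B & forall j x, (j <= 6)%N -> True -> `|unit_step j x : R| <= B.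
  apply: bounded_family => -[_|j _].
    by exists 1 => // x _; have /andP[s0 s1] := step_ge0_le1 x; rewrite ger0_norm.
  have cb : continuous (@unit_step R j.+1) by apply: smooth_continuous; exact: smooth_unit_step.
  have [B B0 HB] := continuous_itv_bounded 0 1 cb; exists B => // x _.
  have [x0|x0] := leP x 0; first by rewrite step_out// normr0.
  have [x1|x1] := leP 1 x; first by rewrite /= bump_out ?normr0//; right.
  by apply: HB; rewrite !ltW.
by exists B => // j x j6; exact: HB.
Qed.

(** The derivatives live on [[1, 2]], where [1 <= 2 / x]. *)
Lemma up_cut_bound : exists2 B, 0 <= B & forall j x, (0 < j <= 6)%N -> 1 <= x ->
  `|up_cut j x| <= B / x.
Proof.
have [B B0 HB] := step_bounded; exists (2 * B) => [|j x /andP[j0 j6] x1]; first by rewrite mulr_ge0.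
rewrite /up_cut /affine_tower expr1n !mul1r.
rewrite ler_pdivlMr; last lra.
have [x2|x2] := leP 2 x.
  case: j j0 {j6} => // j _; rewrite /= bump_out ?normr0 ?mul0r ?mulr_ge0//; right; lra.
rewrite mulrC ler_pM//; [lra|exact: ltW|exact: HB].
Qed.

(** The derivatives carry a factor [t] and live where [t x <= 2], that is, where
[t <= 2 / x]: the bound does not depend on [t]. *)
Lemma down_cut_bound : exists2 B, 0 <= B & forall t j x, 0 <= t <= 1 -> (0 < j <= 6)%N ->
  1 <= x -> `|down_cut t j x| <= B / x.
Proof.
have [B B0 HB] := step_bounded; exists (2 * B) => [|t j x /andP[t0 t1] /andP[j0 j6] x1].
  by rewrite mulr_ge0.
rewrite ler_pdivlMr; last lra.
have [x2|x2] := leP 2 (t * x).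
  by rewrite /down_cut /affine_tower unit_drop_ge1 ?mulr0 ?normr0 ?mul0r ?mulr_ge0//; lra.
rewrite /down_cut /affine_tower /unit_drop (gtn_eqF j0) sub0r mulrN normrN normrM.
rewrite mulrAC ler_pM//; last exact: HB.
  by rewrite mulr_ge0//; lra.
rewrite (ger0_norm (exprn_ge0 _ t0)).
apply: le_trans (ltW x2); rewrite ler_wpM2r//; first lra.
by case: j j0 {j6} => // j _; rewrite exprS ler_piMr// exprn_ile1.
Qed.

Lemma up_cut0_le x : `|up_cut 0 x| <= 1.
Proof.
rewrite /up_cut /affine_tower expr0 !mul1r.
by have /andP[s0 s1] := step_ge0_le1 (x - 1); rewrite ger0_norm.
Qed.

Lemma down_cut0_le t x : `|down_cut t 0 x| <= 1.
Proof.
rewrite /down_cut /affine_tower /unit_drop expr0 mul1r eqxx.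
move: (step_ge0_le1 (t * x - 1)); move: (unit_step 0 _) => s /andP[s0 s1].
by rewrite ger0_norm; rewrite /=; lra.
Qed.

Lemma cutoff0_le t x : `|cutoff t 0 x| <= 1.
Proof. by rewrite /cutoff /= normrM mulr_ile1// ?up_cut0_le ?down_cut0_le. Qed.

Lemma cutoff_bound : exists2 B, 0 <= B & forall t j x, 0 <= t <= 1 -> (0 < j <= 6)%N ->
  1 <= x -> `|cutoff t j x| <= B / x.
Proof.
have [B B0 HB] := up_cut_bound; have [C C0 HC] := down_cut_bound.
exists (2 ^+ 6 * (B + C + B * C)) => [|t j x t01 /andP[j0 j6] x1].
  by rewrite mulr_ge0// !addr_ge0// mulr_ge0.
have x0 : 0 < x by lra.
apply: (@le_trans _ _ (2 ^+ j * ((B + C + B * C) / x))); last first.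
  rewrite -mulrA ler_wpM2r//; last by rewrite ler_weXn2l// ler1n.
  by apply: divr_ge0; [rewrite !addr_ge0// mulr_ge0|exact: ltW].
apply: leibniz_le_terms => i ij.
have u0 := up_cut0_le x; have d0 := down_cut0_le t x.
have BC0 : 0 <= B * C by rewrite mulr_ge0.
have [i0|i0] := posnP i.
  rewrite i0 subn0; apply: (@le_trans _ _ (1 * (C / x))).
    by rewrite ler_pM// HC// j0.
  by rewrite mul1r ler_wpM2r ?invr_ge0 ?(ltW x0)//; lra.
have iB : `|up_cut i x| <= B / x by rewrite HB// i0 (leq_trans ij).
have [ji|ji] := posnP (j - i)%N.
  rewrite ji; apply: (@le_trans _ _ (B / x * 1)); first by rewrite ler_pM.
  by rewrite mulr1 ler_wpM2r ?invr_ge0 ?(ltW x0)//; lra.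
have jC : `|down_cut t (j - i) x| <= C / x by rewrite HC// ji (leq_trans (leq_subr _ _)).
apply: (@le_trans _ _ (B / x * (C / 1))).
  rewrite ler_pM//; apply: le_trans jC _; rewrite ler_wpM2l// lef_pV2//.
  by rewrite posrE.
by rewrite divr1 mulrAC ler_wpM2r ?invr_ge0 ?(ltW x0)//; lra.
Qed.

Lemma modulation0_le a t x : 0 <= a <= 1 / 4 -> 1 <= x ->
  `|modulation a t 0 x| <= x `^ (1 / 4).
Proof.
move=> a01 x1; rewrite /modulation /= normrM -[leRHS]mul1r.
by rewrite ler_pM// ?cutoff0_le// power0_le.
Qed.

Lemma powR_quarter x : 0 < x -> x `^ (1 / 4) / x = x `^ (- (3 / 4)).
Proof.
move=> x0; rewrite -{2}(powRr1 (ltW x0)) -powRB ?(gt_eqF x0) ?implybT//.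
by congr (_ `^ _); lra.
Qed.

(** The exponent stays below [1/4], so that [x^a / x] is [O(x^(-3/4))], whose square is
integrable at infinity.  This holds uniformly in the truncation parameter. *)
Lemma modulation_bound : exists2 C, 0 <= C & forall a t j x, 0 <= a <= 1 / 4 ->
  0 <= t <= 1 -> (0 < j <= 6)%N -> 1 <= x ->
  `|modulation a t j x| <= C * x `^ (- (3 / 4)).
Proof.
have [B B0 HB] := cutoff_bound; pose D : R := 6 ^+ 6.
have D1 : 1 <= D by rewrite exprn_ege1// ler1n.
exists (2 ^+ 6 * (D + B * D)) => [|a t j x a01 t01 /andP[j0 j6] x1].
  by rewrite mulr_ge0// addr_ge0 ?mulr_ge0//; lra.
have x0 : 0 < x by lra.
set y := x `^ _; have y0 : 0 <= y by exact: powR_ge0.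
apply: (@le_trans _ _ (2 ^+ j * ((D + B * D) * y))); last first.
  rewrite -mulrA ler_wpM2r//; last by rewrite ler_weXn2l// ler1n.
  by rewrite mulr_ge0// addr_ge0 ?mulr_ge0//; lra.
apply: leibniz_le_terms => i ij.
have D0 : 0 <= D by lra.
have [i0|i0] := posnP i.
  rewrite i0 subn0; apply: (@le_trans _ _ (1 * (D * y))).
    by rewrite ler_pM// ?cutoff0_le// power_le// j0.
  by rewrite mul1r ler_wpM2r// lerDl mulr_ge0.
have iB : `|cutoff t i x| <= B / x by rewrite HB// i0 (leq_trans ij).
have E : `|power_tower a (j - i) x| <= D * x `^ (1 / 4).
  have [ji|ji] := posnP (j - i)%N.
    rewrite ji; apply: le_trans (power0_le a01 x1) _.
    by rewrite ler_peMl// powR_ge0.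
  apply: le_trans (power_le a01 x1 _) _; first by rewrite ji (leq_trans (leq_subr _ _)).
  by rewrite ler_wpM2l// ler_powR//; lra.
apply: (@le_trans _ _ (B / x * (D * x `^ (1 / 4)))); first by rewrite ler_pM.
have -> : B / x * (D * x `^ (1 / 4)) = B * D * y.
  by rewrite /y -powR_quarter//; ring.
by rewrite ler_wpM2r// lerDr.
Qed.

End SlowModulation.

(** * The residual of a modulated eigenfunction *)

Section Residual.
Variable R : realType.

(** Besides [m psi^(j)] every term of Leibniz' rule contains a derivative of [m]. *)
Lemma leibniz_sub_main j (m psi : nat -> R -> R) (x M beta : R) : 0 <= M -> 0 <= beta ->
  (forall i, (i <= j)%N -> `|psi i x| <= M) ->
  (forall i, (0 < i <= j)%N -> `|m i x| <= beta) ->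
  `|leibniz j m psi x - m 0%N x * psi j x| <= 2 ^+ j * (beta * M).
Proof.
move=> M0 b0; elim: j psi => [|j IH] psi Hp Hm.
  by rewrite /= subrr normr0 expr0 mul1r mulr_ge0.
have -> : leibniz j.+1 m psi x - m 0%N x * psi j.+1 x =
    leibniz j (fun k => m k.+1) psi x +
    (leibniz j m (fun k => psi k.+1) x - m 0%N x * psi j.+1 x) by rewrite /= addrA.
apply: (le_trans (ler_normD _ _)); rewrite exprS -mulrA mulr_natl mulr2n lerD//.
  apply: leibniz_le_terms => i ij; rewrite ler_pM//; first exact: Hm.
  by apply: Hp; rewrite (leq_trans (leq_subr _ _)).
apply: (IH (fun k => psi k.+1)) => i; first exact: (Hp i.+1).
by move=> /andP[i0 ij]; apply: Hm; rewrite i0 leqW.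
Qed.

(** The residual of [m psi] at one point, with values in place of functions: [s_j] and
[p_j] stand for the derivatives of [m psi] and [psi], [u_j] and [v_j] for those of
the two potentials.  The contribution of [m0] times the limiting equation cancels;
what remains contains a derivative of [m] or a difference of potentials. *)
Lemma residual_arith (lam c nu m0 p0 p1 p2 p4 p6 s0 s1 s2 s4 s6 u0 u1 u2 v0 v1 v2
    M B delta E mu : R) : 0 <= M -> 0 <= B -> 0 <= delta -> 0 <= E -> 0 <= mu ->
  lam * p1 - (1 * p6 + 1 * p4 - c * p2 + (v2 * p0 + v1 * p1 + (v1 * p1 + v0 * p2)))
    = nu * p0 ->
  `|p0| <= M -> `|p1| <= M -> `|p2| <= M ->
  `|s0 - m0 * p0| <= E -> `|s1 - m0 * p1| <= E -> `|s2 - m0 * p2| <= E ->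
  `|s4 - m0 * p4| <= E -> `|s6 - m0 * p6| <= E ->
  `|u0| <= B -> `|u1| <= B -> `|u2| <= B ->
  `|u0 - v0| <= delta -> `|u1 - v1| <= delta -> `|u2 - v2| <= delta -> `|m0| <= mu ->
  `|lam * s1 - (1 * s6 + 1 * s4 - c * s2 + (u2 * s0 + u1 * s1 + (u1 * s1 + u0 * s2)))
     - nu * (m0 * p0)| <= E * (`|lam| + 2 + `|c| + 4 * B) + 4 * (mu * (delta * M)).
Proof.
move=> M0 B0 d0 E0 mu0 eq P0 P1 P2 E_0 E_1 E_2 E_4 E_6 U0 U1 U2 D0 D1 D2 Hm.
have -> : lam * s1 - (1 * s6 + 1 * s4 - c * s2 + (u2 * s0 + u1 * s1 + (u1 * s1 + u0 * s2)))
     - nu * (m0 * p0) =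
   lam * (s1 - m0 * p1) + (- (s6 - m0 * p6)) + (- (s4 - m0 * p4)) + c * (s2 - m0 * p2) +
   (- (u2 * (s0 - m0 * p0))) + (- (u1 * (s1 - m0 * p1))) + (- (u1 * (s1 - m0 * p1))) +
   (- (u0 * (s2 - m0 * p2))) + (- (m0 * ((u2 - v2) * p0))) + (- (m0 * ((u1 - v1) * p1)))
   + (- (m0 * ((u1 - v1) * p1))) + (- (m0 * ((u0 - v0) * p2))).
  have -> : nu * (m0 * p0) = m0 * (nu * p0) by ring.
  by rewrite -eq; ring.
have T0 (a b A C : R) : `|a| <= A -> `|b| <= C -> `|a * b| <= A * C.
  by move=> aA bC; rewrite normrM ler_pM.
have L1 := T0 _ _ _ _ (lexx `|lam|) E_1; have L2 := T0 _ _ _ _ (lexx `|c|) E_2.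
have L3 := T0 _ _ _ _ U2 E_0; have L4 := T0 _ _ _ _ U1 E_1; have L5 := T0 _ _ _ _ U0 E_2.
have L6 := T0 _ _ _ _ Hm (T0 _ _ _ _ D2 P0).
have L7 := T0 _ _ _ _ Hm (T0 _ _ _ _ D1 P1).
have L8 := T0 _ _ _ _ Hm (T0 _ _ _ _ D0 P2).
have R1 : E * (`|lam| + 2 + `|c| + 4 * B) + 4 * (mu * (delta * M)) =
  `|lam| * E + E + E + `|c| * E + B * E + B * E + B * E + B * E +
  mu * (delta * M) + mu * (delta * M) + mu * (delta * M) + mu * (delta * M) by ring.
rewrite R1 {R1 eq}.
by do ?[apply: (le_trans (ler_normD _ _)); apply: lerD]; rewrite ?normrN.
Qed.

End Residual.

(** * Integrals at infinity *)

Section TailIntegrals.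
Variable R : realType.
Local Notation mu := (@lebesgue_measure R).

Let f (x : R) := x `^ (- (3 / 2)).
Let F (x : R) := (- 2) * x `^ (- (1 / 2)).

Let dF (x : R) : 0 < x -> is_derive x 1 F (f x).
Proof.
move=> x0; have := is_deriveZ (-2 : R) (is_derive1_powR (- (1 / 2)) x0).
move/is_derive_ext; apply => //.
rewrite /f -[_ *: _]/(_ * _) mulrA (_ : -2 * - (1 / 2) = 1); last lra.
by rewrite [LHS]mul1r; congr (powR x _); lra.
Qed.

Let Fcvg : F x @[x --> +oo%R] --> (0 : R).
Proof.
apply/cvgrPdist_le => e e0; near=> x.
have x0 : 0 < x by near: x; exact: nbhs_pinfty_gt.
rewrite sub0r normrN normrM normrN (ger0_norm (powR_ge0 _ _)) powRN ger0_norm//.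
rewrite ler_pdivrMr ?powR_gt0// -ler_pdivrMl//.
rewrite (_ : e^-1 * 2 = ((e^-1 * 2) ^+ 2) `^ (1 / 2)).
  by apply: ge0_ler_powR; rewrite ?nnegrE ?sqr_ge0 ?(ltW x0)//; near: x; apply: nbhs_pinfty_ge.
have H : 0 <= e^-1 * 2 by rewrite mulr_ge0// invr_ge0 ltW.
by rewrite -[(_ ^+ 2)]powR_mulrn// -powRrM (_ : 2%:R * (1 / 2) = 1) ?powRr1//; lra.
Unshelve. all: by end_near. Qed.

Lemma tail_integral (N : R) : 0 < N ->
  (\int[mu]_(x in `[N, +oo[) (f x)%:E = (2 * N `^ (- (1 / 2)))%:E)%E.
Proof.
move=> N0.
have cf (x : R) : 0 < x -> {for x, continuous f}.
  move=> x0; apply: is_derive_continuous (is_derive1_powR _ x0).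
rewrite (@ge0_continuous_FTC2y R f F N 0).
- by rewrite -EFinD /F; congr EFin; lra.
- by move=> x _; exact: powR_ge0.
- apply: continuous_in_subspaceT => x; rewrite inE/= in_itv/= andbT => Nx.
  by apply: cf; exact: lt_le_trans Nx.
- exact: Fcvg.
- by move=> x Nx; case: (dF (lt_trans N0 Nx)).
- by apply: cvg_at_right_filter; exact: is_derive_continuous (dF N0).
- move=> x; rewrite in_itv/= andbT => Nx; rewrite derive1E.
  by case: (dF (lt_trans N0 Nx)).
Qed.

(** The comparison function [x^(-3/2)] has primitive [-2 x^(-1/2)]. *)
Lemma square_tail (g : R -> R) (C N : R) : continuous g -> 1 <= N ->
  (forall x, x < N -> g x = 0) ->
  (forall x, N <= x -> `|g x| <= C * x `^ (- (3 / 4))) ->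
  mu.-integrable setT (EFin \o (fun x => g x ^+ 2)) /\
  ((\int[mu]_x (g x ^+ 2)) <= 2 * C ^+ 2 * N `^ (- (1 / 2)))%R.
Proof.
move=> cg N1 g0 gC.
have N0 : 0 < N by lra.
have cg2 := continuous_sqr cg.
have mg2 := continuous_measurable_fun cg2.
have H : (\int[mu]_x (g x ^+ 2)%:E <= (2 * C ^+ 2 * N `^ (- (1 / 2)))%:E)%E.
  have -> : (\int[mu]_x (g x ^+ 2)%:E = \int[mu]_(x in `[N, +oo[) (g x ^+ 2)%:E)%E.
    rewrite [RHS]integral_mkcond; apply: eq_integral => x _; rewrite patchE.
    case: ifPn => //; rewrite notin_setE/= in_itv/= andbT => /negP; rewrite -ltNge => xN.
    by rewrite g0// expr0n.
  apply: (@le_trans _ _ (\int[mu]_(x in `[N, +oo[) ((C ^+ 2)%:E * (f x)%:E))%E).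
    apply: ge0_le_integral => //=.
    - by move=> x _; rewrite lee_fin sqr_ge0.
    - by apply/measurable_EFinP; exact: measurable_funTS.
    - apply: measurable_funTS; apply/measurable_EFinP; apply: measurable_funM => //.
      exact: measurable_powR.
    - move=> x; rewrite in_itv/= andbT => Nx; rewrite -EFinM lee_fin.
      have -> : f x = (x `^ (- (3 / 4))) ^+ 2.
        rewrite -powR_mulrn ?powR_ge0// -powRrM /f; congr (_ `^ _); lra.
      rewrite -exprMn -real_normK ?num_real// lerXn2r ?nnegrE//; last exact: gC.
      by apply: le_trans (gC _ Nx).
  rewrite ge0_integralZl//=; last 3 first.
  - by apply: measurable_funTS; apply/measurable_EFinP; exact: measurable_powR.
  - by move=> x _; rewrite lee_fin powR_ge0.
  - by rewrite lee_fin sqr_ge0.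
  rewrite tail_integral// -EFinM lee_fin; lra.
have I : mu.-integrable setT (EFin \o (fun x => g x ^+ 2)).
  apply/integrableP; split; first exact/measurable_EFinP.
  apply: le_lt_trans (ltry (2 * C ^+ 2 * N `^ (- (1 / 2)))).
  apply: le_trans H; rewrite le_eqVlt; apply/orP; left; apply/eqP.
  by apply: eq_integral => x _ /=; rewrite ger0_norm// sqr_ge0.
split => //; rewrite -lee_fin; apply: le_trans H.
by rewrite /Rintegral fineK//; exact: integrable_fin_num I.
Qed.

End TailIntegrals.

(** * Membership in L^2 *)

Section L2Tools.
Variable R : realType.
Local Notation mu := (@lebesgue_measure R).

Lemma L2_zero : L2 (fun=> 0 : R).
Proof.
apply/L2P; split => //; rewrite (_ : _ \o _ = cst 0%E); first exact: integrable0.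
by apply/funext => x /=; rewrite expr0n.
Qed.

(** A continuous function is square integrable on a segment. *)
Lemma compact_support_L2 (f : R -> R) (a b : R) : continuous f ->
  (forall x, x < a \/ b < x -> f x = 0) -> L2 f.
Proof.
move=> cf f0; apply/L2P; split; first exact: continuous_measurable_fun.
have c2 := continuous_sqr cf.
have I := loc_int_itv a b (continuous_loc_int c2).
suff -> : EFin \o (fun x => f x ^+ 2) = (EFin \o (fun x => f x ^+ 2)) \_ `[a, b].
  by move: I; rewrite integrable_mkcond.
apply/funext => x; rewrite patchE; case: ifPn => //.
rewrite notin_setE/= in_itv/= => /negP; rewrite negb_and -!ltNge => /orP xab.
by rewrite f0 ?expr0n.
Qed.

Lemma L2_ae (f g : R -> R) : L2 f -> measurable_fun setT g ->
  {ae mu, forall x, f x = g x} -> L2 g.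
Proof.
move=> /L2P[mf If] mg fg; apply/L2P; split => //.
apply/integrableP; split; first by apply/measurable_EFinP; exact: measurable_funX.
case/integrableP : If => _; apply: le_lt_trans; rewrite le_eqVlt; apply/orP; left; apply/eqP.
apply: ae_eq_integral => //.
- by apply/measurable_EFinP; apply: measurableT_comp => //; exact: measurable_funX.
- by apply/measurable_EFinP; apply: measurableT_comp => //; exact: measurable_funX.
- by apply: ae_imp fg => x /= ->.
Qed.

Lemma L2_sum n (al : 'I_n -> R) (f : 'I_n -> R -> R) : (forall i, L2 (f i)) ->
  L2 (fun x => \sum_(i < n) al i * f i x).
Proof.
move=> Lf; rewrite /L2.
have -> : (fun x => \sum_(i < n) al i * f i x) = \sum_(i < n) (al i *: f i).
  by apply/funext => x; rewrite fct_sumE.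
have p1 : (1 <= 2%:E :> \bar R)%E by rewrite lee_fin ler1n.
apply: (big_ind (fun h => h \in Lfun mu 2%:E)) => [|h1 h2 H1 H2|i _].
- exact: (proj1 (@Lfun_submod_closed _ _ _ mu 2%:E p1)).
- have := proj2 (@Lfun_submod_closed _ _ _ mu 2%:E p1) 1 h1 h2 H1 H2.
  by rewrite scale1r.
- have := proj2 (@Lfun_submod_closed _ _ _ mu 2%:E p1) (al i) (f i) 0 (Lf i)
    (proj1 (@Lfun_submod_closed _ _ _ mu 2%:E p1)).
  by rewrite addr0.
Qed.

(** The integral of [psi^2] over [n] periods grows like [n]. *)
Lemma periodic_not_L2 (psi f : R -> R) (T X0 d : R) : 0 < T -> continuous psi ->
  (forall x, psi (x + T) = psi x) -> (exists x, psi x != 0) -> 0 < d ->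
  (forall x, X0 <= x -> d * psi x ^+ 2 <= f x ^+ 2) -> ~ L2 f.
Proof.
move=> T0 cpsi ppsi [z psiz] d0 Hf /L2P[mf If].
have c2 := continuous_sqr cpsi.
have l2 := continuous_loc_int c2.
pose P := primitive (fun x => psi x ^+ 2).
have dP (x : R) : is_derive x 1 P (psi x ^+ 2) by exact: primitive_derive (c2 x).
have PT x y : P (x + T) - P x = P (y + T) - P y.
  apply: (@zero_derivative_constant R (fun x => P (x + T) - P x)) => w.
  have d1 : is_derive w 1 (fun x => P (x + T)) (psi (w + T) ^+ 2).
    have := @is_derive_affine R P 1 T w (psi (w + T) ^+ 2); rewrite mul1r.
    by move=> /(_ (dP _)); move/is_derive_ext; apply; [move=> v; rewrite mul1r|rewrite mul1r].
  have := is_deriveB d1 (dP w).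
  by move/is_derive_ext; apply => //; rewrite ppsi subrr.
pose I := P (z + T) - P z.
have PnT n x : P (x + n%:R * T) - P x = n%:R * I.
  elim: n => [|n IH]; first by rewrite !mul0r addr0 subrr.
  have := PT (x + n%:R * T) z; rewrite -/I => H.
  rewrite -natr1 !mulrDl !mul1r addrA -IH -H; ring.
have I0 : 0 < I.
  have : 0 < psi z ^+ 2 by rewrite exprn_even_gt0.
  move/cvgr_gt : (c2 z) => /[apply] /nbhs_ballP[e /= e0 He].
  have [e' /andP[e'0 e'e]] := @exists_lt_pos R (Num.min e T) ltac:(by rewrite lt_min e0).
  move: e'e; rewrite lt_min => /andP[e'e e'T].
  rewrite subr_gt0; apply: (@lt_le_trans _ _ (P (z + e'))).
    apply: derive_pos_increasing dP _; first by rewrite ltrDl.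
    move=> x /andP[x1 x2]; apply: He; rewrite /ball/= distrC gtr0_norm ?subr_gt0//.
    by rewrite ltrBlDl (lt_trans x2)// ltrD2l.
  apply: derive_ge0_nondecreasing dP _; first by rewrite lerD2l ltW.
  by move=> x _; exact: sqr_ge0.
have Hn n : d * (n%:R * I) <= (\int[mu]_x (f x ^+ 2))%R.
  rewrite -(PnT n X0) primitiveB//; last first.
    by rewrite lerDl mulr_ge0// ltW.
  rewrite -RintegralZl//; last exact: loc_int_itv.
  apply: (@le_trans _ _ (\int[mu]_(x in `[X0, (X0 + n%:R * T)%R]) (f x ^+ 2))%R).
    apply: le_Rintegral => //.
    - apply: loc_int_itv; apply: continuous_loc_int => x.
      by apply: cvgM; [exact: cvg_cst|exact: c2].
    - by apply: integrableS If.
    - by move=> x /=; rewrite in_itv/= => /andP[x1 _]; exact: Hf.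
  have mf2 : measurable_fun setT (EFin \o (fun x => f x ^+ 2)).
    by apply/measurable_EFinP; exact: measurable_funX.
  rewrite -lee_fin /Rintegral !fineK; last 2 first.
  - exact: (integrable_fin_num measurableT If).
  - by apply: integrable_fin_num => //; exact: integrableS If.
  by apply: ge0_subset_integral => // x _; rewrite lee_fin sqr_ge0.
pose J := (\int[mu]_x (f x ^+ 2))%R.
have dI : 0 < d * I by rewrite mulr_gt0.
have := Hn (Num.truncn (J / (d * I))).+1; rewrite mulrCA -ler_pdivlMr//.
by rewrite -/J leNgt truncnS_gt.
Qed.

End L2Tools.

(** * Polynomials at infinity *)

Section PolynomialGrowth.
Variable R : realType.

(** By induction: [P X + a] is large where [P] is bounded away from zero and [X] is
large. *)
Lemma poly_away_from_zero (P : {poly R}) : P != 0 ->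
  exists2 d, 0 < d & exists Y, forall y, Y <= y -> d <= `|P.[y]|.
Proof.
elim/poly_ind: P => [|P a IH]; first by rewrite eqxx.
have [->|P0] := eqVneq P 0.
  rewrite mul0r add0r polyC_eq0 => a0; exists `|a|; first by rewrite normr_gt0.
  by exists 0 => y _; rewrite hornerC.
have [d d0 [Y HY]] := IH P0; move=> _.
exists 1 => //; exists (Num.max Y ((1 + `|a|) / d)) => y; rewrite ge_max => /andP[y1 y2].
have a0 := normr_ge0 a.
have y0 : 0 < y by apply: lt_le_trans y2; rewrite divr_gt0//; lra.
rewrite hornerMXaddC.
have : 1 + `|a| <= `|P.[y] * y|.
  rewrite normrM (gtr0_norm y0); move: y2; rewrite ler_pdivrMr// mulrC => /le_trans; apply.
  by rewrite ler_wpM2r ?HY// ltW.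
have := ler_normB (P.[y] * y + a) a; rewrite addrK; lra.
Qed.

End PolynomialGrowth.

(** * Coefficients of the homogeneous equation *)

Section OdeCoefficients.
Variable R : realType.

(** The six coefficients of the homogeneous equation solved for its sixth derivative. *)
Lemma ode_coef_bound (lam c nu u0 u1 u2 B : R) i : (i < 6)%N ->
  `|u0| <= B -> `|u1| <= B -> `|u2| <= B ->
  `|nth 0 [:: - u2 - nu; lam - 2 * u1; c - u0; 0; -1; 0] i|
    <= 2 * B + `|nu| + `|lam| + `|c| + 1.
Proof.
move=> i6 H0 H1 H2.
have B0 : 0 <= B by apply: le_trans H0; exact: normr_ge0.
have n0 := normr_ge0 nu; have l0 := normr_ge0 lam; have c0 := normr_ge0 c.
case: i i6 => [|[|[|[|[|[|//]]]]]] _ /=; rewrite ?normr0 ?normrN ?normr1.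
- by have := ler_normB (- u2) nu; rewrite normrN; lra.
- by have := ler_normB lam (2 * u1); rewrite normrM (ger0_norm (ler0n _ 2)); lra.
- by have := ler_normB c u0; lra.
- lra.
- lra.
- lra.
Qed.

End OdeCoefficients.

(** * Approximate eigenfunctions and the range *)

Section WeylSequence.
Variable R : realType.
Local Open Scope complex_scope.
Local Notation mu := (@lebesgue_measure R).
(* [U] is the potential with its derivatives, [V] its limit up to order [1/x], and
   [psi] a periodic solution of the limiting eigenvalue equation. *)
Variables (lam c nu T B C : R) (u : R -> R) (U V psi : nat -> R -> R).
Hypotheses (tU : tower 2 U) (Uu : U 0%N = u) (cU2 : continuous (U 2%N)).
Hypothesis UB : forall j x, (j <= 2)%N -> 0 <= x -> `|U j x| <= B.
Hypotheses (T0 : 0 < T) (tpsi : tower 6 psi) (cpsi6 : continuous (psi 6%N)).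
Hypotheses (psiT : forall x, psi 0%N (x + T) = psi 0%N x) (psi_neq0 : exists x, psi 0%N x != 0).
Hypothesis UV : forall j x, (j <= 2)%N -> 1 <= x -> `|U j x - V j x| <= C / x.
Hypothesis psiE : forall x, kp_classical lam 1 1 c V psi x = nu * psi 0%N x.

Let cpsi j : (j <= 6)%N -> continuous (psi j).
Proof. exact: tower_continuous_le. Qed.

Let cU j : (j <= 2)%N -> continuous (U j).
Proof. exact: tower_continuous_le. Qed.

Lemma kp_classical_continuous F : tower 6 F -> continuous (F 6%N) ->
  continuous (kp_classical lam 1 1 c U F).
Proof.
move=> tF cF6.
have cF j : (j <= 6)%N -> continuous (F j).
  exact: tower_continuous_le.
have cc (j : nat) (r : R) : (j <= 6)%N -> continuous (fun x => r * F j x).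
  by move=> j6 x; apply: cvgM; [exact: cvg_cst|exact: cF].
have cm i j : (i <= 2)%N -> (j <= 6)%N -> continuous (fun x => U i x * F j x).
  by move=> i2 j6 x; apply: cvgM; [exact: cU|exact: cF].
move=> x; apply: cvgB; first exact: cc.
apply: cvgD; first by apply: cvgB; [apply: cvgD; exact: cc|exact: cc].
by apply: cvgD; apply: cvgD; exact: cm.
Qed.

Let S (r : nat) (t : R) (j : nat) : R -> R := leibniz j (modulation (r%:R / 24) t) psi.

Let tS r t : tower 6 (S r t).
Proof. by apply: tower_leibniz => //; apply: smooth_tower; exact: smooth_modulation. Qed.

Let cS r t j : (j <= 6)%N -> continuous (S r t j).
Proof.
move=> j6; apply: leibniz_continuous => i ij; last by apply: cpsi; exact: leq_trans ij j6.
by apply: smooth_continuous; exact: smooth_modulation.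
Qed.

(** The image of the approximate eigenfunction [x^(r/24) psi], truncated at [2/t]. *)
Definition residual r t x := kp_classical lam 1 1 c U (S r t) x - nu * S r t 0%N x.

Let cres r t : continuous (residual r t).
Proof.
move=> x; apply: cvgB; last by apply: cvgM; [exact: cvg_cst|exact: cS].
by apply: kp_classical_continuous; [exact: tS|exact: cS].
Qed.

Let S_le1 r t j x : x <= 1 -> S r t j x = 0.
Proof. by move=> x1; apply: leibniz_eq0l => i _; exact: modulation_le1. Qed.

Let S_far r t j x : 2 <= t * x -> S r t j x = 0.
Proof. by move=> x1; apply: leibniz_eq0l => i _; exact: modulation_far. Qed.

Let S_near r t j x : t * x <= 1 -> S r t j x = S r 0 j x.
Proof. by move=> x1; apply: eq_leibniz => // i _; exact: modulation_near. Qed.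

Let res_le1 r t x : x <= 1 -> residual r t x = 0.
Proof. by move=> x1; rewrite /residual /kp_classical /= !S_le1//; ring. Qed.

Let res_near r t x : t * x <= 1 -> residual r t x = residual r 0 x.
Proof. by move=> x1; rewrite /residual /kp_classical /= !(@S_near r t). Qed.

Let exponent_range (r : nat) : (r <= 6)%N -> 0 <= (r%:R / 24 : R) <= 1 / 4.
Proof.
move=> r6; have : (r%:R : R) <= 6 by rewrite ler_nat.
have : 0 <= (r%:R : R) by []. by lra.
Qed.

Let psi_bounded : exists2 M, 0 <= M & forall j x, (j <= 6)%N -> `|psi j x| <= M.
Proof.
have [M M0 HM] : exists2 M, 0 <= M & forall j x, (j <= 6)%N -> True -> `|psi j x| <= M.
  apply: bounded_family => j j6.
  have pT x : psi j (x + T) = psi j x by exact: (tower_periodic tpsi psiT).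
  have [M M0 HM] := periodic_bounded T0 (cpsi j6) pT.
  by exists M.
by exists M => // j x j6; exact: HM.
Qed.

(** Derivatives of the amplitude are [O(x^(-3/4))], and the difference of the
potentials, which is [O(1/x)], multiplies an amplitude of size [x^(1/4)]. *)
Lemma residual_bound : exists2 K, 0 <= K & forall r t x, (r <= 6)%N -> 0 <= t <= 1 -> 1 <= x ->
  `|residual r t x| <= K * x `^ (- (3 / 4)).
Proof.
have [M M0 HM] := psi_bounded; have [D D0 HD] := @modulation_bound R.
have B0 : 0 <= B by apply: le_trans (UB (isT : (0 <= 2)%N) (lexx 0)); exact: normr_ge0.
have C0 : 0 <= C.
  have := UV (isT : (0 <= 2)%N) (lexx 1); rewrite divr1; apply: le_trans; exact: normr_ge0.
exists (64 * (D * M) * (`|lam| + 2 + `|c| + 4 * B) + 4 * (C * M)) => [|r t x r6 t01 x1].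
  by rewrite addr_ge0// ?mulr_ge0// !addr_ge0// mulr_ge0.
have x0 : 0 < x by lra.
set y := x `^ _; have y0 : 0 <= y by exact: powR_ge0.
have E j : (j <= 6)%N ->
    `|S r t j x - modulation (r%:R / 24) t 0 x * psi j x| <= 64 * (D * y * M).
  move=> j6; apply: (@le_trans _ _ (2 ^+ j * (D * y * M))).
    apply: leibniz_sub_main => //; first exact: mulr_ge0.
      by move=> i ij; apply: HM; exact: leq_trans ij j6.
    move=> i /andP[i0 ij]; apply: HD => //; first exact: exponent_range.
    by rewrite i0 (leq_trans ij).
  rewrite ler_wpM2r ?mulr_ge0//.
  apply: (@le_trans _ _ (2 ^+ 6)); last by rewrite -natrX ler_nat.
  by rewrite ler_weXn2l// ler1n.
have m0 : `|modulation (r%:R / 24) t 0 x| <= x `^ (1 / 4).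
  by apply: modulation0_le => //; exact: exponent_range.
have U1 j : (j <= 2)%N -> `|U j x| <= B by move=> j2; apply: UB => //; lra.
have E0 : 0 <= 64 * (D * y * M) by rewrite !mulr_ge0.
have Cx : 0 <= C / x by rewrite divr_ge0// ltW.
have := residual_arith M0 B0 Cx E0 (powR_ge0 x (1 / 4)) (psiE x) (HM 0%N x isT)
  (HM 1%N x isT) (HM 2%N x isT) (E 0%N isT) (E 1%N isT) (E 2%N isT) (E 4%N isT) (E 6%N isT)
  (U1 0%N isT) (U1 1%N isT) (U1 2%N isT) (@UV 0%N x isT x1) (@UV 1%N x isT x1) (@UV 2%N x isT x1) m0.
move=> H; apply: le_trans H _; rewrite le_eqVlt; apply/orP; left; apply/eqP.
have -> : x `^ (1 / 4) * (C / x * M) = y * (C * M).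
  by rewrite /y -powR_quarter//; ring.
by ring.
Qed.

Let res0_L2 r : (r <= 6)%N -> L2 (residual r 0).
Proof.
move=> r6; have [K K0 HK] := residual_bound.
apply/L2P; split; first by apply: continuous_measurable_fun; exact: cres.
have [| | |//] := @square_tail R (residual r 0) K 1 _ (lexx 1).
- exact: cres.
- by move=> x /ltW; exact: res_le1.
- by move=> x x1; apply: HK => //; rewrite lexx ler01.
Qed.

Let S_L2 r t j : (j <= 6)%N -> 0 < t -> L2 (S r t j).
Proof.
move=> j6 t0; apply: (@compact_support_L2 _ _ 1 (2 / t)); first exact: cS.
move=> x [/ltW x1|x2]; first exact: S_le1.
by apply: S_far; move: x2; rewrite ltr_pdivrMr// mulrC; exact: ltW.
Qed.

Let S_Hs r t : 0 < t -> Hs 6 (S r t 0%N).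
Proof.
move=> t0; split; first exact: S_L2.
move=> j j6; exists (S r t j); last exact: S_L2.
by apply: weak_deriv_tower; [exact: tower_le (tS r t)|exact: cS].
Qed.

(** A classical solution is a weak one, with all witnesses classical derivatives. *)
Lemma real_kp_classical F : tower 6 F -> continuous (F 6%N) ->
  real_kp_expr lam 1 1 c u (F 0%N) (kp_classical lam 1 1 c U F).
Proof.
move=> tF cF6.
have cF j : (j <= 6)%N -> continuous (F j).
  exact: tower_continuous_le.
have wF j : (j <= 6)%N -> weak_deriv j (F 0%N) (F j).
  by move=> j6; apply: weak_deriv_tower; [exact: tower_le tF|exact: cF].
pose Y (j : nat) x := 1 * F (4 + j)%N x + 1 * F (2 + j)%N x - c * F j x + leibniz j U F x.
exists (F 1%N), (F 2%N), (F 4%N), (Y 2%N); split; try exact: wF.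
  rewrite -Uu; apply: (@weak_deriv_tower _ 2 Y).
    move=> j x j2.
    have d (k : nat) (r : R) : (k < 6)%N -> is_derive x 1 (fun x => r * F k x) (r * F k.+1 x).
      by move=> k6; have := is_deriveZ r (tF k x k6); move/is_derive_ext; apply.
    have dl : is_derive x 1 (leibniz j U F) (leibniz j.+1 U F x).
      apply: is_derive_leibniz => i ij; first by apply: tU; exact: leq_ltn_trans ij j2.
      by apply: tF; rewrite (leq_ltn_trans ij)// (ltn_trans j2).
    have j4 : (4 + j < 6)%N by rewrite (ltn_add2l 4 j 2).
    have j3 : (2 + j < 6)%N by rewrite (ltn_trans _ j4)// ltn_add2r.
    apply: is_derive_ext (is_deriveD (is_deriveB (is_deriveD (d (4 + j)%N 1 j4) (d (2 + j)%N 1 j3))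
      (d j c _)) dl) _ _ => //; first by rewrite (ltn_trans j2).
  have cc (j : nat) (r : R) : (j <= 6)%N -> continuous (fun x => r * F j x).
    by move=> j6 x; apply: cvgM; [exact: cvg_cst|exact: cF].
  move=> x; apply: cvgD; first by apply: cvgB; [apply: cvgD; exact: cc|exact: cc].
  by apply: leibniz_continuous => i i2; [exact: cU|apply: cF; exact: leq_trans i2 _].
by apply: ae_everywhere => x; rewrite /kp_classical /Y.
Qed.

Let opT := shift_op (line_op lam%:C c u) nu%:C.

Let residual_range r t : 0 < t -> range_op opT (fun x => (residual r t x)%:C).
Proof.
move=> t0; exists (fun x => (S r t 0%N x)%:C); split.
- split; first exact: S_Hs.
  by split; [exact: L2_zero|move=> j _; exists (fun=> 0); [|exact: L2_zero];
    apply: (@weak_deriv_tower _ j (fun _ _ => 0)) => [i x _|];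
    [exact: is_derive_cst|exact: cst_continuous]].
- have -> : (fun x => (residual r t x)%:C + nu%:C * (S r t 0%N x)%:C) =
      (fun x => (kp_classical lam 1 1 c U (S r t) x)%:C).
    by apply/funext => x; rewrite -rmorphM -rmorphD /residual subrK.
  split; last exact: L2_zero.
  apply: (@compact_support_L2 _ _ 1 (2 / t)).
    by apply: kp_classical_continuous; [exact: tS|exact: cS].
  move=> x [/ltW x1|x2]; first by rewrite /kp_classical /= !S_le1//=; ring.
  have tx : 2 <= t * x by move: x2; rewrite ltr_pdivrMr// mulrC; exact: ltW.
  by rewrite /kp_classical /= !S_far//=; ring.
- have -> : (fun x => (residual r t x)%:C + nu%:C * (S r t 0%N x)%:C) =
      (fun x => (kp_classical lam 1 1 c U (S r t) x)%:C).
    by apply/funext => x; rewrite -rmorphM -rmorphD /residual subrK.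
  by apply: kp_expr_real; apply: real_kp_classical; [exact: tS|exact: cS].
Qed.

(* With this truncation the squared distance is of order [1 / n.+1]. *)
Let tn (n : nat) : R := (n.+1%:R ^+ 2)^-1.

Let sqdist_residual r : (r <= 6)%N ->
  sqdist (fun x => (residual r (tn n) x)%:C) (fun x => (residual r 0 x)%:C) @[n --> \oo]
    --> (0 : R).
Proof.
move=> r6; have [K K0 HK] := residual_bound.
have bound n : 0 <= sqdist (fun x => (residual r (tn n) x)%:C)
    (fun x => (residual r 0 x)%:C) <= 2 * (2 * K) ^+ 2 * harmonic n.
  have n1 : 1 <= (n.+1%:R ^+ 2 : R) by rewrite exprn_ege1// ler1n.
  have tn0 : 0 < tn n by rewrite invr_gt0; lra.
  have tn1 : tn n <= 1 by rewrite invf_le1//; lra.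
  rewrite /sqdist.
  have -> : (fun x => complex.Re ((residual r (tn n) x)%:C - (residual r 0 x)%:C) ^+ 2 +
      complex.Im ((residual r (tn n) x)%:C - (residual r 0 x)%:C) ^+ 2) =
    (fun x => (residual r (tn n) x - residual r 0 x) ^+ 2).
    by apply/funext => x /=; rewrite subrr expr0n addr0.
  apply/andP; split; first by apply: Rintegral_ge0 => x _; exact: sqr_ge0.
  have [| | | _ H] := @square_tail R (fun x => residual r (tn n) x - residual r 0 x)
     (2 * K) (n.+1%:R ^+ 2) _ n1.
  - by move=> x; apply: cvgB; exact: cres.
  - move=> x xn; rewrite res_near ?subrr// /tn mulrC ler_pdivrMr ?mul1r; [exact: ltW|lra].
  - move=> x xn; apply: le_trans (ler_normB _ _) _.
    have x1 : 1 <= x by exact: le_trans xn.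
    have t01 : 0 <= tn n <= 1 by rewrite (ltW tn0).
    have z01 : 0 <= (0 : R) <= 1 by rewrite lexx ler01.
    by have := HK r (tn n) x r6 t01 x1; have := HK r 0 x r6 z01 x1; lra.
  apply: le_trans H _; rewrite /harmonic.
  rewrite powRN -[n.+1%:R ^+ 2]powR_mulrn// -powRrM.
  by rewrite (_ : 2%:R * (1 / 2) = 1) ?powRr1//; lra.
apply: (squeeze_cvgr (f := fun=> 0) (h := fun n => 2 * (2 * K) ^+ 2 * harmonic n)).
- by near=> n; exact: bound.
- exact: cvg_cst.
- rewrite -[X in _ --> X](mulr0 (2 * (2 * K) ^+ 2)).
  by apply: cvgM; [exact: cvg_cst|exact: cvg_harmonic].
Unshelve. all: by end_near. Qed.

(** The full residual is the limit of the truncated ones, which lie in the range; a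
preimage in [H^6] is then regular because the residual is continuous. *)
Lemma residual_preimage : closed_in_L2 (range_op opT) -> forall r, (r <= 6)%N ->
  exists F, [/\ tower 6 F, L2 (F 0%N) &
    forall x, kp_classical lam 1 1 c U F x - nu * F 0%N x = residual r 0 x].
Proof.
move=> clT r r6.
have [f [[[Lf Hf] _] _ K]] : range_op opT (fun x => (residual r 0 x)%:C).
  apply: (clT (fun n x => (residual r (tn n) x)%:C)).
  - by move=> n; apply: residual_range; rewrite invr_gt0 exprn_gt0.
  - by split; [exact: res0_L2|exact: L2_zero].
  - exact: sqdist_residual.
have {}K : real_kp_expr lam 1 1 c (U 0%N) (fun x => complex.Re (f x))
    (fun x => residual r 0 x + nu * complex.Re (f x)).
  rewrite Uu; apply: real_kp_expr_ext (kp_expr_Re K) => x.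
  by rewrite ReD Re_mulC.
have [F [tF cF fF]] : exists F, [/\ tower 5 F, continuous (F 5%N) &
    {ae mu, forall x, complex.Re (f x) = F 0%N x}].
  by apply: weakly_differentiable_tower => j /Hf[g wg _]; exists g.
have cF0 : continuous (F 0%N) by exact: tower_continuous tF _.
pose G x := residual r 0 x + nu * F 0%N x.
have cG : continuous G.
  by move=> x; apply: cvgD; [exact: cres|apply: cvgM; [exact: cvg_cst|exact: cF0]].
have gG : {ae mu, forall x, residual r 0 x + nu * complex.Re (f x) = G x}.
  by apply: ae_imp fF => x ->.
have [F' [tF' F'0 _ F'E]] := kp_regularity (oner_neq0 _) tF cF fF tU cU2 cG gG K.
exists F'; split => // [|x]; last by rewrite F'E F'0 /G addrK.
rewrite F'0; apply: L2_ae Lf _ fF; exact: continuous_measurable_fun.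
Qed.

(** Compare seven approximate eigenfunctions with the six-dimensional solution space
of the homogeneous equation. *)
Lemma weyl_not_closed : ~ closed_in_L2 (range_op opT).
Proof.
move=> clT.
have [F HF] : {F : 'I_7 -> nat -> R -> R & forall r : 'I_7, [/\ tower 6 (F r), L2 (F r 0%N) &
    forall x, kp_classical lam 1 1 c U (F r) x - nu * F r 0%N x = residual r 0 x]}.
  apply: (@choice _ _ (fun (r : 'I_7) F => [/\ tower 6 F, L2 (F 0%N) &
    forall x, kp_classical lam 1 1 c U F x - nu * F 0%N x = residual r 0 x])) => r.
  by apply: residual_preimage => //; rewrite -ltnS.
pose W (r : 'I_7) (j : nat) x := S r 0 j x - F r j x.
pose b (i : nat) x : R := nth 0 [:: - U 2%N x - nu; lam - 2 * U 1%N x; c - U 0%N x; 0; -1; 0] i.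
have tW r : tower 6 (W r).
  have [tF _ _] := HF r.
  by move=> j x j6; exact: (is_deriveB (tS r 0 x j6) (tF j x j6)).
have eW r x : 0 <= x -> W r 6%N x = \sum_(i < 6) b i x * W r i x.
  move=> _; have [_ _ /(_ x)] := HF r.
  rewrite /residual /kp_classical !big_ord_recl big_ord0 /b /W /=; lra.
have bB i x : (i < 6)%N -> 0 <= x -> `|b i x| <= 2 * B + `|nu| + `|lam| + `|c| + 1.
  move=> i6 x0.
  have := (@ode_coef_bound R lam c nu _ _ _ _ _ i6 (@UB 0%N x isT x0) (@UB 1%N x isT x0) (@UB 2%N x isT x0)).
  by apply: le_trans.
have [al [r0 alr0] al0] := solutions_dependent (isT : (0 < 6)%N) tW eW bB.
pose f x := \sum_(r < 7) al r * F r 0%N x.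
have Lf : L2 f by apply: L2_sum => r; case: (HF r).
(* the default [0] is never reached, since [i < 7] *)
pose P : {poly R} := \poly_(i < 7) (if insub i is Some r then al r else 0).
have Pnz : P != 0.
  apply/eqP => /(congr1 (fun p : {poly R} => p`_r0)).
  rewrite coef_poly ltn_ord coef0 valK => /eqP; exact/negP.
have [d d0 [Y HY]] := poly_away_from_zero Pnz.
have fE x : 2 <= x -> f x = P.[x `^ (1 / 24)] * psi 0%N x.
  move=> x2; have x0 : 0 <= x by lra.
  have := al0 x x0; rewrite /W.
  have -> : \sum_(r < 7) al r * (S r 0 0%N x - F r 0%N x) =
     \sum_(r < 7) al r * S r 0 0%N x - f x.
    by rewrite /f -sumrB; apply: eq_bigr => r _; rewrite mulrBr.
  move=> /eqP; rewrite subr_eq0 => /eqP <-.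
  rewrite horner_poly mulr_suml; apply: eq_bigr => r _.
  rewrite valK /S /= modulation_main// mulrA; congr (_ * _ * _).
  by rewrite -powR_mulrn ?powR_ge0// -powRrM; congr (x `^ _); field.
(* beyond [2] the cutoff is [1], and [Y <= x^(1/24)] from [Y^24] on *)
pose X0 := Num.max 2 ((Num.max Y 0) `^ 24).
have c0 : continuous (psi 0%N) by exact: cpsi.
apply: (@periodic_not_L2 R (psi 0%N) f T X0 (d ^+ 2) T0 c0 psiT psi_neq0 _ _ Lf).
  by rewrite exprn_gt0.
move=> x; rewrite /X0 ge_max => /andP[x2 xY]; rewrite fE// exprMn.
rewrite ler_wpM2r ?sqr_ge0// -[leRHS]real_normK ?num_real// lerXn2r ?nnegrE ?(ltW d0)//.
apply: HY; apply: (@le_trans _ _ (Num.max Y 0)); first by rewrite le_max lexx.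
have Y0 : 0 <= Num.max Y 0 by rewrite le_max lexx orbT.
have -> : Num.max Y 0 = ((Num.max Y 0) `^ 24) `^ (1 / 24).
  by rewrite -powRrM (_ : 24 * (1 / 24) = 1) ?powRr1//; field.
by apply: ge0_ler_powR; rewrite ?nnegrE ?powR_ge0//; lra.
Qed.

Theorem weyl_ess_spectrum : ess_spectrum (line_op lam%:C c u) nu%:C.
Proof. by move=> [clT _]; exact: weyl_not_closed. Qed.

End WeylSequence.

(** * The hyperbolic tangent *)

Section HyperbolicTangent.
Variable R : realType.
Implicit Types x : R.

Lemma is_derive_tanh x : is_derive x 1 (@tanh R) (1 - tanh x ^+ 2).
Proof.
have dN : is_derive x 1 (fun y : R => expR (- y)) (- expR (- x)).
  have := @is_derive_affine R expR (-1) 0 x _ (is_derive_expR _).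
  by rewrite addr0 mulN1r; move/is_derive_ext; apply; [move=> y; rewrite addr0 mulN1r|rewrite mulN1r].
have s0 : expR x + expR (- x) != 0 by rewrite gt_eqF// addr_gt0 ?expR_gt0.
have dn := is_deriveB (is_derive_expR x) dN.
have dd := is_deriveV (s0 : (expR + (fun y : R => expR (- y))) x != 0) (is_deriveD (is_derive_expR x) dN).
apply: is_derive_ext (is_deriveM dn dd) _ _ => //.
rewrite /tanh -![_ *: _]/(_ * _) !fctE; field.
exact: s0.
Qed.

(** [1 - tanh x = 2 exp(-x) / (exp x + exp(-x))]. *)
Lemma tanh_bounds x : 0 <= x -> 0 <= tanh x <= 1 /\ 1 - tanh x <= 2 * expR (- (2 * x)).
Proof.
move=> x0; have ex := expR_gt0 x; have en := expR_gt0 (- x).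
have s0 : 0 < expR x + expR (- x) by rewrite addr_gt0.
have le : expR (- x) <= expR x by rewrite ler_expR; lra.
split.
  apply/andP; split; first by apply: divr_ge0; [rewrite subr_ge0|exact: ltW].
  by rewrite /tanh ler_pdivrMr// mul1r; lra.
have -> : 1 - tanh x = 2 * expR (- x) / (expR x + expR (- x)).
  by rewrite /tanh; field; rewrite gt_eqF.
rewrite ler_pdivrMr// -mulrA ler_wpM2l//.
have -> : - (2 * x) = - x + - x by ring.
have := expRxMexpNx_1 x; rewrite expRD; move: (expR x) (expR (- x)) ex en {s0 le} => E N E0 N0 EN.
have -> : N * N * (E + N) = N * (E * N) + N * N * N by ring.
by rewrite EN mulr1 lerDl !mulr_ge0// ltW.
Qed.

Lemma expRN_le_inv (y : R) : 0 < y -> expR (- y) <= y^-1.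
Proof.
move=> y0; rewrite expRN lef_pV2 ?posrE ?expR_gt0//.
by apply: le_trans (expR_ge1Dx y); rewrite lerDr.
Qed.

End HyperbolicTangent.

(** * Asymptotics of the shifted phase *)

Section PhaseShift.
Variable R : realType.

Lemma lipschitz (F f : R -> R) (M a b : R) : (forall x : R, is_derive x 1 F (f x)) ->
  (forall x, `|f x| <= M) -> `|F a - F b| <= M * `|a - b|.
Proof.
move=> dF fM; have [ab|ba|->] := ltgtP a b; last by rewrite !subrr normr0 mulr0.
  have [z _ E] := mean_value ab dF.
  by rewrite distrC E normrM [X in _ * X]distrC ler_wpM2r.
by have [z _ E] := mean_value ba dF; rewrite E normrM ler_wpM2r.
Qed.

(** The phase [x + tau tanh (kap x)] of the periodic part of the wave and its first two
derivatives. *)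
Definition shifted_phase (tau kap : R) (j : nat) (x : R) : R :=
  match j with
  | 0%N => x + tau * tanh (kap * x)
  | 1%N => 1 + tau * kap * (1 - tanh (kap * x) ^+ 2)
  | _ => - (2 * tau * kap ^+ 2 * tanh (kap * x) * (1 - tanh (kap * x) ^+ 2))
  end.

(** The chain rule up to second order. *)
Definition composite (Phi sig : nat -> R -> R) (j : nat) (x : R) : R :=
  match j with
  | 0%N => Phi 0%N (sig 0%N x)
  | 1%N => Phi 1%N (sig 0%N x) * sig 1%N x
  | _ => Phi 2%N (sig 0%N x) * sig 1%N x ^+ 2 + Phi 1%N (sig 0%N x) * sig 2%N x
  end.

Lemma tower_shifted_phase tau kap : tower 2 (shifted_phase tau kap).
Proof.
have dt (x : R) : is_derive x 1 (fun y => tanh (kap * y)) (kap * (1 - tanh (kap * x) ^+ 2)).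
  have := @is_derive_affine R (@tanh R) kap 0 x _ (is_derive_tanh _).
  by rewrite addr0; move/is_derive_ext; apply => // y; rewrite addr0.
case=> [|[|//]] x _.
  have := is_deriveD (is_derive_id x 1) (is_deriveZ tau (dt x)).
  by move/is_derive_ext; apply => //; rewrite /= -[_ *: _]/(_ * _) mulrA.
have := is_deriveD (is_derive_cst (1 : R) x 1) (is_deriveZ (tau * kap)
  (is_deriveB (is_derive_cst (1 : R) x 1) (is_deriveM (dt x) (dt x)))).
move/is_derive_ext; apply => [y|]; first by rewrite /= expr2.
by rewrite /= -![_ *: _]/(_ * _); ring.
Qed.

Lemma tower_composite Phi sig : tower 2 Phi -> tower 2 sig -> tower 2 (composite Phi sig).
Proof.
move=> tP tS.
have d j (x : R) : (j < 2)%N ->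
    is_derive x 1 (fun y => Phi j (sig 0%N y)) (Phi j.+1 (sig 0%N x) * sig 1%N x).
  by move=> j2; have := @is_derive1_comp R (Phi j) (sig 0%N) x _ _ (tP j _ j2) (tS 0%N x isT).
case=> [|[|//]] x _; first exact: d.
have := is_deriveM (d 1%N x isT) (tS 1%N x isT).
by move/is_derive_ext; apply => //; rewrite /= -![_ *: _]/(_ * _); ring.
Qed.

(** [1 - tanh] decays like [exp(-2 kap x)], and the derivatives of [tanh] contain the
factor [1 - tanh^2]. *)
Lemma shifted_phase_close tau kap x : 0 <= kap -> 0 <= x ->
  let e := expR (- (2 * (kap * x))) in
  [/\ `|shifted_phase tau kap 0 x - (x + tau)| <= 2 * `|tau| * e,
      `|shifted_phase tau kap 1 x - 1| <= 4 * `|tau| * kap * e &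
      `|shifted_phase tau kap 2 x| <= 8 * `|tau| * kap ^+ 2 * e].
Proof.
move=> k0 x0 e; rewrite /shifted_phase.
have [/andP[t0 t1] te] := tanh_bounds (mulr_ge0 k0 x0); rewrite -/e in te.
move: (tanh (kap * x)) t0 t1 te (expR_ge0 (- (2 * (kap * x)))) => t t0 t1 te; rewrite -/e => e0.
have E2 : 0 <= 1 - t ^+ 2 <= 4 * e by apply/andP; split; nra.
have [E3 E4] := andP E2.
split.
- have -> : x + tau * t - (x + tau) = - (tau * (1 - t)) by ring.
  rewrite normrN normrM (ger0_norm (_ : 0 <= 1 - t)); last by lra.
  have -> : 2 * `|tau| * e = `|tau| * (2 * e) by ring.
  by rewrite ler_wpM2l//; lra.
- rewrite addrAC subrr add0r !normrM (ger0_norm k0) (ger0_norm E3).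
  have -> : 4 * `|tau| * kap * e = `|tau| * kap * (4 * e) by ring.
  by rewrite ler_wpM2l// mulr_ge0.
- move: (kap ^+ 2) (exprn_ge0 2 k0) => q q0; rewrite normrN.
  move: (1 - t ^+ 2) E3 E4 => s s0 s4.
  rewrite !normrM (ger0_norm s0) (ger0_norm t0) (ger0_norm (ler0n _ 2)) (ger0_norm q0).
  have -> : 8 * `|tau| * q * e = 2 * `|tau| * q * 1 * (4 * e) by ring.
  by rewrite ler_pM// ?ler_wpM2l// !mulr_ge0.
Qed.

(** The derivatives of [Phi] up to order three are bounded, so [Phi] and its first two
derivatives are Lipschitz, and the phases merge exponentially fast. *)
Lemma composite_close (Phi : nat -> R -> R) (M tau kap : R) : tower 3 Phi ->
  (forall j x, (j <= 3)%N -> `|Phi j x| <= M) -> 0 <= kap ->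
  exists2 K, 0 <= K & forall j x, (j <= 2)%N -> 0 <= x ->
    `|composite Phi (shifted_phase tau kap) j x - Phi j (x + tau)|
      <= K * expR (- (2 * (kap * x))).
Proof.
move=> tP HM k0.
have M0 : 0 <= M by apply: le_trans (HM 0%N 0 isT); exact: normr_ge0.
pose A := 2 * `|tau|; pose D := 4 * `|tau| * kap; pose G := 8 * `|tau| * kap ^+ 2.
have A0 : 0 <= A by rewrite mulr_ge0.
have D0 : 0 <= D by rewrite !mulr_ge0.
have G0 : 0 <= G by rewrite !mulr_ge0// exprn_ge0.
have lip j y z : (j <= 2)%N -> `|Phi j y - Phi j z| <= M * `|y - z|.
  by move=> j2; apply: lipschitz (fun x => tP j x j2) _ => x; exact: HM.
exists (M * A + M * A * (1 + D) + M * D + M * D * (2 + D) + M * G).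
  by rewrite !addr_ge0// !mulr_ge0// addr_ge0.
move=> j x j2 x0; have [S0 S1 S2] := shifted_phase_close tau k0 x0.
set e := expR _ in S0 S1 S2 *; have e0 : 0 <= e by exact: expR_ge0.
have e1 : e <= 1 by rewrite -[leRHS]expR0 ler_expR oppr_le0 !mulr_ge0.
set sg := shifted_phase tau kap in S0 S1 S2 *.
have L i : (i <= 2)%N -> `|Phi i (sg 0%N x) - Phi i (x + tau)| <= M * A * e.
  move=> i2; apply: le_trans (lip i _ _ i2) _; rewrite -mulrA.
  exact: ler_wpM2l.
have s1 : `|sg 1%N x| <= 1 + D.
  have := ler_normD (sg 1%N x - 1) 1; rewrite subrK normr1.
  have : D * e <= D by rewrite ler_piMr.
  by move: S1; rewrite -/D; lra.
have Q0 : 0 <= M * A * e by rewrite !mulr_ge0.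
have Q1 : 0 <= M * A * (1 + D) * e by rewrite !mulr_ge0// addr_ge0.
have Q2 : 0 <= M * D * e by rewrite !mulr_ge0.
have Q3 : 0 <= M * D * (2 + D) * e by rewrite !mulr_ge0// addr_ge0.
have Q4 : 0 <= M * G * e by rewrite !mulr_ge0.
rewrite !mulrDl; case: j j2 => [|[|[|//]]] _.
- by have := L 0%N isT; rewrite /composite; lra.
- have -> : composite Phi sg 1 x - Phi 1%N (x + tau) =
    (Phi 1%N (sg 0%N x) - Phi 1%N (x + tau)) * sg 1%N x + Phi 1%N (x + tau) * (sg 1%N x - 1).
    by rewrite /composite; ring.
  have H1 : `|(Phi 1%N (sg 0%N x) - Phi 1%N (x + tau)) * sg 1%N x| <= M * A * (1 + D) * e.
    by rewrite normrM [leRHS]mulrAC ler_pM// L.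
  have H2 : `|Phi 1%N (x + tau) * (sg 1%N x - 1)| <= M * D * e.
    by rewrite normrM -mulrA ler_pM// HM.
  by apply: le_trans (ler_normD _ _) _; lra.
- have -> : composite Phi sg 2 x - Phi 2%N (x + tau) =
    Phi 2%N (sg 0%N x) * ((sg 1%N x - 1) * (sg 1%N x + 1)) +
    (Phi 2%N (sg 0%N x) - Phi 2%N (x + tau)) + Phi 1%N (sg 0%N x) * sg 2%N x.
    by rewrite /composite; ring.
  have H1 : `|Phi 2%N (sg 0%N x) * ((sg 1%N x - 1) * (sg 1%N x + 1))| <= M * D * (2 + D) * e.
    have -> : M * D * (2 + D) * e = M * ((D * e) * (2 + D)) by ring.
    rewrite normrM ler_pM ?HM// normrM ler_pM//.
    by apply: le_trans (ler_normD _ _) _; rewrite normr1; lra.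
  have H2 := L 2%N isT.
  have H3 : `|Phi 1%N (sg 0%N x) * sg 2%N x| <= M * G * e.
    by rewrite normrM -mulrA ler_pM// HM.
  apply: le_trans (ler_normD _ _) _.
  have := ler_normD (Phi 2%N (sg 0%N x) * ((sg 1%N x - 1) * (sg 1%N x + 1)))
    (Phi 2%N (sg 0%N x) - Phi 2%N (x + tau)).
  lra.
Qed.

End PhaseShift.

(** * From the periodic problem to the line *)

Section WaveSpectrum.
Variable R : realType.
Local Open Scope complex_scope.
Local Notation mu := (@lebesgue_measure R).

Lemma expRN_le_div (y r x : R) : 0 < r -> 1 <= x -> r * x <= y -> expR (- y) <= r^-1 / x.
Proof.
move=> r0 x1 yx; have x0 : 0 < x by lra.
have rx : 0 < r * x by rewrite mulr_gt0.
apply: (@le_trans _ _ (expR (- (r * x)))); first by rewrite ler_expR lerN2.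
by apply: le_trans (expRN_le_inv rx) _; rewrite invfM.
Qed.

Lemma line_wave_tower (c : R) (f : R -> R) : line_wave c f ->
  tower 4 (fun j => derive1n j f).
Proof. by move=> [df _]; apply: derivable_tower => j x; exact: df. Qed.

(** The constants are not tracked: the exponential decay is only used as decay of order
[1/x], and [u], [u'], [u''] are bounded on the right half-line because the periodic
wave is. *)
Lemma potential_asymptotics (c th M1 tau T : R) (u h phi : R -> R) : 0 < c -> 0 < th ->
  0 < T -> (forall x, phi (x + T) = phi x) -> line_wave c phi -> line_wave c u ->
  (forall x, u x = h x + phi (x + tau * tanh (Num.sqrt c * x / 2))) ->
  (forall j x, (j < 3)%N -> derivable (derive1n j h) x 1) ->
  (forall j x, (j <= 3)%N -> `|derive1n j h x| <= M1 * c * expR (- (th * Num.sqrt c * `|x|))) ->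
  0 <= M1 ->
  exists B C, (forall j x, (j <= 2)%N -> 0 <= x -> `|derive1n j u x| <= B) /\
    (forall j x, (j <= 2)%N -> 1 <= x ->
       `|derive1n j u x - derive1n j phi (x + tau)| <= C / x).
Proof.
move=> c0 th0 T0 pT wphi wu uE dh hB M10.
have w0 : 0 < Num.sqrt c by rewrite sqrtr_gt0.
set w := Num.sqrt c in uE hB w0 *.
pose kap := w / 2.
have k0 : 0 <= kap by rewrite /kap divr_ge0// ltW.
pose Phi j := derive1n j phi.
have tP : tower 4 Phi := line_wave_tower wphi.
have PT j x : (j <= 3)%N -> Phi j (x + T) = Phi j x.
  by move=> j3; apply: (tower_periodic tP) => //; exact: leqW.
have [M M0 HM] : exists2 M, 0 <= M & forall j x, (j <= 3)%N -> True -> `|Phi j x| <= M.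
  apply: bounded_family => j j3.
  have [M M0 HM] := periodic_bounded T0 (tower_continuous tP (j3 : (j < 4)%N)) (fun x => PT j x j3).
  by exists M.
have {}HM j x : (j <= 3)%N -> `|Phi j x| <= M by move=> j3; exact: HM.
have tP3 : tower 3 Phi := tower_le (isT : (3 <= 4)%N) tP.
have [K K0 HK] := composite_close tau tP3 HM k0.
pose Q := composite Phi (shifted_phase tau kap).
have tQ : tower 2 Q.
  apply: tower_composite; first exact: tower_le tP3.
  exact: tower_shifted_phase.
have tH : tower 3 (fun j => derive1n j h) by exact: derivable_tower.
have tU := line_wave_tower wu.
have uQ j x : (j <= 2)%N -> derive1n j u x = derive1n j h x + Q j x.
  have tS : tower 2 (fun j x => derive1n j h x + Q j x).
    move=> i y i2; have := is_deriveD (tH i y (leqW i2)) (tQ i y i2).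
    by move/is_derive_ext; apply.
  have E : u = (fun x => derive1n 0 h x + Q 0%N x).
    apply/funext => y; rewrite uE /Q /composite /shifted_phase /kap.
    by congr (_ + phi (_ + _ * tanh _)); ring.
  by move=> j2; rewrite {1}E (tower_derive1n tS j2).
have hle j x : (j <= 2)%N -> `|derive1n j h x| <= M1 * c.
  move=> j2; apply: le_trans (hB j x (leqW j2)) _.
  rewrite ler_piMr ?mulr_ge0 ?(ltW c0)// -[leRHS]expR0 ler_expR oppr_le0.
  by rewrite !mulr_ge0// ltW.
exists (M1 * c + (M + K)), (M1 * c * (th * w)^-1 + K * w^-1); split => j x j2 x0.
  rewrite uQ//; apply: le_trans (ler_normD _ _) _; rewrite lerD ?hle//.
  have := HK j x j2 x0; rewrite -/Q => H.
  have e1 : K * expR (- (2 * (kap * x))) <= K.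
    by rewrite ler_piMr// -[leRHS]expR0 ler_expR oppr_le0 mulr_ge0// mulr_ge0.
  have := ler_normD (Q j x - Phi j (x + tau)) (Phi j (x + tau)); rewrite subrK => H2.
  apply: le_trans H2 _; rewrite addrC lerD ?HM ?(leq_trans j2)//.
  exact: le_trans H e1.
have x1 : 0 <= x by lra.
rewrite uQ// -addrA; apply: le_trans (ler_normD _ _) _; rewrite mulrDl lerD//.
  apply: le_trans (hB j x (leqW j2)) _; rewrite -[leRHS]mulrA ler_wpM2l ?mulr_ge0 ?(ltW c0)//.
  apply: expRN_le_div => //; first by rewrite mulr_gt0.
  by rewrite (ger0_norm x1).
apply: le_trans (HK j x j2 x1) _; rewrite -[leRHS]mulrA ler_wpM2l//.
by apply: expRN_le_div => //; rewrite /kap le_eqVlt; apply/orP; left; apply/eqP; field.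
Qed.

(** With [psi x = F (k (x + tau))] every [x]-derivative brings out a factor [k], and the
whole expression is [k^2] times the periodic one. *)
Lemma line_eigenfunction (L k c nu tau : R) (p phi : R -> R) : 0 < k ->
  (forall z, p (z + 2 * pi) = p z) -> phi = (fun x => p (k * x)) -> line_wave c phi ->
  Defs.eigenvalue (per_op L k c p) nu%:C ->
  exists psi, [/\ tower 6 psi, continuous (psi 6%N),
    forall x, psi 0%N (x + 2 * pi / k) = psi 0%N x, exists x, psi 0%N x != 0 &
    forall x, kp_classical (k * L) 1 1 c (fun j x => derive1n j phi (x + tau)) psi x
      = k ^+ 2 * nu * psi 0%N x].
Proof.
move=> k0 pp phiE wphi ev; have kn0 : k != 0 by rewrite gt_eqF.
have [f [Hf nf K]] := per_eigenfunction ev.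
have [F [tF cF fF pF]] := Hs_per_tower Hf.
pose Phi j := derive1n j phi.
have tP : tower 4 Phi := line_wave_tower wphi.
pose P := affine_tower Phi k^-1 0.
have tP4 : tower 4 P := tower_affine _ _ tP.
have P0 : P 0%N = p.
  apply/funext => z; rewrite /P /affine_tower expr0 mul1r addr0 /Phi /= phiE.
  by rewrite mulrA mulfV// mul1r.
have cP2 : continuous (P 2%N) by exact: tower_continuous tP4 _.
have cF0 : continuous (F 0%N) by exact: tower_continuous tF _.
have cG : continuous (fun x => nu * F 0%N x).
  by move=> x; apply: cvgM; [exact: cvg_cst|exact: cF0].
have gG : {ae mu, forall x, nu * f x = nu * F 0%N x} by apply: ae_imp fF => x ->.
rewrite -P0 in K.
have [F' [tF' F'0 cF6 F'E]] := kp_regularity (expf_neq0 4 kn0) tF cF fF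
  (tower_le (isT : (2 <= 4)%N) tP4) cP2 cG gG K.
exists (affine_tower F' k (k * tau)); split.
- exact: tower_affine.
- move=> x; apply: cvgM; first exact: cvg_cst.
  apply: (@continuous_comp _ _ _ (fun x : R => k * x + k * tau) (F' 6%N)); last exact: cF6.
  by apply: cvgD; [apply: cvgM; [exact: cvg_cst|exact: cvg_id]|exact: cvg_cst].
- move=> x; rewrite /affine_tower expr0 !mul1r F'0.
  have -> : k * (x + 2 * pi / k) + k * tau = (k * x + k * tau) + 2 * pi by field.
  exact: pF.
- apply: contrapT => H; apply: nf; apply: ae_imp fF => y ->.
  apply: contrapT => /eqP y0; apply: H; exists (k^-1 * y - tau).
  rewrite /affine_tower expr0 !mul1r F'0.
  by have -> : k * (k^-1 * y - tau) + k * tau = y by field.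
- rewrite -[fun j x => derive1n j phi (x + tau)]/(fun j x => Phi j (x + tau)).
  clearbody Phi => x; set z := k * x + k * tau.
  have PE j : P j z = k^-1 ^+ j * Phi j (x + tau).
    rewrite /P /affine_tower addr0; congr (_ * Phi j _).
    by rewrite /z; field.
  have := F'E z; rewrite /kp_classical /= !PE /affine_tower -/z -F'0 => E.
  rewrite [RHS](_ : _ = k ^+ 2 * (nu * F' 0%N z)); last by rewrite expr0; ring.
  by rewrite -E; field.
Qed.

Theorem wave_ess_spectrum (L k c th nu M1 tau : R) (p u h phi : R -> R) :
  0 < c -> 0 < th -> 0 < k -> 0 <= M1 ->
  (forall z, p (z + 2 * pi) = p z) -> phi = (fun x => p (k * x)) ->
  line_wave c phi -> line_wave c u ->
  (forall x, u x = h x + phi (x + tau * tanh (Num.sqrt c * x / 2))) ->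
  (forall j x, (j < 3)%N -> derivable (derive1n j h) x 1) ->
  (forall j x, (j <= 3)%N -> `|derive1n j h x| <= M1 * c * expR (- (th * Num.sqrt c * `|x|))) ->
  Defs.eigenvalue (per_op L k c p) nu%:C ->
  ess_spectrum (line_op (k * L)%:C c u) (k ^+ 2 * nu)%:C.
Proof.
move=> c0 th0 k0 M10 pp phiE wphi wu uE dh hB ev.
have T0 : 0 < 2 * pi / k by rewrite divr_gt0// mulr_gt0// pi_gt0.
have phiT x : phi (x + 2 * pi / k) = phi x.
  rewrite phiE -(pp (k * x)); congr p.
  by field; rewrite gt_eqF.
have [B [C [UB UV]]] := potential_asymptotics c0 th0 T0 phiT wphi wu uE dh hB M10.
have [psi [tpsi cpsi psiT psi0 psiE]] := line_eigenfunction tau k0 pp phiE wphi ev.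
have tU := line_wave_tower wu.
exact: (@weyl_ess_spectrum R (k * L) c (k ^+ 2 * nu) _ B C u (fun j => derive1n j u)
  (fun j x => derive1n j phi (x + tau)) psi (tower_le (isT : (2 <= 4)%N) tU) erefl
  (tower_continuous tU (isT : (2 < 4)%N)) UB T0 tpsi cpsi psiT psi0 UV psiE).
Qed.

End WaveSpectrum.

(** * Unconditional sums *)

Section UnorderedSums.
Variable R : realType.
Local Open Scope complex_scope.
Variables (I : choiceType) (P : pred I).

Lemma Re_sum (J : Type) (s : seq J) (Q : pred J) (x : J -> R[i]) :
  complex.Re (\sum_(i <- s | Q i) x i) = \sum_(i <- s | Q i) complex.Re (x i).
Proof.
elim: s => [|i s IH]; first by rewrite !big_nil.
by rewrite !big_cons; case: ifP => _ //; rewrite ReD IH.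
Qed.

Lemma has_sum_Re (x : I -> R[i]) (s : R[i]) : has_sum P x s ->
  has_sum P (fun i => complex.Re (x i)) (complex.Re s).
Proof.
move=> H e e0; have e0' : 0 < e%:C by rewrite ltcR.
have [A HA] := H _ e0'; exists A => B AB; have := HA B AB.
rewrite -Re_sum -ReN -ReD -ltcR; apply: le_lt_trans.
exact: normc_ge_Re.
Qed.

Lemma sum_fset_split (A B : {fset I}) (y : I -> R) : (A `<=` B)%fset ->
  \sum_(i <- B | P i) y i = \sum_(i <- A | P i) y i + \sum_(i <- (B `\` A)%fset | P i) y i.
Proof.
move=> AB; rewrite -big_cat; apply: perm_big; apply: uniq_perm.
- exact: fset_uniq.
- rewrite cat_uniq !fset_uniq andbT /=; apply/hasPn => i.
  by rewrite inE => /andP[].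
- move=> i; rewrite mem_cat !inE; case: (boolP (i \in A)) => //= iA.
  exact: (fsubsetP AB).
Qed.

(** In [R] unconditional summability is absolute: split a finite set into its
nonnegative and its negative terms. *)
Lemma has_sum_abs_tail (y : I -> R) (s e : R) : has_sum P y s -> 0 < e ->
  exists A : {fset I}, forall B, (A `<=` B)%fset ->
    \sum_(i <- (B `\` A)%fset | P i) `|y i| <= e.
Proof.
move=> H e0; have e4 : 0 < e / 4 by rewrite divr_gt0.
have [A HA] := H _ e4; exists A => B AB.
have tail (D : {fset I}) : (forall i, i \in D -> i \notin A) -> `|\sum_(i <- D | P i) y i| <= e / 2.
  move=> AD; have AAD : (A `<=` A `|` D)%fset by exact: fsubsetUl.
  have := HA _ AAD; rewrite (sum_fset_split y AAD).
  have -> : ((A `|` D) `\` A = D)%fset.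
    apply/fsetP => i; rewrite !inE; case: (boolP (i \in A)) => //= iA.
    by apply/esym/negbTE/negP => /AD; rewrite iA.
  have := HA A (fsubset_refl A).
  set a := \sum_(i <- A | _) _; set d := \sum_(i <- D | _) _ => h1 h2.
  have := ler_normB (s - a) (s - (a + d)).
  have -> : s - a - (s - (a + d)) = d by ring.
  by lra.
have AB0 i : i \in (B `\` A)%fset -> i \notin A by rewrite inE => /andP[].
pose D1 := [fset i in (B `\` A)%fset | 0 <= y i]%fset.
pose D2 := [fset i in (B `\` A)%fset | ~~ (0 <= y i)]%fset.
have T1 : `|\sum_(i <- D1 | P i) y i| <= e / 2.
  by apply: tail => i; rewrite !inE /= => /andP[iB _]; apply: AB0; rewrite inE.
have T2 : `|\sum_(i <- D2 | P i) y i| <= e / 2.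
  by apply: tail => i; rewrite !inE /= => /andP[iB _]; apply: AB0; rewrite inE.
have -> : \sum_(i <- (B `\` A)%fset | P i) `|y i| =
    \sum_(i <- D1 | P i) y i + - \sum_(i <- D2 | P i) y i.
  rewrite (big_fsetIDcond _ (fun i => 0 <= y i)) /= -sumrN; congr (_ + _).
    rewrite big_seq_cond [RHS]big_seq_cond; apply: eq_bigr => i /andP[].
    by rewrite !inE /= => /andP[_ yi] _; rewrite ger0_norm.
  rewrite big_seq_cond [RHS]big_seq_cond; apply: eq_bigr => i /andP[].
  by rewrite !inE /= -ltNge => /andP[_ yi] _; rewrite ltr0_norm.
have := ler_norm (\sum_(i <- D1 | P i) y i).
have := ler_norm (- \sum_(i <- D2 | P i) y i); rewrite normrN; lra.
Qed.

End UnorderedSums.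

(** * Continuity of the periodic profile *)

Section ProfileContinuity.
Variable R : realType.
Local Open Scope complex_scope.

Definition profile_term (pt : nat -> nat -> R) (i : nat * nat) (a z : R) : R :=
  pt i.1 i.2 * cos ((i.1%:R - i.2%:R) * z) * a ^+ (i.1 + i.2).

Lemma profile_term_continuous pt i :
  continuous (fun w : R * R => profile_term pt i w.1 w.2).
Proof.
move=> w; apply: cvgM; last first.
  apply: (@continuous_comp _ _ _ (fun w : R * R => w.1) (fun a : R => a ^+ (i.1 + i.2))).
    exact: cvg_fst.
  exact: exprn_continuous.
apply: cvgM; first exact: cvg_cst.
apply: (@continuous_comp _ _ _ (fun w : R * R => (i.1%:R - i.2%:R) * w.2) (@cos R)).
  by apply: cvgM; [exact: cvg_cst|exact: cvg_snd].
exact: continuous_cos.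
Qed.

(** Weierstrass' test.  At [z = 0] and at an amplitude [b] beyond [|a1|] the expansion
is absolutely summable, and it dominates the expansion at every [z] and every
amplitude up to [b]; so the profile is a uniform limit of continuous functions. *)
Lemma profile_jointly_continuous (c a0 : R) (pt : nat -> nat -> R) (p : R -> R -> R) :
  (forall a, `|a| < a0 -> forall z, exists2 s : R[i],
     has_sum p_index (fun i : nat * nat =>
       (pt i.1 i.2)%:C * cis ((i.1%:R - i.2%:R) * z) * (a ^+ (i.1 + i.2))%:C) s &
     (p a z)%:C = (a * c * cos z)%:C + c%:C * s) ->
  forall a1 z1 e, `|a1| < a0 -> 0 < e -> exists2 d, 0 < d &
    forall a z, `|a - a1| < d -> `|z - z1| < d -> `|p a z - p a1 z1| < e.
Proof.
move=> Hp a1 z1 e a10 e0.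
(* the dominating amplitude, strictly between [|a1|] and [a0] *)
pose b := (`|a1| + a0) / 2.
have b1 : `|a1| < b by rewrite /b; lra.
have b0 : b < a0 by rewrite /b; lra.
have bp : 0 < b by apply: le_lt_trans b1; exact: normr_ge0.
have ReT a z i : complex.Re ((pt i.1 i.2)%:C * cis ((i.1%:R - i.2%:R) * z) * (a ^+ (i.1 + i.2))%:C)
    = profile_term pt i a z.
  by rewrite mulrC Re_mulC Re_mulC /= mulrC.
have Hreal a z : `|a| < a0 -> exists2 s : R,
    has_sum p_index (fun i => profile_term pt i a z) s & p a z = a * c * cos z + c * s.
  move=> aa; have [s Hs E] := Hp a aa z; exists (complex.Re s).
    have := has_sum_Re Hs; congr has_sum; apply/funext => i; exact: ReT.
  by have := congr1 (@complex.Re R) E; rewrite ReD Re_mulC.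
pose e' := e / (8 * (`|c| + 1)).
have c1 : 0 < `|c| + 1 by rewrite ltr_wpDl.
have e'0 : 0 < e' by rewrite divr_gt0// mulr_gt0.
have [s0 Hs0 _] := Hreal b 0 ltac:(by rewrite gtr0_norm).
have [A HA] := has_sum_abs_tail Hs0 e'0.
pose g (w : R * R) := w.1 * c * cos w.2 + c * \sum_(i <- A | p_index i) profile_term pt i w.1 w.2.
have pg a z : `|a| <= b -> `|p a z - g (a, z)| <= e / 4.
  move=> ab; have [s Hs ->] := Hreal a z (le_lt_trans ab b0).
  have [A' HA'] := Hs _ e'0.
  have AB : (A `<=` A `|` A')%fset by exact: fsubsetUl.
  have := HA' _ (fsubsetUr A A'); rewrite (sum_fset_split _ _ AB) => H1.
  have H2 : `|\sum_(i <- ((A `|` A') `\` A)%fset | p_index i) profile_term pt i a z| <= e'.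
    apply: le_trans (ler_norm_sum _ _ _) _; apply: le_trans (HA _ AB).
    apply: ler_sum => i _; rewrite /profile_term mulr0 cos0 mulr1 !normrM.
    rewrite ler_pM ?mulr_ge0//; first by rewrite ler_piMr// ler_norml cos_geN1 cos_le1.
    by rewrite !normrX lerXn2r ?nnegrE// (gtr0_norm bp).
  rewrite /g /=; set SA := \sum_(i <- A | _) _ in H1 *.
  have -> : a * c * cos z + c * s - (a * c * cos z + c * SA) = c * (s - SA) by ring.
  rewrite normrM; apply: (@le_trans _ _ ((`|c| + 1) * (2 * e'))).
    rewrite ler_pM//; first by rewrite lerDl.
    move: H1 H2; set D := \sum_(i <- _ | _) _ => H1 H2.
    have := ler_normD (s - (SA + D)) D; rewrite (_ : s - (SA + D) + D = s - SA); last by ring.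
    by lra.
  rewrite /e' le_eqVlt; apply/orP; left; apply/eqP; field.
  by rewrite gt_eqF.
have cg : continuous g.
  move=> w; apply: cvgD.
    apply: cvgM; first by apply: cvgM; [exact: cvg_fst|exact: cvg_cst].
    by apply: (@continuous_comp _ _ _ (fun w : R * R => w.2) (@cos R)); [exact: cvg_snd|exact: continuous_cos].
  apply: cvgM; first exact: cvg_cst.
  have : forall s : seq (nat * nat),
      continuous (fun w : R * R => \sum_(i <- s | p_index i) profile_term pt i w.1 w.2).
    elim=> [|i s IH].
      rewrite (_ : (fun w => _) = cst 0); first exact: cst_continuous.
      by apply/funext => v; rewrite big_nil.
    case: (boolP (p_index i)) => Pi; last first.
      by under eq_fun do rewrite big_cons (negbTE Pi).
    under eq_fun do rewrite big_cons Pi.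
    by move=> v; apply: cvgD; [exact: profile_term_continuous|exact: IH].
  by move/(_ (enum_fset A)); apply.
have e4 : 0 < e / 4 by rewrite divr_gt0.
have /cvgrPdist_lt /(_ _ e4) /nbhs_ballP[d /= d0 Hd] := cg (a1, z1).
exists (Num.min d (b - `|a1|)); first by rewrite lt_min d0 subr_gt0.
move=> a z; rewrite !lt_min => /andP[ad ab] /andP[zd _].
have ab' : `|a| <= b.
  by have := ler_normD (a - a1) a1; rewrite subrK; lra.
have Hg : `|g (a1, z1) - g (a, z)| < e / 4.
  by apply: Hd; split; rewrite /ball /= distrC.
have := pg a z ab'; have := pg a1 z1 (ltW b1).
move: (p a z) (p a1 z1) (g (a, z)) (g (a1, z1)) Hg => u v x y.
rewrite !ltr_norml !ler_norml; lra.
Qed.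

End ProfileContinuity.

(** * Continuity of analytic families *)

Section AnalyticContinuity.
Variable R : realType.

Lemma geometric_sum_le2 (q : R) n : 0 <= q <= 1 / 2 -> \sum_(i < n) q ^+ i <= 2.
Proof.
move=> /andP[q0 q1]; elim: n => [|n IH]; first by rewrite big_ord0.
rewrite big_ord_recl expr0.
under eq_bigr => i _ do rewrite lift0 exprS.
have s0 : 0 <= \sum_(i < n) q ^+ i by apply: sumr_ge0 => i _; exact: exprn_ge0.
rewrite -mulr_sumr; nra.
Qed.

(** Along [c = c1] only the terms with exponent zero in [c - c1] survive, and the
series is dominated by a geometric one. *)
Lemma analytic2_continuous (D : R -> R -> Prop) (F : R -> R -> R) (a1 c1 : R) :
  analytic2 (V := R^o) (fun x r => r = `|x|) D F -> D a1 c1 ->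
  forall e, 0 < e -> exists2 d, 0 < d & forall a, `|a - a1| < d -> `|F a c1 - F a1 c1| < e.
Proof.
move=> H D1 e e0; have [P [r [K [r0 [PK HF]]]]] := H _ _ D1.
have PK' m : `|P m 0%N| * r ^+ m <= K.
  by have [N -> ] := PK m 0%N; rewrite addn0.
have K0 : 0 <= K by apply: le_trans (PK' 0%N); rewrite expr0 mulr1.
pose q a := `|a - a1| / r.
have main a : `|a - a1| < r / 2 -> `|F a c1 - P 0%N 0%N| <= 2 * K * q a.
  move=> ar; rewrite leNgt; apply/negP => Hlt.
  have q0 : 0 <= q a by rewrite /q divr_ge0// ltW.
  have q1 : q a <= 1 / 2 by rewrite /q ler_pdivrMr//; lra.
  have ar' : `|a - a1| < r by lra.
  have cr : `|c1 - c1| < r by rewrite subrr normr0.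
  have d0 : 0 < `|F a c1 - P 0%N 0%N| - 2 * K * q a by rewrite subr_gt0.
  have [N0 HN] := HF a c1 ar' cr _ d0.
  have [d -> ] := HN N0.+1 (leqnSn _).
  have -> : \sum_(m < N0.+1) \sum_(n < N0.+1) ((a - a1) ^+ m * (c1 - c1) ^+ n) *: (P m n : R^o) =
     P 0%N 0%N + \sum_(m < N0) (a - a1) ^+ m.+1 * P m.+1 0%N.
    under eq_bigr => m _.
      rewrite big_ord_recl big1 => [|n _]; last first.
        by rewrite subrr expr0n /= mulr0 scale0r.
      rewrite addr0 expr0 mulr1; over.
    rewrite big_ord_recl expr0 scale1r; congr (_ + _).
  have S : `|\sum_(m < N0) (a - a1) ^+ m.+1 * P m.+1 0%N| <= 2 * K * q a.
    apply: le_trans (ler_norm_sum _ _ _) _.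
    apply: (@le_trans _ _ (\sum_(m < N0) K * q a * q a ^+ m)).
      apply: ler_sum => m _; rewrite normrM normrX -mulrA -exprS /q expr_div_n.
      rewrite mulrCA ler_wpM2l ?exprn_ge0//.
      by rewrite ler_pdivlMr ?exprn_gt0.
    rewrite -mulr_sumr; have := @geometric_sum_le2 (q a) N0 ltac:(by rewrite q0 q1).
    move=> /(ler_wpM2l (mulr_ge0 K0 q0)); lra.
  set Sm := \sum_(m < N0) _ in S *.
  have := ler_normD (F a c1 - (P 0%N 0%N + Sm)) Sm.
  rewrite (_ : F a c1 - (P 0%N 0%N + Sm) + Sm = F a c1 - P 0%N 0%N); last by ring.
  by lra.
have F1 : F a1 c1 = P 0%N 0%N.
  have := main a1; rewrite /q subrr normr0 mul0r mulr0 normr_le0 subr_eq0.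
  by move=> /(_ ltac:(lra)) /eqP.
exists (Num.min (r / 2) (e * r / (2 * K + 1))).
  by rewrite lt_min !divr_gt0// ?mulr_gt0//; lra.
move=> a; rewrite lt_min F1 => /andP[a2 a3].
apply: le_lt_trans (main a a2) _.
have : `|a - a1| * (2 * K + 1) < e * r by rewrite -ltr_pdivlMr//; lra.
have := normr_ge0 (a - a1).
rewrite /q mulrA ltr_pdivrMr// => n0; nra.
Qed.

End AnalyticContinuity.

(** * Vanishing dispersion *)

Section SmallDispersion.
Variable R : realType.
Implicit Types (f g : R -> R).

Definition second_difference (d : R) f (z : R) : R := f (z + d) + f (z - d) - 2 * f z.

(** Twice integrated form of [f'' >= m]. *)
Lemma second_difference_ge f f1 f2 (m d z : R) : 0 <= d ->
  (forall x : R, is_derive x 1 f (f1 x)) -> (forall x : R, is_derive x 1 f1 (f2 x)) ->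
  (forall x, z - d <= x <= z + d -> m <= f2 x) -> m * d ^+ 2 <= second_difference d f z.
Proof.
move=> d0 df df1 mf2.
have plus (h h' : R -> R) (x : R) : (forall x : R, is_derive x 1 h (h' x)) ->
    is_derive x 1 (fun s => h (z + s)) (h' (z + x)).
  move=> dh; have := @is_derive_affine R h 1 z x (h' (z + x)).
  rewrite mul1r (addrC x) => /(_ (dh _)); rewrite mul1r.
  by move/is_derive_ext; apply => // y; rewrite mul1r addrC.
have minus (h h' : R -> R) (x : R) : (forall x : R, is_derive x 1 h (h' x)) ->
    is_derive x 1 (fun s => h (z - s)) (- h' (z - x)).
  move=> dh; have := @is_derive_affine R h (-1) z x (h' (z - x)).
  rewrite mulN1r (addrC (- x)) => /(_ (dh _)); rewrite mulN1r.
  by move/is_derive_ext; apply => // y; rewrite mulN1r addrC.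
pose g2 s := f2 (z + s) + f2 (z - s) - 2 * m.
pose g1 s := f1 (z + s) - f1 (z - s) - 2 * m * s.
pose g s := f (z + s) + f (z - s) - m * s ^+ 2.
have dg1 (s : R) : is_derive s 1 g1 (g2 s).
  have := is_deriveB (is_deriveB (plus _ _ s df1) (minus _ _ s df1)) (is_deriveZ (2 * m) (is_derive_id s 1)).
  move/is_derive_ext; apply => //.
  by rewrite /g2 opprK -[_ *: 1]/(_ * 1) mulr1.
have dg (s : R) : is_derive s 1 g (g1 s).
  have := is_deriveB (is_deriveD (plus _ _ s df) (minus _ _ s df)) (is_deriveZ m (is_deriveX 2 (is_derive_id s 1))).
  move/is_derive_ext; apply => //.
  by rewrite /g1 -![_ *: _]/(_ * _) /= expr1; ring.
have g1_ge0 s : 0 <= s <= d -> 0 <= g1 s.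
  move=> /andP[s0 sd].
  have -> : 0 = g1 0 by rewrite /g1 addr0 subr0; ring.
  apply: (derive_ge0_nondecreasing s0 dg1) => x /andP[x0 xs].
  have H1 : m <= f2 (z + x) by apply: mf2; apply/andP; split; lra.
  have H2 : m <= f2 (z - x) by apply: mf2; apply/andP; split; lra.
  by rewrite /g2; lra.
have : g 0 <= g d.
  by apply: (derive_ge0_nondecreasing d0 dg) => x /andP[x0 xd]; apply: g1_ge0; rewrite !ltW.
by rewrite /g /second_difference addr0 subr0; lra.
Qed.

Lemma is_derive_second_difference f f' (d x : R) : (forall x : R, is_derive x 1 f (f' x)) ->
  is_derive x 1 (second_difference d f) (second_difference d f' x).
Proof.
move=> df.
have sh (s : R) : is_derive x 1 (fun y => f (y + s)) (f' (x + s)).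
  have := @is_derive_affine R f 1 s x (f' (x + s)); rewrite mul1r => /(_ (df _)); rewrite mul1r.
  by move/is_derive_ext; apply => // y; rewrite mul1r.
have := is_deriveB (is_deriveD (sh d) (sh (- d))) (is_deriveZ 2 (df x)).
by move/is_derive_ext; apply.
Qed.

Lemma second_difference_le f (M d z : R) : (forall x, z - d <= x <= z + d -> `|f x| <= M) ->
  0 <= d -> `|second_difference d f z| <= 4 * M.
Proof.
move=> fM d0.
have H1 : `|f (z + d)| <= M by apply: fM; apply/andP; split; lra.
have H2 : `|f (z - d)| <= M by apply: fM; apply/andP; split; lra.
have H3 : `|f z| <= M by apply: fM; apply/andP; split; lra.
move: H1 H2 H3; rewrite /second_difference !ler_norml => /andP[? ?] /andP[? ?] /andP[? ?].
by apply/andP; split; lra.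
Qed.

(** If [kap^4 P'''' + kap^2 P''] stays above [eta] near [z0] while [P] stays bounded, then
[kap] cannot be too small: two second differences remove all derivatives, and second
differences of [P] are bounded by multiples of [M]. *)
Lemma small_dispersion (P : nat -> R -> R) (kap eta M d z0 : R) : tower 4 P ->
  0 <= d -> 0 <= kap <= 1 ->
  (forall z, `|z - z0| <= 2 * d -> `|P 0%N z| <= M) ->
  (forall z, `|z - z0| <= 2 * d -> eta <= kap ^+ 4 * P 4%N z + kap ^+ 2 * P 2%N z) ->
  eta * d ^+ 4 <= kap ^+ 2 * (4 * M * d ^+ 2 + 16 * M).
Proof.
move=> tP d0 /andP[k0 k1] PM Peta.
have M0 : 0 <= M.
  by apply: le_trans (PM z0 _); [exact: normr_ge0|rewrite subrr normr0 mulr_ge0].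
pose G j x := kap ^+ 4 * P j.+2 x + kap ^+ 2 * P j x.
have dG j (x : R) : (j < 2)%N -> is_derive x 1 (G j) (G j.+1 x).
  move=> j2; have := is_deriveD (is_deriveZ (kap ^+ 4) (tP j.+2 x j2))
    (is_deriveZ (kap ^+ 2) (tP j x (ltn_trans j2 (isT : (2 < 4)%N)))).
  by move/is_derive_ext; apply.
pose D := second_difference d.
have near1 z x : `|z - z0| <= d -> z - d <= x <= z + d -> `|x - z0| <= 2 * d.
  rewrite !ler_norml => /andP[? ?] /andP[? ?]; apply/andP; split; lra.
have S1 z : `|z - z0| <= d -> eta * d ^+ 2 <= D (G 0%N) z.
  move=> zd; apply: second_difference_ge d0 (fun x => dG 0%N x isT) (fun x => dG 1%N x isT) _.
  by move=> x xz; apply: Peta; exact: near1 zd xz.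
have S2 z : `|z - z0| <= d -> eta * d ^+ 2 - 4 * M * kap ^+ 2 <= kap ^+ 4 * D (P 2%N) z.
  move=> zd; have := S1 z zd.
  have -> : D (G 0%N) z = kap ^+ 4 * D (P 2%N) z + kap ^+ 2 * D (P 0%N) z.
    by rewrite /D /second_difference /G; ring.
  have H : `|D (P 0%N) z| <= 4 * M.
    by apply: second_difference_le => // x xz; apply: PM; exact: near1 zd xz.
  have : kap ^+ 2 * D (P 0%N) z <= kap ^+ 2 * (4 * M).
    by rewrite ler_wpM2l ?sqr_ge0//; apply: le_trans (ler_norm _) H.
  lra.
pose Q j x := kap ^+ 4 * D (P j) x.
have dQ j (x : R) : (j < 4)%N -> is_derive x 1 (Q j) (Q j.+1 x).
  move=> j4; have := is_deriveZ (kap ^+ 4)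
    (@is_derive_second_difference (P j) (P j.+1) d x (fun y => tP j y j4)).
  by move/is_derive_ext; apply.
have S3 : (eta * d ^+ 2 - 4 * M * kap ^+ 2) * d ^+ 2 <= D (Q 0%N) z0.
  apply: second_difference_ge d0 (fun x => dQ 0%N x isT) (fun x => dQ 1%N x isT) _.
  move=> x xz; apply: S2; move: xz => /andP[? ?]; rewrite ler_norml; apply/andP; split; lra.
have S4 : `|D (Q 0%N) z0| <= 4 * (kap ^+ 4 * (4 * M)).
  apply: second_difference_le => // x xz.
  have xd : `|x - z0| <= d by move: xz => /andP[? ?]; rewrite ler_norml; apply/andP; split; lra.
  rewrite /Q normrM ger0_norm ?exprn_ge0// ler_wpM2l ?exprn_ge0//.
  by apply: second_difference_le => // y yx; apply: PM; exact: near1 xd yx.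
have k42 : kap ^+ 4 * (16 * M) <= kap ^+ 2 * (16 * M).
  rewrite ler_wpM2r ?mulr_ge0// -[leRHS]mulr1 (exprD kap 2 2) ler_wpM2l ?sqr_ge0//.
  by rewrite exprn_ile1.
have := le_trans S3 (le_trans (ler_norm _) S4).
have -> : eta * d ^+ 4 = eta * d ^+ 2 * d ^+ 2 by ring.
rewrite mulrBl mulrDr; move: k42; set q := d ^+ 2.
have -> : 4 * M * kap ^+ 2 * q = kap ^+ 2 * (4 * M * q) by ring.
have -> : 4 * (kap ^+ 4 * (4 * M)) = kap ^+ 4 * (16 * M) by ring.
lra.
Qed.

End SmallDispersion.

(** * Constant profiles *)

Section ConstantPotential.
Variable R : realType.
Local Open Scope complex_scope.
Local Notation mu := (@lebesgue_measure R).

(** For wavenumber zero the eigenvalue equation is [(v - c) F'' = L F' - nu F].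
Multiplying by [F'] shows that the periodic function
[(v - c) F'^2 / 2 + nu F^2 / 2] has derivative [L F'^2 >= 0], so [F' = 0], and then
[nu F = 0]. *)
Lemma constant_potential_no_eigenvalue (L c v nu : R) (p : R -> R) :
  0 < L -> nu < 0 -> (forall z, p z = v) ->
  ~ Defs.eigenvalue (per_op L 0 c p) nu%:C.
Proof.
move=> L0 nu0 pv ev; have [f [Hf nf K]] := per_eigenfunction ev; apply: nf.
have [F [tF cF fF pF]] := Hs_per_tower Hf.
pose V (j : nat) (x : R) : R := if j is 0%N then v else 0.
have tV : tower 1 V.
  by case=> [|//] x _; exact: is_derive_cst.
have pV : p = V 0%N by apply/funext => z; rewrite pv.
have cF0 : continuous (F 0%N) by exact: tower_continuous tF _.
have cG : continuous (fun x => nu * F 0%N x).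
  by move=> x; apply: cvgM; [exact: cvg_cst|exact: cF0].
have gG : {ae mu, forall x, nu * f x = nu * F 0%N x} by apply: ae_imp fF => x ->.
rewrite pV in K.
have D := kp_bootstrap tF cF fF tV (@cst_continuous _ _ (0 : R)) cG gG K.
have E x : (v - c) * F 2%N x = L * F 1%N x - nu * F 0%N x.
  apply: is_derive_unique (D x); have := is_deriveZ (v - c) (tF 1%N x isT).
  move/is_derive_ext; apply => // y.
  by rewrite -[LHS]/((v - c) * F 1%N y) /=; ring.
(* the energy that is nondecreasing along the solution *)
pose Q x := (v - c) / 2 * F 1%N x ^+ 2 + nu / 2 * F 0%N x ^+ 2.
have dQ (x : R) : is_derive x 1 Q (L * F 1%N x ^+ 2).
  have := is_deriveD (is_deriveZ ((v - c) / 2) (is_deriveM (tF 1%N x isT) (tF 1%N x isT)))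
    (is_deriveZ (nu / 2) (is_deriveM (tF 0%N x isT) (tF 0%N x isT))).
  move/is_derive_ext; apply => [y|]; first by rewrite /Q !expr2.
  rewrite -![_ *: _]/(_ * _).
  have -> : L * F 1%N x ^+ 2 = F 1%N x * ((L * F 1%N x - nu * F 0%N x) + nu * F 0%N x) by ring.
  by rewrite -E; field.
have pi0 := @pi_gt0 R.
have QT x : Q (x + 2 * pi) = Q x.
  by rewrite /Q !(tower_periodic tF pF).
have mono a b : a <= b -> Q a <= Q b.
  move=> ab; apply: (derive_ge0_nondecreasing ab dQ) => x _.
  by rewrite mulr_ge0 ?sqr_ge0// ltW.
have F1 x : F 1%N x = 0.
  have C y : x - pi <= y <= x + pi -> Q y = Q (x - pi).
    move=> /andP[y1 y2]; apply/eqP; rewrite eq_le (mono _ _ y1) andbT -(QT (x - pi)).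
    by apply: mono; lra.
  have D0 : is_derive x 1 Q 0.
    apply: near_eq_is_derive (is_derive_cst (Q (x - pi)) x 1).
    near=> y; apply/esym/C; apply/andP; split; apply/ltW.
      by near: y; apply: lt_nbhsr; lra.
    by near: y; apply: lt_nbhsl; lra.
  have /eqP := is_derive_unique D0 (dQ x).
  by rewrite eq_sym mulf_eq0 (gt_eqF L0) /= sqrf_eq0 => /eqP.
have F2 x : F 2%N x = 0.
  apply: is_derive_unique (tF 1%N x isT) _.
  have -> : F 1%N = cst 0 by apply/funext.
  exact: is_derive_cst.
apply: ae_imp fF => x ->.
have /eqP := E x; rewrite F1 F2 !mulr0 sub0r eq_sym oppr_eq0 mulf_eq0 (lt_eqF nu0) /=.
by move/eqP.
Unshelve. all: by end_near. Qed.

End ConstantPotential.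

(** * Positivity of the wavenumber *)

Section WavenumberPositive.
Variable R : realType.
Local Open Scope complex_scope.

Lemma first_zero (f : R -> R) :
  (forall t e, 0 <= t <= 1 -> 0 < e -> exists2 d, 0 < d & forall s, `|s - t| < d -> `|f s - f t| < e) ->
  0 < f 0 -> f 1 <= 0 ->
  exists t, [/\ 0 < t <= 1, f t = 0 & forall s, 0 <= s < t -> 0 < f s].
Proof.
move=> cf f0 f1.
pose Z := [set t | 0 <= t <= 1 /\ f t <= 0].
have Z1 : Z 1 by rewrite /Z /= ler01 lexx.
have lb : has_lbound Z by exists 0 => t [/andP[]].
have hZ : has_inf Z by split => //; exists 1.
pose t := inf Z.
have t0 : 0 <= t by apply: lb_le_inf; [exists 1|move=> s [/andP[]]].
have t1 : t <= 1 by exact: ge_inf.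
have below s : 0 <= s < t -> 0 < f s.
  move=> /andP[s0 st]; rewrite ltNge; apply/negP => fs.
  have : t <= s by apply: ge_inf => //; split => //; rewrite s0 (le_trans (ltW st)).
  by rewrite leNgt st.
have t01 : 0 <= t <= 1 by rewrite t0.
have ft_le : f t <= 0.
  rewrite leNgt; apply/negP => ft; have [d d0 Hd] := cf t (f t) t01 ft.
  have [s Zs st] := inf_adherent d0 hZ.
  have ts : t <= s by exact: ge_inf.
  have std : `|s - t| < d by rewrite ger0_norm ?subr_ge0// ltrBlDl.
  have [_ fs] := Zs; have := Hd s std; rewrite ltr_norml => /andP[fd _].
  by move: fd fs; lra.
have tpos : 0 < t.
  by rewrite lt_neqAle t0 andbT; apply/eqP => E; move: ft_le; rewrite -E leNgt f0.
have ft_ge : 0 <= f t.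
  rewrite leNgt; apply/negP => ft.
  have ft' : 0 < - f t by rewrite oppr_gt0.
  have [d d0 Hd] := cf t _ t01 ft'.
  have [r /andP[r0]] := @exists_lt_pos R (Num.min d t) ltac:(by rewrite lt_min d0).
  rewrite lt_min => /andP[rd rt].
  have := below (t - r) ltac:(by apply/andP; split; lra).
  have std : `|t - r - t| < d by rewrite addrAC subrr add0r normrN gtr0_norm.
  by have := Hd (t - r) std; rewrite ltr_norml => /andP[_ +]; lra.
exists t; split => //; first by rewrite tpos.
by apply/eqP; rewrite eq_le ft_le.
Qed.

(** By the intermediate value theorem the midpoint would also be a value. *)
Lemma two_valued_constant (f : R -> R) (u v : R) : u != v -> continuous f ->
  (forall z, f z = u \/ f z = v) -> forall z, f z = f 0.
Proof.
move=> uv cf fuv z; apply: contrapT => /eqP nz.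
have H a b : a <= b -> f a = f b.
  move=> ab; apply: contrapT => /eqP nab.
  have cw : {within `[a, b], continuous f} by exact: continuous_subspaceT.
  pose m := (f a + f b) / 2.
  have [|x _ fx] := @IVT R f a b m ab cw.
    rewrite /m; have [h|h|h] := ltgtP (f a) (f b); apply/andP; split;
      by [lra|move: nab; rewrite h eqxx].
  have uv' : u - v != 0 by rewrite subr_eq0.
  have nab' : f a - f b != 0 by rewrite subr_eq0.
  have : f x = m by []. rewrite /m => E.
  by move: uv' nab' E; case: (fuv a) => ->; case: (fuv b) => ->; case: (fuv x) => -> h1 h2 E;
    move: h1 h2; rewrite ?subrr ?eqxx// => /eqP h1 _; lra.
have [z0|z0] := leP 0 z; first by move: nz; rewrite (H 0 z z0) eqxx.
by move: nz; rewrite (H z 0 (ltW z0)) eqxx.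
Qed.

Lemma k0_gt0 (c : R) : 0 < k0 c.
Proof.
rewrite /k0 sqrtr_gt0 divr_gt0//; have := sqrtr_ge0 (1 + 4 * c); lra.
Qed.

(** An explicit modulus of continuity of [c u - u^2 / 2] at [v]. *)
Lemma nonlinearity_close (c u v eta : R) : 0 < c ->
  `|u - v| < Num.min 1 (eta / (c + `|v| + 2)) ->
  `|u| <= `|v| + 1 /\ `|(c * u - 2^-1 * u ^+ 2) - (c * v - 2^-1 * v ^+ 2)| <= eta.
Proof.
move=> c0; rewrite lt_min => /andP[h1 h2].
have v0 := normr_ge0 v.
have u1 : `|u| <= `|v| + 1.
  by have := ler_normD (u - v) v; rewrite subrK; lra.
split => //.
have -> : (c * u - 2^-1 * u ^+ 2) - (c * v - 2^-1 * v ^+ 2) = (u - v) * (c - 2^-1 * (u + v)).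
  by field.
have h3 : `|c - 2^-1 * (u + v)| <= c + `|v| + 2.
  have := ler_normD u v; have := ler_normB c (2^-1 * (u + v)).
  rewrite normrM (gtr0_norm c0) (ger0_norm (_ : 0 <= 2^-1)) ?invr_ge0//; lra.
move: h2; rewrite ltr_pdivlMr; last lra.
rewrite normrM => h2; apply: le_trans (ltW h2).
by rewrite ler_wpM2l.
Qed.

Lemma quarter_lt (d : R) : 0 < d -> 2 * (d / 4) < d.
Proof. lra. Qed.

Lemma half_norm_lower (x y : R) : 0 < y -> `|x - y| <= `|y| / 2 -> `|y| / 2 <= x.
Proof. by move=> y0; rewrite (gtr0_norm y0) ler_norml => /andP[? _]; lra. Qed.

Lemma half_norm_upper (x y : R) : y <= 0 -> `|x - y| <= `|y| / 2 -> `|y| / 2 <= - x.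
Proof. by move=> y0; rewrite (ler0_norm y0) ler_norml => /andP[_ ?]; lra. Qed.

(** The wave equation in the variable [z = k x]. *)
Lemma profile_tower (k c : R) (p : R -> R) : 0 < k -> line_wave c (fun x => p (k * x)) ->
  exists P, [/\ tower 4 P, P 0%N = p &
    forall z, k ^+ 4 * P 4%N z + k ^+ 2 * P 2%N z = c * p z - 2^-1 * p z ^+ 2].
Proof.
move=> k0 w; have kn0 : k != 0 by rewrite gt_eqF.
have tP := line_wave_tower w; have [_ ode] := w.
exists (affine_tower (fun j => derive1n j (fun x => p (k * x))) k^-1 0); split.
- exact: tower_affine.
- by apply/funext => z; rewrite /affine_tower expr0 mul1r addr0 /= mulrA mulfV// mul1r.
- move=> z; rewrite /affine_tower; set x := k^-1 * z + 0.
  have kx : k * x = z by rewrite /x addr0 mulrA mulfV// mul1r.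
  have kk (j : nat) (y : R) : k ^+ j * (k^-1 ^+ j * y) = y.
    by rewrite mulrA -exprMn mulfV// expr1n mul1r.
  rewrite !kk; have := ode x; rewrite kx.
  by move: (derive1n 4 _ x) (derive1n 2 _ x) (p z) => d4 d2 y; lra.
Qed.

(** The eigenvalue hypothesis is needed along the whole segment from [0] to [a], because
it is contradicted at the first amplitude where [k] vanishes. *)
Lemma wavenumber_positive (a0 c0 : R) (k : R -> R -> R) (p : R -> R -> R -> R) (a c : R) :
  periodic_family a0 c0 k p -> 0 < c < c0 -> `|a| < a0 ->
  (forall t, 0 < t <= 1 -> exists L nu, [/\ 0 < L, nu < 0 &
     Defs.eigenvalue (per_op L (k (t * a) c) c (p (t * a) c)) nu%:C]) ->
  0 < k a c.
Proof.
move=> [[a00 c00] Hw Hk [_ Hper] [Hex _ _ _ _]] /andP[cp cc0] aa0 Hev.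
have [K0 [C0 [rho0 [kt [pt [_ _ _ [_ Hks] [_ Hps]]]]]]] := Hex.
have cn : `|c| < c0 by rewrite gtr0_norm.
rewrite ltNge; apply/negP => ka.
pose f t := k (t * a) c.
have Da t : `|t| <= 1 -> `|t * a| < a0.
  move=> t1; apply: le_lt_trans aa0; rewrite normrM ler_piMl//.
have fcont t e : 0 <= t <= 1 -> 0 < e ->
    exists2 d, 0 < d & forall s, `|s - t| < d -> `|f s - f t| < e.
  move=> /andP[t0 t1] e0.
  have tn : `|t| <= 1 by rewrite ger0_norm.
  have [d d0 Hd] := analytic2_continuous Hk (conj (Da t tn) cn) e0.
  exists (d / (`|a| + 1)); first by rewrite divr_gt0// ltr_wpDl.
  move=> s; rewrite ltr_pdivlMr ?ltr_wpDl// => sd; apply: Hd.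
  rewrite -mulrBl normrM; apply: le_lt_trans sd; rewrite ler_wpM2l// lerDl//.
have f0 : 0 < f 0.
  rewrite /f mul0r.
  have D0 : `|0 : R| < a0 by rewrite normr0.
  have [ktil Hkt ->] := Hks 0 c (conj D0 cn).
  have -> : ktil = 0.
    apply: (cvg_unique _ Hkt) => //.
    rewrite (_ : (fun n => _) = cst 0); first exact: cvg_cst.
    apply/funext => n; rewrite /series /= big1// => i _.
    by rewrite expr0n muln_eq0 /= mulr0.
  by rewrite mulr0 addr0 k0_gt0.
have f1 : f 1 <= 0 by rewrite /f mul1r.
have [ts [/andP[ts0 ts1] fts below]] := first_zero fcont f0 f1.
have tsn : `|ts| <= 1 by rewrite gtr0_norm.
have joint := @profile_jointly_continuous R c a0 (fun n m => pt n m c) (fun a z => p a c z)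
  (fun a aa z => Hps a c (conj aa cn) z).
pose ps z := p (ts * a) c z.
have root z0 : c * ps z0 - 2^-1 * ps z0 ^+ 2 = 0.
  apply: contrapT => /eqP q0.
  pose eta := `|c * ps z0 - 2^-1 * ps z0 ^+ 2| / 2.
  have eta0 : 0 < eta by rewrite divr_gt0// normr_gt0.
  pose M := `|ps z0| + 1.
  have e0 : 0 < Num.min 1 (eta / (c + `|ps z0| + 2)).
    by rewrite lt_min ltr01 divr_gt0// addr_gt0// ltr_wpDr.
  have [d d0 Hd] := joint (ts * a) z0 _ (Da ts tsn) e0.
  pose dz := d / 4.
  have dz0 : 0 < dz by rewrite divr_gt0.
  pose bnd := 4 * M * dz ^+ 2 + 16 * M + 1.
  have M0 : 0 < M by rewrite ltr_wpDl.
  have bnd0 : 0 < bnd by rewrite /bnd !addr_gt0// !mulr_gt0// exprn_gt0.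
  have e10 : 0 < Num.min 1 (eta * dz ^+ 4 / bnd).
    by rewrite lt_min ltr01 divr_gt0// mulr_gt0// exprn_gt0.
  have ts01 : 0 <= ts <= 1 by rewrite ltW.
  have [d1 d10 Hd1] := fcont ts _ ts01 e10.
  have a1 : 0 < `|a| + 1 by rewrite ltr_wpDl.
  have [r /andP[r0]] := @exists_lt_pos R (Num.min ts (Num.min d1 (d / (`|a| + 1))))
    ltac:(by rewrite !lt_min ts0 d10 divr_gt0).
  rewrite !lt_min => /andP[rts /andP[rd1 rd]].
  pose t := ts - r.
  have tt : 0 <= t < ts by rewrite /t subr_ge0 (ltW rts) ltrBlDr ltrDl.
  have [t0 t_ts] := andP tt.
  have trn : `|t - ts| = r by rewrite /t addrAC subrr add0r normrN gtr0_norm.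
  have tn : `|t| <= 1 by rewrite ger0_norm// (le_trans (ltW t_ts)).
  have kt0 := below t tt.
  have ktlt : f t < Num.min 1 (eta * dz ^+ 4 / bnd).
    by have := Hd1 t; rewrite trn fts subr0 (gtr0_norm kt0); apply.
  move: ktlt; rewrite lt_min => /andP[kt1 ktb].
  have [wt _] := Hw (t * a) c (conj (Da t tn) cn).
  have [P [tP P0 PE]] := profile_tower kt0 wt.
  have near z : `|z - z0| <= 2 * dz -> `|p (t * a) c z - ps z0| < Num.min 1 (eta / (c + `|ps z0| + 2)).
    move=> zz; apply: Hd.
      rewrite -mulrBl normrM trn; move: rd; rewrite ltr_pdivlMr//; apply: le_lt_trans.
      by rewrite ler_wpM2l ?(ltW r0)// lerDl.
    exact: le_lt_trans zz (quarter_lt d0).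
  have nl z : `|z - z0| <= 2 * dz -> `|p (t * a) c z| <= M /\
      `|(c * p (t * a) c z - 2^-1 * p (t * a) c z ^+ 2) - (c * ps z0 - 2^-1 * ps z0 ^+ 2)| <= eta.
    by move=> zz; apply: nonlinearity_close cp (near z zz).
  have kt01 : 0 <= f t <= 1 by rewrite !ltW.
  (* apply the dispersion estimate to the profile or to its opposite, according
     to the sign of the nonlinearity at [z0] *)
  have concl : eta * dz ^+ 4 <= f t ^+ 2 * (4 * M * dz ^+ 2 + 16 * M).
    have [q0'|q0'] := ltP 0 (c * ps z0 - 2^-1 * ps z0 ^+ 2).
      apply: (small_dispersion tP (ltW dz0) kt01) => z zz.
        by rewrite P0; case: (nl z zz).
      by rewrite PE; case: (nl z zz) => _; exact: half_norm_lower.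
    have tN : tower 4 (fun j x => - P j x).
      by move=> j x j4; exact: is_deriveN (tP j x j4).
    apply: (small_dispersion tN (ltW dz0) kt01) => z zz.
      by rewrite normrN P0; case: (nl z zz).
    by rewrite !mulrN -opprD PE; case: (nl z zz) => _; exact: half_norm_upper.
  have : f t ^+ 2 * (4 * M * dz ^+ 2 + 16 * M) <= f t * bnd.
    have B0 : 0 <= 4 * M * dz ^+ 2 + 16 * M.
      by apply: addr_ge0; apply: mulr_ge0; rewrite ?sqr_ge0 ?(ltW M0)// mulr_ge0// ltW.
    rewrite expr2 -mulrA; apply: ler_wpM2l; first exact: ltW.
    by apply: (le_trans (ler_piMl B0 (ltW kt1))); rewrite /bnd lerDl.
  move: ktb; rewrite ltr_pdivlMr// => h1 h2.
  by have := lt_le_trans h1 (le_trans concl h2); rewrite ltxx.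
have cps : continuous ps.
  move=> z; apply/cvgrPdist_lt => e e0.
  have [d d0 Hd] := joint (ts * a) z e (Da ts tsn) e0.
  apply/nbhs_ballP; exists d => // y; rewrite /ball/= => zy.
  by rewrite distrC; apply: Hd; [rewrite subrr normr0|rewrite distrC].
have cn0 : (0 : R) != 2 * c by rewrite lt_eqF// mulr_gt0.
have ps2 z : ps z = 0 \/ ps z = 2 * c.
  have /eqP := root z; have -> : c * ps z - 2^-1 * ps z ^+ 2 = 2^-1 * ps z * (2 * c - ps z) by field.
  rewrite mulf_eq0 mulf_eq0 invr_eq0 pnatr_eq0 /= => /orP[/eqP|]; first by left.
  by rewrite subr_eq0 => /eqP; right.
have psc := two_valued_constant cn0 cps ps2.
have [L [nu [L0 nu0 ev]]] := Hev ts ltac:(by rewrite ts0).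
rewrite -/(f ts) fts in ev.
exact: constant_potential_no_eigenvalue L0 nu0 psc ev.
Qed.

End WavenumberPositive.

Unset Implicit Arguments.
Local Open Scope complex_scope.

(** * Transverse instability *)

Theorem theorem3 (R : realType)
  (a0 c0 : R) (k : R -> R -> R) (p : R -> R -> R -> R)
  (Hper : periodic_family a0 c0 k p)
  (a1 M1 : R) (c2 a2 : R -> R) (tau : R -> R -> R -> R -> R)
  (h u : R -> R -> R -> R -> R -> R)
  (Hgsw : gen_solitary_waves a0 c0 (phi_of k p) a1 M1 c2 a2 tau h u)
  (c3 a3 : R) (Lam : R -> R -> R)
  (Hc3 : 0 < c3 <= c0) (Ha3 : 0 < a3 <= a0)
  (HLam : forall a c : R, - a3 < a < a3 -> a != 0 -> - c3 < c < c3 -> c != 0 ->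
     0 < Lam a c /\
     forall L : R, 0 < L < Lam a c ->
       exists nu : R, nu < 0 /\
         simple_eigenvalue (per_op L (k a c) c (p a c)) nu%:C)
  (l th : R) (Hl : 0 < l < pi) (Hth : 0 < th < 1)
  (c : R) (Hc : 0 < c <= c2 l) (Hcc3 : c < c3)
  (a : R) (Ha : a2 l * c * expR (- (l / Num.sqrt c)) <= `|a| <= a1)
  (Haa3 : `|a| < a3) :
  (forall L : R, 0 < L < Lam a c ->
     exists nu : R, nu < 0 /\
       ess_spectrum (line_op (k a c * L)%:C c (u l th a c)) nu%:C) /\
  transversely_essentially_unstable c (u l th a c).
Proof.
have [a10 M10 /(_ l th Hl Hth)[c20 a20 Hwaves _]] := Hgsw.
have [cp cc2] := andP Hc; have [c30 c3c0] := andP Hc3; have [a30 a3a0] := andP Ha3.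
have [th0 _] := andP Hth.
have cc0 : c < c0 by exact: lt_le_trans c3c0.
have aa0 : `|a| < a0 by exact: lt_le_trans a3a0.
have [wu _ uE dh hB] : [/\ line_wave c (u l th a c),
    (forall x, u l th a c (- x) = u l th a c x),
    (forall x, u l th a c x = h l th a c x +
      phi_of k p a c (x + tau l th a c * tanh (Num.sqrt c * x / 2))),
    (forall j x, (j < 3)%N -> derivable (derive1n j (h l th a c)) x 1) &
    (forall j x, (j <= 3)%N -> `|derive1n j (h l th a c) x| <=
       M1 * c * expR (- (th * Num.sqrt c * `|x|)))].
  by apply: Hwaves; split.
(* the lower bound on the amplitude is positive *)
have an0 : a != 0.
  rewrite -normr_gt0; have /andP[+ _] := Ha; apply: lt_le_trans.
  by rewrite !mulr_gt0// expR_gt0.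
have cn0 : c != 0 by rewrite gt_eqF.
have ccc : - c3 < c < c3 by rewrite Hcc3 andbT; lra.
have HL t : 0 < t <= 1 -> 0 < Lam (t * a) c /\ forall L, 0 < L < Lam (t * a) c ->
    exists nu : R, nu < 0 /\ simple_eigenvalue (per_op L (k (t * a) c) c (p (t * a) c)) nu%:C.
  move=> /andP[t0 t1]; apply: HLam => //; last by rewrite mulf_neq0// gt_eqF.
  rewrite -ltr_norml; apply: le_lt_trans Haa3.
  by rewrite normrM (gtr0_norm t0) ler_piMl.
(* the eigenvalue hypothesis holds at every amplitude [t a], not only at [a] *)
have kp : 0 < k a c.
  apply: (wavenumber_positive Hper) => //; first by rewrite cp.
  move=> t t01; have [Lt HLt] := HL t t01.
  have [L L01] := exists_lt_pos Lt.
  have [nu [nu0 [ev _]]] := HLt L L01.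
  by exists L, nu; split => //; have /andP[] := L01.
have pT z : p a c (z + 2 * pi) = p a c z.
  have [_ _ _ [_ HH] _] := Hper; have [] := HH a c; last by [].
  by split => //; rewrite gtr0_norm.
have wphi : line_wave c (phi_of k p a c).
  have [_ HH _ _ _] := Hper; have [] := HH a c; last by [].
  by split => //; rewrite gtr0_norm.
have main L : 0 < L < Lam a c -> exists nu : R, nu < 0 /\
    ess_spectrum (line_op (k a c * L)%:C c (u l th a c)) nu%:C.
  move=> L01; have [_] := HL 1 ltac:(by rewrite ltr01 lexx).
  rewrite mul1r => /(_ L L01)[nu [nu0 [ev _]]].
  exists (k a c ^+ 2 * nu); split; first by rewrite pmulr_rlt0// exprn_gt0.
  exact: (wave_ess_spectrum cp th0 kp (ltW M10) pT erefl wphi wu uE dh hB ev).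
split => //.
have [Lp _] := HL 1 ltac:(by rewrite ltr01 lexx); rewrite mul1r in Lp.
have [L L01] := exists_lt_pos Lp; have [nu [nu0 ess]] := main L L01.
(* the frequency with [- omega^2 = nu] *)
exists (k a c * L)%:C; split; first by rewrite /= mulr_gt0//; case/andP: L01.
exists (Num.sqrt (- nu)).
have -> : - Num.sqrt (- nu) ^+ 2 = nu by rewrite sqr_sqrtr ?opprK// oppr_ge0 ltW.
by [].
Qed.
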